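(* Assume $c_0=\ln(\bar p/\bar\delta)>2$ and $a>0$. For $d$ sufficiently large, let $\hat\tau_0=\hat\tau_0(d)$ be the first Hopf bifurcation value (defined in the context), at its unique positive steady state, of the model $$\begin{cases}\dfrac{\partial u}{\partial t}=d\Delta u+p(x)u(x,t-\hat\tau)e^{-au(x,t-\hat\tau)}-\delta(x)u(x,t), & x\in\Omega,\ t>0,\\ \partial_{\mathbf n}u=0,& x\in\partial\Omega,\ t>0.\end{cases}$$ Then $$\lim_{d\to\infty}\hat\tau_0(d)=\check\tau_0:=\frac{\theta_0}{h_0},$$ where $\theta_0\in[0,2\pi]$ and $h_0$ are given by $\cos\theta_0=\frac1{1-c_0}$, $\sin\theta_0=-\frac{\sqrt{c_0^2-2c_0}}{1-c_0}$, $h_0=\bar\delta\sqrt{c_0^2-2c_0}$, and $\check\tau_0$ is the first Hopf bifurcation value (with respect to the delay $\check\tau$, at the positive equilibrium) of the averaged delay differential equation $$u'(t)=\bar p\,u(t-\check\tau)e^{-au(t-\check\tau)}-\bar\delta\,u(t).$$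
   Context: $\Omega$ is a bounded domain with smooth boundary $\partial\Omega$, and $\mathbf n$ is the outward unit normal vector on $\partial\Omega$. The coefficients $p=p(x)$ and $\delta=\delta(x)$ are positive and spatially dependent, and all other parameters are positive constants; $\bar p=\frac1{|\Omega|}\int_\Omega p\,dx$, $\bar\delta=\frac1{|\Omega|}\int_\Omega\delta\,dx$; $f(u)=ue^{-u}$. Definition of $\hat\tau_0(d)$: put $r=1/d$, let $u_r$ be the unique positive solution of $\Delta u+rpf(u)-r\delta u=0$ in $\Omega$, $\partial_{\mathbf n}u=0$ on $\partial\Omega$, and let $X_1=\{y\in H^2(\Omega):\partial_{\mathbf n}y=0,\ \int_\Omega y\,dx=0\}$ with complexification $(X_1)_{\mathbb C}$. For $r>0$ small there is a unique $(z_r,\beta_r,h_r,\theta_r)$ with $z_r\in(X_1)_{\mathbb C}$, $\beta_r\ge0$, $h_r>0$, $\theta_r\in[0,2\pi)$ solving $$\Delta z+\left(e^{-\mathrm i\theta}pf'(u_r)-\delta-\mathrm ih\right)(\beta c_0+rz)=0,\qquad(\beta^2-1)c_0^2|\Omega|+r^2\|z\|_{L^2}^2=0.$$ Then $\tau_0=\theta_r/(rh_r)$ is the first Hopf bifurcation value for the rescaled model $\partial_tu=\Delta u+rpf(u(x,t-\tau))-r\delta u$ with $\partial_{\mathbf n}u=0$ on $\partial\Omega$ (obtained by $\tilde u=au$, $\tilde t=dt$, $r=1/d$, $\tau=d\hat\tau$), and $\hat\tau_0(d)=\tau_0/d$. The positive steady state of the model with parameter $d$ is locally asymptotically stable for $0\le\hat\tau<\hat\tau_0(d)$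 and unstable for $\hat\tau>\hat\tau_0(d)$. *)

(* Defs.v *)
From HB Require Import structures.
From mathcomp Require Import all_boot all_order all_algebra.
From mathcomp Require Import all_classical all_reals all_analysis.
From mathcomp Require Import complex.

Set Implicit Arguments.
Unset Strict Implicit.
Unset Printing Implicit Defensive.
Import Order.TTheory GRing.Theory Num.Theory.
Import numFieldNormedType.Exports.

Local Open Scope classical_set_scope.
Local Open Scope ring_scope.

(* R^n is 'rV[R]_n, with the sigma-algebra generated by the n coordinate maps,
   i.e. its Borel sigma-algebra. *)
Definition measure_rV_display : measure_display.
Proof. exact. Qed.

Section measurable_rV.
Context {R : realType} (n : nat).

Definition coord_rV (i : 'I_n) (x : 'rV[R]_n) : measurableTypeR R := x ord0 i.

Let rV_set0 : g_sigma_preimage coord_rV set0.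
Proof. exact: sigma_algebra0. Qed.

Let rV_setC A : g_sigma_preimage coord_rV A -> g_sigma_preimage coord_rV (~` A).
Proof. exact: sigma_algebraC. Qed.

Let rV_bigcup (F : _^nat) : (forall i, g_sigma_preimage coord_rV (F i)) ->
  g_sigma_preimage coord_rV (\bigcup_i (F i)).
Proof. exact: sigma_algebra_bigcup. Qed.

HB.instance Definition _ := @isMeasurable.Build measure_rV_display
  'rV[R]_n (g_sigma_preimage coord_rV) rV_set0 rV_setC rV_bigcup.

End measurable_rV.

Lemma measurable_coord_rV (R : realType) n (i : 'I_n) :
  measurable_fun [set: 'rV[R]_n] (coord_rV i).
Proof.
move=> _ Y mY; rewrite setTI; apply: sub_sigma_algebra => /=.
rewrite -bigcup_seq/=; exists i => /=; first by rewrite mem_index_enum.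
by exists Y => //; rewrite setTI.
Qed.

Lemma measurable_fun_rVP (R : realType) n d (T : measurableType d)
    (f : T -> 'rV[R]_n) :
  (forall i, measurable_fun [set: T] (coord_rV i \o f)) ->
  measurable_fun [set: T] f.
Proof.
move=> mf.
suff prefS : g_sigma_preimage (fun i => coord_rV i \o f) `<=` measurable.
  move=> _ A mA; apply: prefS.
  by rewrite g_sigma_preimage_comp; exists A.
apply: smallest_sub; first exact: sigma_algebra_measurable.
case: n f mf => [|m] f mf; first by rewrite big_ord0.
rewrite -bigcup_mkord_ord; apply: bigcup_sub => i Ii.
by move=> A [B mB <-]; exact: mf.
Qed.

Section lebesgue_rV.
Context {R : realType}.

Definition cons_rV n (p : measurableTypeR R * 'rV[R]_n) : 'rV[R]_n.+1 :=
  \row_i oapp (p.2 ord0) p.1 (unlift ord0 i).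

Definition uncons_rV n (x : 'rV[R]_n.+1) : measurableTypeR R * 'rV[R]_n :=
  (x ord0 ord0, \row_j x ord0 (lift ord0 j)).

Lemma cons_rVK n : cancel (@cons_rV n) (@uncons_rV n).
Proof.
move=> [x v]; rewrite /cons_rV /uncons_rV/= mxE unlift_none; congr pair.
by apply/rowP => j; rewrite !mxE liftK.
Qed.

Lemma measurable_cons_rV n : measurable_fun setT (@cons_rV n).
Proof.
apply: measurable_fun_rVP => i.
case: (unliftP ord0 i) => [j|] ->.
  rewrite (_ : _ \o _ = coord_rV j \o snd).
    by apply: measurableT_comp => //; exact: measurable_coord_rV.
  by apply/funext => -[x v]; rewrite /= /coord_rV /cons_rV mxE liftK.
rewrite (_ : _ \o _ = fst) //.
by apply/funext => -[x v]; rewrite /= /coord_rV /cons_rV mxE unlift_none.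
Qed.

Lemma measurable_uncons_rV n : measurable_fun setT (@uncons_rV n).
Proof.
apply: measurable_fun_pair; first exact: (measurable_coord_rV ord0).
apply: measurable_fun_rVP => j.
rewrite (_ : _ \o _ = coord_rV (lift ord0 j)); last first.
  by apply/funext => x; rewrite /= /coord_rV mxE.
exact: measurable_coord_rV.
Qed.

Section step.
Context n (m : {sigma_finite_measure set 'rV[R]_n -> \bar R}).

Definition lebesgue_rV_step : set 'rV[R]_n.+1 -> \bar R :=
  pushforward (@lebesgue_measure R \x m)%E (@cons_rV n).

Let step0 : lebesgue_rV_step set0 = 0%E.
Proof. by rewrite /lebesgue_rV_step /pushforward preimage_set0 measure0. Qed.

Let step_ge0 A : (0 <= lebesgue_rV_step A)%E.
Proof. by rewrite /lebesgue_rV_step /pushforward; apply: measure_ge0. Qed.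

Let step_sigma_additive : semi_sigma_additive lebesgue_rV_step.
Proof.
have mcons F : measurable F -> measurable (@cons_rV n @^-1` F).
  by move=> mF; rewrite -[X in measurable X]setTI; exact: measurable_cons_rV.
move=> F mF tF mUF; rewrite /lebesgue_rV_step /pushforward preimage_bigcup.
apply: measure_semi_sigma_additive.
- by move=> k; exact: mcons.
- apply/trivIsetP => /= i j _ _ ij; rewrite -preimage_setI.
  by move/trivIsetP : tF => /(_ _ _ _ _ ij) ->//; rewrite preimage_set0.
- by rewrite -preimage_bigcup; exact: mcons.
Qed.

HB.instance Definition _ := isMeasure.Build _ _ _ lebesgue_rV_step
  step0 step_ge0 step_sigma_additive.

Let lebesgue_rV_step_sigma_finite : sigma_finite setT lebesgue_rV_step.
Proof.
have /sigma_finiteP[F [TF ndF Foo]] := sigma_finiteT (@lebesgue_measure R).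
have /sigma_finiteP[G [TG ndG Goo]] := sigma_finiteT m.
exists (fun k => @uncons_rV n @^-1` (F k `*` G k)).
  rewrite -preimage_bigcup -[LHS](@preimage_setT _ _ (@uncons_rV n)).
  congr (_ @^-1` _); rewrite -setXTT TF TG predeqE => -[x y]; split.
    move=> [/= [i _ Fix] [k _ Gky]]; exists (maxn i k) => //; split.
    - by move: x Fix; exact/subsetPset/ndF/leq_maxl.
    - by move: y Gky; exact/subsetPset/ndG/leq_maxr.
  by move=> [k _ []/= ? ?]; split; exists k.
move=> k; have [? ?] := Foo k; have [? ?] := Goo k; split.
  rewrite -[X in measurable X]setTI.
  by apply: measurable_uncons_rV => //; exact: measurableX.
rewrite /lebesgue_rV_step /pushforward -comp_preimage.
rewrite (_ : _ \o _ = id); last by apply/funext => x; exact: cons_rVK.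
by rewrite preimage_id product_measure1E// lte_mul_pinfty// ge0_fin_numE.
Qed.

HB.instance Definition _ := Measure_isSigmaFinite.Build _ _ _ lebesgue_rV_step
  lebesgue_rV_step_sigma_finite.

End step.

(* Lebesgue measure on R^n: the n-fold product of the one on R. *)
Fixpoint lebesgue_rV (n : nat) : {sigma_finite_measure set 'rV[R]_n -> \bar R} :=
  if n is k.+1 then lebesgue_rV_step (lebesgue_rV k) else \d_(0 : 'rV[R]_0).

End lebesgue_rV.

Section domains.
Context {R : realType} {n : nat}.
Implicit Types (f : 'rV[R]_n -> R) (x : 'rV[R]_n).

Definition partial (i : 'I_n) f x : R := 'D_(delta_mx ord0 i) f x.

Definition smooth f : Prop := forall s : seq 'I_n,
  continuous (foldr partial f s) /\
  forall i x, derivable (foldr partial f s) x (delta_mx ord0 i).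

Definition gradient f x : 'rV[R]_n := \row_i partial i f x.

(* The norm `|x| of the library on 'rV[R]_n is the sup norm. *)
Definition euclidean_norm x : R := Num.sqrt (\sum_i x ord0 i ^+ 2).

Definition defining_function (Omega : set 'rV[R]_n) (rho : 'rV[R]_n -> R) :=
  [/\ smooth rho, Omega = [set x | rho x < 0] &
      forall x, rho x = 0 -> gradient rho x != 0].

(* A bounded open connected set with C^oo boundary; by the implicit function
   theorem, [defining_function Omega rho] makes [set x | rho x = 0] the boundary
   of Omega and a smooth hypersurface with Omega on one side. *)
Definition smooth_bounded_domain (Omega : set 'rV[R]_n) : Prop :=
  [/\ Omega !=set0, open Omega, connected Omega, bounded_set Omega &
      exists rho, defining_function Omega rho].

Definition boundary (Omega : set 'rV[R]_n) := closure Omega `\` Omega°.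

Definition outward_unit_normal (Omega : set 'rV[R]_n) x (nu : 'rV[R]_n) : Prop :=
  exists2 rho, defining_function Omega rho &
    nu = (euclidean_norm (gradient rho x))^-1 *: gradient rho x.

End domains.

Section sobolev.
Context {R : realType} {n : nat} (Omega : set 'rV[R]_n).
Implicit Types (y g phi : 'rV[R]_n -> R).

Local Notation mu := (@lebesgue_rV R n).

Definition test_function phi : Prop :=
  [/\ smooth phi, compact (closure [set x | phi x != 0]) &
      closure [set x | phi x != 0] `<=` Omega].

Definition L2 y : Prop :=
  measurable_fun Omega y /\ (\int[mu]_(x in Omega) ((y x) ^+ 2)%:E < +oo)%E.

Definition L2sqnorm y : R := \int[mu]_(x in Omega) (y x ^+ 2).

Definition is_weak_partial (i : 'I_n) y g : Prop :=
  L2 g /\ forall phi, test_function phi ->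
    \int[mu]_(x in Omega) (y x * partial i phi x) =
    - \int[mu]_(x in Omega) (g x * phi x).

(* The weak derivative (a representative of its a.e.-class), junk if none. *)
Definition weak_partial (i : 'I_n) y : 'rV[R]_n -> R :=
  get (is_weak_partial i y).

Definition H1 y : Prop :=
  L2 y /\ forall i, exists g, is_weak_partial i y g.

Definition H2 y : Prop := H1 y /\ forall i, H1 (weak_partial i y).

Definition laplacian y x : R :=
  \sum_i weak_partial i (weak_partial i y) x.

(* The closure of the test functions in H^1, i.e. the H^1 functions with zero
   trace on the boundary. *)
Definition H10 y : Prop := H1 y /\
  forall e : R, 0 < e -> exists2 phi, test_function phi &
    L2sqnorm (y \- phi) +
    \sum_i L2sqnorm (weak_partial i y \- partial i phi) < e.

(* For y in H^2 the normal derivative on the boundary is the trace of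
   nu . grad y, where nu is any smooth field extending the outward unit normal;
   the trace does not depend on the extension. *)
Definition neumann y : Prop :=
  forall nu : 'I_n -> 'rV[R]_n -> R,
    (forall i, smooth (nu i)) ->
    (forall x, boundary Omega x ->
       outward_unit_normal Omega x (\row_i nu i x)) ->
    H10 (fun x => \sum_i nu i x * weak_partial i y x).

Definition volume : R := fine (mu Omega).

Definition mean y : R := volume^-1 * \int[mu]_(x in Omega) y x.

Definition X1 y : Prop :=
  [/\ H2 y, neumann y & \int[mu]_(x in Omega) y x = 0].

Definition X1C (z : 'rV[R]_n -> R[i]) : Prop :=
  X1 (fun x => complex.Re (z x)) /\ X1 (fun x => complex.Im (z x)).

Definition laplacianC (z : 'rV[R]_n -> R[i]) x : R[i] :=
  Complex (laplacian (fun x => complex.Re (z x)) x)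
          (laplacian (fun x => complex.Im (z x)) x).

Definition L2sqnormC (z : 'rV[R]_n -> R[i]) : R :=
  L2sqnorm (fun x => complex.Re (z x)) + L2sqnorm (fun x => complex.Im (z x)).

End sobolev.

Definition cexp {R : realType} (z : R[i]) : R[i] :=
  (expR (complex.Re z))%:C%C *
  Complex (cos (complex.Im z)) (sin (complex.Im z)).

Section delayed_diffusion.
Context {R : realType} {n : nat} (Omega : set 'rV[R]_n)
  (p delta : 'rV[R]_n -> R).

Definition nicholson (u : R) : R := u * expR (- u).

(* Positive solutions of d * Laplacian u + g(x, u) = 0 with zero Neumann data.
   They are strong solutions in H^2: for merely continuous p and delta a second
   derivative need not exist pointwise. *)
Definition positive_solution (d : R) (g : 'rV[R]_n -> R -> R)
    (u : 'rV[R]_n -> R) : Prop :=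
  [/\ H2 Omega u, neumann Omega u,
      {ae @lebesgue_rV R n, forall x, Omega x -> 0 < u x} &
      {ae @lebesgue_rV R n, forall x, Omega x ->
        d * laplacian Omega u x + g x (u x) = 0}].

Definition hopf_system (r : R) (u : 'rV[R]_n -> R) (z : 'rV[R]_n -> R[i])
    (beta h theta : R) : Prop :=
  let c0 := ln (mean Omega p / mean Omega delta) in
  [/\ X1C Omega z, 0 <= beta, 0 < h, 0 <= theta < 2 * pi &
      {ae @lebesgue_rV R n, forall x, Omega x ->
        laplacianC Omega z x +
        (cexp (Complex 0 (- theta)) * (p x * derive1 nicholson (u x))%:C%C
           - (delta x)%:C%C - Complex 0 h) *
        ((beta * c0)%:C%C + r%:C%C * z x) = 0} /\
      (beta ^+ 2 - 1) * c0 ^+ 2 * volume Omega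
        + r ^+ 2 * L2sqnormC Omega z = 0].

(* tau is the first Hopf bifurcation value of
     u_t = d * Laplacian u + p u(t - tau) e^(- a u(t - tau)) - delta u
   at its positive steady state us.  With r = 1/d, the substitution u := a u,
   t := d t turns us into the positive steady state ur = a us of
     u_t = Laplacian u + r p f(u(t - tau')) - r delta u,   tau' = d tau,
   whose first Hopf bifurcation value is theta / (r h). *)
Definition diffusive_first_hopf_value (a d tau : R) : Prop :=
  let r := d^-1 in
  exists us ur z beta h theta,
    [/\ positive_solution d
          (fun x v => p x * v * expR (- (a * v)) - delta x * v) us,
        positive_solution 1
          (fun x v => r * p x * nicholson v - r * delta x * v) ur,
        ur = (fun x => a * us x),
        hopf_system r ur z beta h theta &
        tau = theta / (r * h) / d].

End delayed_diffusion.

(* The scalar delay equation u'(t) = F (u(t)) (u(t - tau)). *)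
Section scalar_dde.
Context {R : realType} (F : R -> R -> R).

Definition positive_equilibrium (us : R) : Prop := 0 < us /\ F us us = 0.

Variable us : R.

(* Linearization v'(t) = A v(t) + B v(t - tau) at us, and its characteristic
   function. *)
Let A : R := derive1 (F^~ us) us.
Let B : R := derive1 (F us) us.

Definition characteristic (tau : R) (l : R[i]) : R[i] :=
  l - A%:C%C - B%:C%C * cexp (- (l * tau%:C%C)).

Definition eigenvalue (tau : R) (l : R[i]) : Prop := characteristic tau l = 0.

(* The second conjunct: the l-derivative of the characteristic function does
   not vanish. *)
Definition simple_eigenvalue (tau : R) (l : R[i]) : Prop :=
  eigenvalue tau l /\ 1 + (tau * B)%:C%C * cexp (- (l * tau%:C%C)) != 0.

(* Hopf bifurcation point: a simple pair +-i w, w > 0, no other eigenvalue on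
   the imaginary axis, and the branch of eigenvalues through i w crosses the
   axis with nonzero speed as the delay varies. *)
Definition hopf_value (tau : R) : Prop :=
  exists w : R,
    [/\ 0 < tau, 0 < w, simple_eigenvalue tau (Complex 0 w),
        forall s : R, eigenvalue tau (Complex 0 s) -> s = w \/ s = - w &
        exists l : R -> R[i],
          [/\ l tau = Complex 0 w, \forall t \near tau, eigenvalue t (l t),
              derivable (fun t => complex.Im (l t)) tau 1,
              derivable (fun t => complex.Re (l t)) tau 1 &
              derive1 (fun t => complex.Re (l t)) tau != 0]].

(* First: for every smaller delay all eigenvalues lie in the open left
   half-plane (so that no smaller delay is a Hopf bifurcation value). *)
Definition first_hopf_value (tau : R) : Prop :=
  hopf_value tau /\
  forall t l, 0 <= t < tau -> eigenvalue t l -> complex.Re l < 0.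

End scalar_dde.

(* Main.v *)
(** As d -> oo, diffusion makes the steady state and the eigenfunction nearly
    constant. Testing the equations with their own solutions bounds the energies
    |grad u|^2 and r |grad z|^2 in terms of r = 1/d, and the Poincare inequality
    turns this into |u - mean u|^2 = O(r) and |r z|^2 = O(r). The Neumann
    condition gives a Green identity, so the averages of the equations over
    Omega hold without the Laplacian. Up to O(sqrt r), they say that
    pbar e^(-m) = dbar for m = mean u, hence m -> c0, and that theta and h
    satisfy cos theta X = dbar and sin theta X = - h with
    X = pbar e^(-m) (1 - m) -> dbar (1 - c0), which determines their limits.

    The Green identity and the Poincare inequality are proved in the weak
    setting, from difference quotients and from cutoff functions of the defining
    function rho: near the boundary one integrates by parts against multiples of
    grad rho, and in the interior the inequality spreads from balls to compact
    sets by connectedness.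

    For the delay equation, an eigenvalue l satisfies |l + dbar| = b e^(-t Re l)
    with b = dbar (c0 - 1), which excludes Re l >= 0 as long as t < theta0 / h0,
    and the branch through i h0 is parametrized by the phase of l + dbar. *)

Require Import Defs.
From HB Require Import structures.
From mathcomp Require Import all_boot all_order all_algebra.
From mathcomp Require Import all_classical all_reals all_analysis.
From mathcomp Require Import complex ring lra zify measurable_realfun.

Set Implicit Arguments.
Unset Strict Implicit.
Unset Printing Implicit Defensive.
Import Order.TTheory GRing.Theory Num.Theory.
Import numFieldNormedType.Exports.

Local Open Scope classical_set_scope.
Local Open Scope ring_scope.

(** * Smooth functions *)

(** The obstacle is the weak setting. [neumann] only says that nu . grad y lies in the closure of
    the test functions, so neither traces nor boundary integrals are at hand. Boundary terms are
    removed by cutoffs that depend on x through [rho] alone. Their gradients grow like 1/|rho|, but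
    they are multiples of grad rho, so that only normal components meet them; each such product is
    arranged to contain a further factor [rho], and dominated convergence applies. Smoothing is
    replaced by duality: an L^2 norm is a supremum of pairings with test functions, and in a pairing
    a translation can be moved to the smooth factor. This bounds the difference quotients,
    identifies their weak limit, and yields integration by parts between two functions that are both
    only weakly differentiable. The Poincare inequality is built without a compact embedding. The
    bound on difference quotients handles small balls, overlaps carry it to unions, and a thin
    collar of the boundary holds at most half of the squared deviation up to an energy term, so it
    is absorbed on the left. *)

Lemma is_derive_comp1 (R : realType) (V : normedModType R) (f : V -> R)
    (g : R -> R) (x v : V) (df dg : R) :
  is_derive x v f df -> is_derive (f x) 1 g dg ->
  is_derive x v (g \o f) (dg * df).
Proof.
move=> [fx fE] [gx gE].
(* On the line through [x] in direction [v] everything becomes a one-variable chain rule; [f] need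
   only have a derivative along [v]. *)
pose fl (h : R) := f (h *: v + x).
have fl0 : fl 0 = f x by rewrite /fl scale0r add0r.
have flx : derivable fl 0 1 by apply: (derivable1P _ _ _).1.
have gfx : derivable g (fl 0) 1 := ltac:(rewrite fl0; exact: gx).
have line (k : V -> R) : 'D_v k x = derive1 (fun h : R => k (h *: v + x)) 0.
  rewrite derive1E /derive; apply: (f_equal (fun F : R -> R => lim (F @ 0^'))).
  by apply/funext => h /=; rewrite addr0 scale0r add0r [_%:A]mulr1.
have dfl : is_derive (0 : R) (1 : R) fl df.
  by apply: DeriveDef; [exact: flx|rewrite -derive1E -line].
have dg0 : is_derive (fl 0) (1 : R) g dg by apply: DeriveDef => //; rewrite fl0.
have [gflx gflE] := is_derive1_comp dg0 dfl.
apply: DeriveDef; first exact/(derivable1P _ _ _).2.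
by rewrite line derive1E.
Qed.

Lemma continuous_addf (R : realType) (T : topologicalType) (f g : T -> R) :
  continuous f -> continuous g -> continuous (fun x => f x + g x).
Proof. by move=> cf cg x; apply: cvgD; [exact: cf|exact: cg]. Qed.

Lemma continuous_mulf (R : realType) (T : topologicalType) (f g : T -> R) :
  continuous f -> continuous g -> continuous (fun x => f x * g x).
Proof. by move=> cf cg x; apply: cvgM; [exact: cf|exact: cg]. Qed.

Lemma continuous_addr (R : realType) (V : normedModType R) (s : V) :
  continuous (fun y => y + s).
Proof. by move=> y; apply: cvgD; [exact: cvg_id|exact: cvg_cst]. Qed.

Section gamma.
Context {R : realType}.

(* The functions t^-k e^(-1/t), t > 0, are closed under derivation, which makes
   each of them smooth when extended by 0. *)
Definition gamma (k : nat) (t : R) : R :=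
  if 0 < t then t ^- k * expR (- t^-1) else 0.

Lemma gamma_ge0 k t : 0 <= gamma k t.
Proof.
rewrite /gamma; case: ifP => // t0.
by rewrite mulr_ge0 ?expR_ge0// invr_ge0 exprn_ge0// ltW.
Qed.

Lemma gamma_le0 k t : t <= 0 -> gamma k t = 0.
Proof. by rewrite /gamma ltNge => ->. Qed.

(** The exponential series gives e^(1/t) >= t^-(k+1) / (k+1)! for t > 0. Used with k + 1 in place of
    k, the linear bound makes the difference quotient of [gamma k] at 0 vanish. *)
Lemma gamma_bound k t : gamma k t <= k.+1`!%:R * `|t|.
Proof.
rewrite /gamma; case: ifP => [t0|_]; last by rewrite mulr_ge0.
have tn0 : t != 0 by rewrite gt_eqF.
rewrite gtr0_norm// expRN.
have kf : 0 < k.+1`!%:R :> R by rewrite ltr0n fact_gt0.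
have h : t^-1 ^+ k.+1 / k.+1`!%:R <= expR t^-1.
  apply: (le_trans _ (@expR_ge1Dxn R t^-1 k _)); last by rewrite invr_ge0 ltW.
  by rewrite lerDr.
rewrite ler_pdivrMr ?expR_gt0//.
have h2 : t^-1 ^+ k.+1 / k.+1`!%:R * (k.+1`!%:R * t) <= expR t^-1 * (k.+1`!%:R * t).
  by rewrite ler_pM2r// mulr_gt0.
apply: le_trans (le_trans h2 _); last by rewrite mulrC.
by rewrite mulrA divfK ?gt_eqF// exprSr -mulrA mulVf// mulr1 exprVn.
Qed.

Lemma gammaS k t : gamma k.+1 t * t = gamma k t.
Proof.
rewrite /gamma; case: ifP => [t0|]; last by rewrite mul0r.
by rewrite mulrAC exprSr invfM mulfVK ?gt_eqF.
Qed.

Lemma is_derive_gamma k (t : R) :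
  is_derive t (1 : R) (gamma k) (gamma k.+2 t - k%:R * gamma k.+1 t).
Proof.
have [t0|t0|->] := ltgtP t 0.
- rewrite !gamma_le0 ?(ltW t0)// mulr0 subr0.
  apply: (@near_eq_is_derive _ _ _ (cst 0)) => //.
    near=> s; rewrite gamma_le0// ltW//; near: s.
    exact: lt_nbhsl.
- apply: (@near_eq_is_derive R R R (fun t : R => t ^- k * expR (- t^-1))).
    near=> s; rewrite /gamma ifT//; near: s.
    exact: lt_nbhsr.
  have tn0 : t != 0 by rewrite gt_eqF.
  have dV : is_derive t (1:R) (fun t : R => - t^-1) (t ^- 2).
    apply: is_derive_eq; first by apply: is_deriveN; apply: is_deriveV.
    by rewrite scaleNr opprK [_ *: _]mulr1.
  have dE : is_derive t 1 (expR \o (fun t : R => - t^-1)) (expR (- t^-1) * t ^- 2).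
    by apply: is_derive_comp1; apply: is_derive_expR.
  have dX : is_derive t (1:R) (fun t : R => t ^- k) (- t ^- (k.*2) * (k%:R * t ^+ k.-1)).
    have tk : t ^+ k != 0 by rewrite expf_neq0.
    have dk : derivable (fun t : R => t ^+ k) t 1 by exact: exprn_derivable.
    apply: DeriveDef; first exact: derivableV.
    rewrite deriveV// exp_derive -exprM muln2 /GRing.scale/=.
    by rewrite mulr1.
  have dM : is_derive t (1 : R) (fun t : R => t ^- k * expR (- t^-1)) _ :=
    is_deriveM dX dE.
  case: dM => dM1 dM2; apply: DeriveDef; first exact: dM1.
  rewrite dM2.
  rewrite /gamma t0 /= /GRing.scale/=.
  clear dM1 dM2 dX; case: k => [|k].
    by rewrite !mul0r mulr0 subr0 !mulr0 addr0 expr0 invr1 mul1r mulrC.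
  have -> : t ^- k.+1.*2 = t ^- k.+2 * t ^- k.
    by rewrite -invfM -exprD; congr (_ ^+ _)^-1; rewrite -addnn; lia.
  have tk : t ^+ k != 0 by rewrite expf_neq0.
  rewrite /= !exprS; set E := expR _; set T := t ^+ k in tk *.
  by rewrite expr0 mulr1; field; rewrite tk tn0.
- rewrite !gamma_le0// mulr0 subr0.
  have h : h^-1 *: (gamma k (h *: 1 + 0) - gamma k 0) @[h --> (0:R)^'] --> (0:R).
    apply/cvgr0Pnorm_lt => e e0.
    have kf : 0 < k.+2`!%:R :> R by rewrite ltr0n fact_gt0.
    near=> h.
    rewrite addr0 [_ *: 1]mulr1 (@gamma_le0 k 0)// subr0 /GRing.scale/=.
    have hn0 : h != 0 by near: h; exact: nbhs_dnbhs_neq.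
    (* The quotient [gamma k h / h] is [gamma k.+1 h], which is O(h). *)
    rewrite -gammaS mulrC mulfK//.
    rewrite ger0_norm ?gamma_ge0// (le_lt_trans (gamma_bound _ _))//.
    rewrite mulrC -ltr_pdivlMr//.
    near: h; apply: dnbhs0_lt; exact: divr_gt0.
  apply: DeriveDef; first by apply/cvg_ex; exists 0.
  by apply/cvg_lim.
Unshelve. all: end_near. Qed.

End gamma.

(** * Closure properties of smooth functions *)

Section smooth_calculus.
Context {R : realType} {n : nat}.
Implicit Types f g : 'rV[R]_n -> R.

(** [smooth] speaks of all iterated partial derivatives, so a direct treatment of products would
    need a Leibniz rule for words. This family is stable under one partial derivative
    ([smooth_expr_spec]), and an induction on the word then gives [smooth_exprP]. Stability is why
    all indices of [gamma] and all real exponents occur. *)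
Inductive smooth_expr : ('rV[R]_n -> R) -> Prop :=
| SmoothBase f : smooth f -> smooth_expr f
| SmoothCst (c : R) : smooth_expr (cst c)
| SmoothAdd f g : smooth_expr f -> smooth_expr g ->
    smooth_expr (fun x => f x + g x)
| SmoothMul f g : smooth_expr f -> smooth_expr g ->
    smooth_expr (fun x => f x * g x)
| SmoothExp f : smooth_expr f -> smooth_expr (fun x => expR (f x))
| SmoothGamma k f : smooth_expr f -> smooth_expr (fun x => gamma k (f x))
| SmoothPow (a : R) f : smooth_expr f -> (forall x, 0 < f x) ->
    smooth_expr (fun x => f x `^ a).

Lemma smooth_continuous f : smooth f -> continuous f.
Proof. by move=> /(_ [::])[]. Qed.

Lemma smooth_derivable f i x : smooth f -> derivable f x (delta_mx ord0 i).
Proof. by move=> /(_ [::])[]. Qed.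

Lemma smooth_partial f i : smooth f -> smooth (partial i f).
Proof. by move=> sf s; have := sf (rcons s i); rewrite foldr_rcons. Qed.

Lemma smooth_is_derive f i x : smooth f ->
  is_derive x (delta_mx ord0 i) f (partial i f x).
Proof. by move=> sf; apply: DeriveDef => //; exact: smooth_derivable. Qed.

Lemma continuous_is_derive_comp (g dg : R -> R) :
  (forall x : R, is_derive x (1 : R) g (dg x)) -> continuous g.
Proof.
by move=> dgE x; apply: differentiable_continuous; apply/derivable1_diffP; case: (dgE x).
Qed.

Lemma smooth_expr_spec f : smooth_expr f -> continuous f /\
  forall i, exists2 f', smooth_expr f' &
    forall x, is_derive x (delta_mx ord0 i) f (f' x).
Proof.
elim=> {f} [f sf|c|f g _ [cf df] _ [cg dg]|f g sf [cf df] sg [cg dg]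
    |f sf [cf df]|k f sf [cf df]|a f sf [cf df] f0].
- split; first exact: smooth_continuous.
  move=> i; exists (partial i f) => [|x]; last exact: smooth_is_derive.
  exact/SmoothBase/smooth_partial.
- split; [exact: cst_continuous|move=> i].
  exists (cst 0) => [|x]; [exact: SmoothCst|exact: is_derive_cst].
- split; [exact: continuous_addf|move=> i].
  have [f' sf' f'E] := df i; have [g' sg' g'E] := dg i.
  exists (fun x => f' x + g' x) => [|x]; first exact: SmoothAdd.
  exact: is_deriveD.
- split; [exact: continuous_mulf|move=> i].
  have [f' sf' f'E] := df i; have [g' sg' g'E] := dg i.
  exists (fun x => f x * g' x + g x * f' x) => [|x].
    by apply: SmoothAdd; exact: SmoothMul.
  exact: is_deriveM.
- split; [move=> x|move=> i].
    by apply: (@continuous_comp _ _ _ f expR); [exact: cf|exact: continuous_expR].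
  have [f' sf' f'E] := df i.
  exists (fun x => expR (f x) * f' x) => [|x].
    by apply: SmoothMul => //; exact: SmoothExp.
  by apply: is_derive_comp1; exact: is_derive_expR.
- split; [move=> x|move=> i].
    apply: (@continuous_comp _ _ _ f (gamma k)); first exact: cf.
    exact: (continuous_is_derive_comp (is_derive_gamma k)).
  have [f' sf' f'E] := df i.
  exists (fun x => (gamma k.+2 (f x) + (- k%:R) * gamma k.+1 (f x)) * f' x) => [|x].
    apply: SmoothMul => //; apply: SmoothAdd; first exact: SmoothGamma.
    by apply: (SmoothMul (SmoothCst (- k%:R))); exact: SmoothGamma.
  rewrite mulNr; apply: is_derive_comp1; exact: is_derive_gamma.
- have pE x : is_derive (f x) (1:R) (fun y => y `^ a) (a * f x `^ (a - 1)).
    have fx : f x \in `]0, +oo[ by rewrite in_itv/= f0.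
    apply: DeriveDef; first exact: derivable_powR.
    by rewrite -derive1E powR_derive1.
  split; [move=> x|move=> i].
    apply: (@continuous_comp _ _ _ f (fun y => y `^ a)); first exact: cf.
    by apply: differentiable_continuous; apply/derivable1_diffP; case: (pE x).
  have [f' sf' f'E] := df i.
  exists (fun x => (a * f x `^ (a - 1)) * f' x) => [|x].
    by apply: SmoothMul => //; apply: (SmoothMul (SmoothCst a)); exact: SmoothPow.
  exact: is_derive_comp1.
Qed.

Lemma smooth_exprP f : smooth_expr f -> smooth f.
Proof.
(* The induction runs from the end of the word, whose last letter is the derivative applied
   first. *)
have key s : forall f, smooth_expr f -> smooth_expr (foldr partial f s).
  elim/last_ind: s => //= s i IH {}f sf; rewrite foldr_rcons; apply: IH.
  have [_ /(_ i)[f' sf' f'E]] := smooth_expr_spec sf.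
  suff -> : partial i f = f' by [].
  by apply/funext => x; rewrite /partial; case: (f'E x).
move=> sf s; have [cf df] := smooth_expr_spec (key s _ sf); split=> // i x.
by have [f' _ /(_ x)[]] := df i.
Qed.

Lemma smooth_cst (c : R) : smooth (cst c : 'rV[R]_n -> R).
Proof. exact/smooth_exprP/SmoothCst. Qed.

Lemma smoothD f g : smooth f -> smooth g -> smooth (fun x => f x + g x).
Proof. by move=> sf sg; apply/smooth_exprP/SmoothAdd; exact: SmoothBase. Qed.

Lemma smoothM f g : smooth f -> smooth g -> smooth (fun x => f x * g x).
Proof. by move=> sf sg; apply/smooth_exprP/SmoothMul; exact: SmoothBase. Qed.

Lemma smoothZ c f : smooth f -> smooth (fun x => c * f x).
Proof. by move=> sf; exact: (@smoothM (cst c) f (smooth_cst c) sf). Qed.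

Lemma smooth_expRc f : smooth f -> smooth (fun x => expR (f x)).
Proof. by move=> sf; apply/smooth_exprP/SmoothExp; exact: SmoothBase. Qed.

Lemma smooth_gamma k f : smooth f -> smooth (fun x => gamma k (f x)).
Proof. by move=> sf; apply/smooth_exprP/SmoothGamma; exact: SmoothBase. Qed.

Lemma smooth_powR a f : smooth f -> (forall x, 0 < f x) ->
  smooth (fun x => f x `^ a).
Proof. by move=> sf f0; apply/smooth_exprP/SmoothPow => //; exact: SmoothBase. Qed.

Lemma smooth_sum (I : Type) (s : seq I) (F : I -> 'rV[R]_n -> R) :
  (forall i, smooth (F i)) -> smooth (fun x => \sum_(i <- s) F i x).
Proof.
move=> sF; elim: s => [|i s IH].
  by rewrite (_ : (fun x => _) = cst 0); [exact: smooth_cst|apply/funext => x; rewrite big_nil].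
rewrite (_ : (fun x => _) = (fun x => F i x + \sum_(j <- s) F j x)).
  exact: (@smoothD (F i) (fun x => \sum_(j <- s) F j x) (sF i) IH).
by apply/funext => x; rewrite big_cons.
Qed.

Lemma partialM i f g x : smooth f -> smooth g ->
  partial i (fun x => f x * g x) x = f x * partial i g x + g x * partial i f x.
Proof.
move=> sf sg; have := smooth_is_derive i x sf; have := smooth_is_derive i x sg.
by move=> hg hf; have [_] := is_deriveM hf hg.
Qed.

Lemma partial_comp i (g : R -> R) dg f x : smooth f -> is_derive (f x) 1 g dg ->
  partial i (fun x => g (f x)) x = dg * partial i f x.
Proof.
by move=> sf dgE; have [_] := is_derive_comp1 (smooth_is_derive i x sf) dgE.
Qed.

Lemma partial_translate i f (s : 'rV[R]_n) x :
  partial i (fun x => f (x + s)) x = partial i f (x + s).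
Proof.
rewrite /partial /derive; apply: (f_equal (fun F : R -> R => lim (F @ 0^'))).
by apply/funext => h /=; rewrite addrA.
Qed.

Lemma smooth_translate f (s : 'rV[R]_n) : smooth f -> smooth (fun x => f (x + s)).
Proof.
move=> sf l.
have -> : foldr partial (fun x => f (x + s)) l = (fun x => foldr partial f l (x + s)).
  elim: l => //= i l ->; apply/funext => x; exact: partial_translate.
have [cf df] := sf l; split=> [x|i x].
  apply: (cvg_comp (fun y => y + s) (foldr partial f l)); last exact: cf.
  exact: continuous_addr.
have := df i (x + s); rewrite /derivable.
set u : R -> R := (fun h => _); set v : R -> R := (X in _ -> cvg (X @ _)).
by have -> : u = v by apply/funext => h; rewrite /u /v /= addrA.
Qed.

End smooth_calculus.

(** * Lebesgue measure on R^n *)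

Local Notation pushforward_measure :=
  measure_function_pushforward__canonical__measure_function_Measure.

Section lebesgue_translation.
Context {R : realType}.

Lemma lebesgue_measure_translate (s : R) (A : set (measurableTypeR R)) :
  measurable A -> lebesgue_measure ((fun x : R => x + s) @^-1` A) = lebesgue_measure A.
Proof.
move=> mA.
have ms : measurable_fun [set: measurableTypeR R]
    ((fun x : R => x + s) : measurableTypeR R -> measurableTypeR R).
  by apply: continuous_measurable_fun; exact: continuous_addr.
apply/esym.
apply: (@lebesgue_measure_unique R (pushforward_measure lebesgue_measure ms)) => //.
move=> X [[a b] /= ab <-] /=; rewrite /pushforward.
rewrite (_ : _ @^-1` _ = `]a - s, b - s]%classic).
  rewrite !lebesgue_measure_itv/= !lte_fin ltrD2r; case: ifP => // _.
  by rewrite -!EFinD; congr (_%:E); ring.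
by apply/seteqP; split=> x /=; rewrite !in_itv/= ltrBlDr lerBrDr.
Qed.

Lemma measurable_translate n (s : 'rV[R]_n) :
  measurable_fun [set: 'rV[R]_n] (fun x => x + s).
Proof.
apply: measurable_fun_rVP => i.
rewrite (_ : _ \o _ = (fun x => coord_rV i x + s ord0 i)).
  by apply: measurable_funD => //; exact: measurable_coord_rV.
by apply/funext => x; rewrite /= /coord_rV mxE.
Qed.

Lemma measurable_preimage_translate n (s : 'rV[R]_n) A :
  measurable A -> measurable ((fun x => x + s) @^-1` A).
Proof.
by move=> mA; rewrite -[X in measurable X]setTI; exact: measurable_translate.
Qed.

Lemma lebesgue_rVS n (A : set 'rV[R]_n.+1) :
  lebesgue_rV n.+1 A =
  (@lebesgue_measure R \x @lebesgue_rV R n)%E (@cons_rV R n @^-1` A).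
Proof. by []. Qed.

(** Under [cons_rV] a translation acts separately on the two factors. Its image of the product
    measure therefore has the right values on rectangles, and uniqueness of the product measure
    concludes. *)
Lemma lebesgue_rV_translate n (s : 'rV[R]_n) (A : set 'rV[R]_n) :
  measurable A -> lebesgue_rV n ((fun x => x + s) @^-1` A) = lebesgue_rV n A.
Proof.
elim: n s A => [|n IH] s A mA.
  congr (lebesgue_rV 0%N _); apply/seteqP; split=> x /=;
    by rewrite (_ : x + s = x) //; apply/rowP => -[].
rewrite !lebesgue_rVS.
set s0 := s ord0 ord0; pose s' : 'rV[R]_n := \row_j s ord0 (lift ord0 j).
pose T (q : measurableTypeR R * 'rV[R]_n) : measurableTypeR R * 'rV[R]_n :=
  ((q.1 : R) + s0 : measurableTypeR R, q.2 + s').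
have m0 : measurable_fun [set: measurableTypeR R]
    ((fun x : R => x + s0) : measurableTypeR R -> measurableTypeR R).
  by apply: continuous_measurable_fun; exact: continuous_addr.
have mT : measurable_fun setT T.
  apply: measurable_fun_pair.
    by apply: (measurableT_comp m0); exact: measurable_fst.
  by apply: (measurableT_comp (measurable_translate s')); exact: measurable_snd.
have mcA : measurable (@cons_rV R n @^-1` A).
  by rewrite -[X in measurable X]setTI; exact: measurable_cons_rV.
have -> : @cons_rV R n @^-1` ((fun x => x + s) @^-1` A) =
    T @^-1` (@cons_rV R n @^-1` A).
  apply/seteqP; split=> q /=; rewrite (_ : cons_rV (T q) = cons_rV q + s)//;
    apply/rowP => i; rewrite /cons_rV !mxE;
    by case: (unliftP ord0 i) => [j|] -> /=; rewrite ?mxE.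
apply/esym.
apply: (@product_measure_unique _ _ _ _ R lebesgue_measure (lebesgue_rV n)
   (pushforward_measure (@lebesgue_measure R \x @lebesgue_rV R n)%E mT)) => //.
move=> B C mB mC /=; rewrite /pushforward.
have -> : T @^-1` (B `*` C) =
    ((fun x : R => x + s0) @^-1` B) `*` ((fun x => x + s') @^-1` C).
  by apply/seteqP; split=> -[].
rewrite product_measure1E//.
- by congr (_ * _)%E; [exact: lebesgue_measure_translate|exact: IH].
- by rewrite -[X in measurable X]setTI; exact: m0.
- exact: measurable_preimage_translate.
Qed.

Lemma ge0_integral_translate n (s : 'rV[R]_n) (D : set 'rV[R]_n) (f : 'rV[R]_n -> \bar R) :
  measurable D -> measurable_fun D f -> (forall x, D x -> (0 <= f x)%E) ->
  (\int[lebesgue_rV n]_(x in (fun x => x + s)%R @^-1` D) f (x + s)%R =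
   \int[lebesgue_rV n]_(x in D) f x)%E.
Proof.
move=> mD mf f0.
have := @ge0_integral_pushforward _ _ _ _ R _ (measurable_translate s)
  (lebesgue_rV n) D f mD mf.
rewrite /comp => <-; last by move=> x /set_mem; exact: f0.
apply: (@eq_measure_integral _ _ _ _ (lebesgue_rV n)
  (pushforward_measure (lebesgue_rV n) (measurable_translate s))) => A mA _.
by rewrite -[RHS](lebesgue_rV_translate s).
Qed.

Lemma integral_translate n (s : 'rV[R]_n) (D : set 'rV[R]_n) (f : 'rV[R]_n -> \bar R) :
  measurable D -> measurable_fun D f ->
  (\int[lebesgue_rV n]_(x in (fun x => x + s)%R @^-1` D) f (x + s)%R =
   \int[lebesgue_rV n]_(x in D) f x)%E.
Proof.
move=> mD mf; rewrite [LHS]integralE [RHS]integralE.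
congr (_ - _)%E.
  rewrite -(ge0_integral_translate s mD (measurable_funepos mf)).
    by apply: eq_integral => x _; rewrite !funeposE.
  by move=> x _; rewrite funepos_ge0.
rewrite -(ge0_integral_translate s mD (measurable_funeneg mf)).
  by apply: eq_integral => x _; rewrite !funenegE.
by move=> x _; rewrite funeneg_ge0.
Qed.

Lemma measurable_fun_translate n (s : 'rV[R]_n) d (T : measurableType d) (D : set 'rV[R]_n)
    (f : 'rV[R]_n -> T) : measurable D ->
  measurable_fun D f ->
  measurable_fun ((fun x => x + s) @^-1` D) (fun x => f (x + s)).
Proof.
move=> mD mf _ B mB.
rewrite (_ : _ `&` _ = (fun x => x + s) @^-1` (D `&` f @^-1` B))//.
by apply: measurable_preimage_translate; exact: mf.
Qed.

Lemma Rintegral_translate n (s : 'rV[R]_n) (D : set 'rV[R]_n) (f : 'rV[R]_n -> R) :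
  measurable D -> measurable_fun D f ->
  \int[lebesgue_rV n]_(x in (fun x => x + s) @^-1` D) f (x + s) =
  \int[lebesgue_rV n]_(x in D) f x.
Proof.
move=> mD mf; rewrite /Rintegral; congr fine.
exact: (integral_translate s mD (measurableT_comp _ mf)).
Qed.

End lebesgue_translation.

(** * Boxes, balls and open sets *)

Section lebesgue_ball.
Context {R : realType}.

(** Membership in a [ball] of matrices includes [0 < r], which the box on the right does not record;
    hence the positive radius here, and a volume computed on boxes first. *)
Lemma rV_ballE n (x : 'rV[R]_n) (r : R) : 0 < r ->
  ball x r = [set y : 'rV[R]_n | forall i, `|x ord0 i - y ord0 i| < r].
Proof.
move=> r0; apply/seteqP; split=> y.
  by case=> _ h i; exact: h.
by move=> h; split => // i j; rewrite ord1; exact: h.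
Qed.

Lemma measurable_rV_box n (x : 'rV[R]_n) (r : R) :
  measurable [set y : 'rV[R]_n | forall i, `|x ord0 i - y ord0 i| < r].
Proof.
rewrite (_ : [set y | _] = \bigcap_(i in setT) (coord_rV i @^-1` ball (x ord0 i : R) r)).
  apply: fin_bigcap_measurable => // i _.
  rewrite -[X in measurable X]setTI; apply: measurable_coord_rV => //.
  exact: measurable_ball.
by apply/seteqP; split=> y /= h i; [move=> _; exact: h|exact: (h i)].
Qed.

Lemma measurable_rV_ball n (x : 'rV[R]_n) (r : R) : measurable (ball x r).
Proof.
have [r0|r0] := ltP 0 r; first by rewrite rV_ballE//; exact: measurable_rV_box.
rewrite (_ : ball x r = set0)//; apply/seteqP; split=> // y [r1].
by move: r0; rewrite leNgt r1.
Qed.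

Lemma lebesgue_rV_box n (x : 'rV[R]_n) (r : R) : 0 <= r ->
  lebesgue_rV n [set y : 'rV[R]_n | forall i, `|x ord0 i - y ord0 i| < r] = ((r *+ 2) ^+ n)%:E.
Proof.
move=> r0; elim: n x => [|n IH] x.
  rewrite (_ : [set y | _] = setT) /=.
    by rewrite diracT expr0.
  by apply/seteqP; split => // y _ [].
rewrite lebesgue_rVS.
pose x' : 'rV[R]_n := \row_j x ord0 (lift ord0 j).
have -> : @cons_rV R n @^-1` [set y : 'rV[R]_n.+1 | forall i, `|x ord0 i - y ord0 i| < r] =
  ball (x ord0 ord0 : R) r `*` [set y : 'rV[R]_n | forall i, `|x' ord0 i - y ord0 i| < r].
  apply/seteqP; split=> -[t v]; rewrite /cons_rV /=.
    move=> h; split=> [|i]; first by have := h ord0; rewrite mxE unlift_none.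
    by have := h (lift ord0 i); rewrite !mxE liftK.
  move=> [h0 h] i; rewrite mxE; case: (unliftP ord0 i) => [j|] -> /=.
    by have := h j; rewrite mxE.
  exact: h0.
rewrite product_measure1E//; [|exact: measurable_ball|exact: measurable_rV_box].
by rewrite IH exprS EFinM; congr (_ * _)%E; exact: lebesgue_measure_ball.
Qed.

Lemma lebesgue_rV_ball n (x : 'rV[R]_n) (r : R) : 0 < r ->
  lebesgue_rV n (ball x r) = ((r *+ 2) ^+ n)%:E.
Proof. by move=> r0; rewrite rV_ballE// lebesgue_rV_box// ltW. Qed.

(** The sigma-algebra is generated by the coordinates, so open sets have to be reduced to boxes: [U]
    is the union of the countably many rational boxes it contains. *)
Lemma open_measurable_rV n (U : set 'rV[R]_n) : open U -> measurable U.
Proof.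
move=> oU.
pose B (q : 'rV[rat]_n * rat) : set 'rV[R]_n :=
  [set y | ball (map_mx ratr q.1 : 'rV[R]_n) (ratr q.2) y /\
           ball (map_mx ratr q.1 : 'rV[R]_n) (ratr q.2) `<=` U].
have -> : U = \bigcup_q B q.
  apply/seteqP; split=> [x Ux|x [q _ []]//]; last by move=> h /(_ _ h).
  have /nbhs_ballP[e /= e0 eU] := open_nbhs_nbhs (conj oU Ux).
  have [r] := @rat_in_itvoo R 0 (e / 2) (divr_gt0 e0 (ltr0Sn _ 1)).
  rewrite in_itv/= => /andP[r0 re].
  have qi (i : 'I_n) : exists q : rat, `|ratr q - x ord0 i| < ratr r :> R.
    have [q] := @rat_in_itvoo R (x ord0 i - ratr r) (x ord0 i + ratr r)
      ltac:(lra).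
    by rewrite in_itv/= => h; exists q; rewrite ltr_distl.
  have /choice[c cE] := qi.
  exists (\row_i c i, r) => //=; rewrite /B /= rV_ballE//.
  split=> /= [i|y hy]; first by rewrite !mxE.
  apply: eU; rewrite rV_ballE// => i.
  have h1 := cE i; have := hy i; rewrite !mxE => h2.
  have : `|x ord0 i - y ord0 i| <= `|ratr (c i) - x ord0 i| + `|ratr (c i) - y ord0 i|.
    rewrite [X in _ <= X + _]distrC.
    by apply: le_trans (ler_normD _ _); rewrite addrA subrK.
  by lra.
apply: countable_bigcupT_measurable => [|q]; first exact: countableP.
have [h|h] := pselect (ball (map_mx ratr q.1 : 'rV[R]_n) (ratr q.2) `<=` U).
  rewrite (_ : B q = ball (map_mx ratr q.1 : 'rV[R]_n) (ratr q.2)).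
    exact: measurable_rV_ball.
  by apply/seteqP; split=> y; [case|split].
by rewrite (_ : B q = set0)//; apply/seteqP; split=> y // -[].
Qed.

Lemma open_continuous_measurable_rV n (U : set 'rV[R]_n) (f : 'rV[R]_n -> R) :
  open U -> (forall x, U x -> {for x, continuous f}) -> measurable_fun U f.
Proof.
move=> oU cf.
apply: (measurability _ (RGenOpens.measurableE R)).
move=> _ [_ [a [b ->] <-]]; apply: open_measurable_rV.
rewrite openE => x [Ux fx]; apply: filterI.
  by apply: open_nbhs_nbhs; split.
apply: (cf x Ux); apply: open_nbhs_nbhs; split => //.
Qed.

Lemma continuous_measurable_rV n (f : 'rV[R]_n -> R) (D : set 'rV[R]_n) :
  continuous f -> measurable_fun D f.
Proof.
move=> cf; apply: (@measurable_funS _ _ _ _ setT) => //.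
apply: open_continuous_measurable_rV; [exact: (@openT 'rV[R]_n)|].
by move=> x _; exact: cf.
Qed.

Lemma lebesgue_rV_bounded n (A : set 'rV[R]_n) : measurable A ->
  bounded_set A -> (lebesgue_rV n A < +oo)%E.
Proof.
move=> mA [M [Mr bA]].
pose r := `|M| + 2.
have r0 : 0 < r by rewrite /r; have := normr_ge0 M; lra.
apply: (@le_lt_trans _ _ (lebesgue_rV n (ball (0 : 'rV[R]_n) r))).
  apply: le_measure; rewrite ?inE//; first exact: measurable_rV_ball.
  move=> x Ax; rewrite -ball_normE /ball_ /= sub0r normrN.
  have := bA (`|M| + 1) ltac:(have := ler_norm M; lra) x Ax.
  by rewrite /r /=; lra.
by rewrite lebesgue_rV_ball// ltry.
Qed.

Lemma lebesgue_rV_open_gt0 n (U : set 'rV[R]_n) : open U -> U !=set0 ->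
  (0 < lebesgue_rV n U)%E.
Proof.
move=> oU [x Ux].
have /nbhs_ballP[e /= e0 eU] := open_nbhs_nbhs (conj oU Ux).
apply: (@lt_le_trans _ _ (lebesgue_rV n (ball x e))).
  by rewrite lebesgue_rV_ball// lte_fin exprn_gt0// pmulrn_lgt0.
apply: le_measure => //; rewrite ?inE; first exact: measurable_rV_ball.
exact: open_measurable_rV.
Qed.

End lebesgue_ball.

(** * Square-integrable functions *)

Section L2_theory.
Context {R : realType} {n : nat}.
Local Notation mu := (@lebesgue_rV R n).
Implicit Types (D A : set 'rV[R]_n) (f g h : 'rV[R]_n -> R).

Lemma integrable_le D f g : measurable D -> measurable_fun D f ->
  (forall x, D x -> `|f x| <= g x) -> mu.-integrable D (EFin \o g) ->
  mu.-integrable D (EFin \o f).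
Proof.
move=> mD mf fg ig; apply: (le_integrable mD _ _ ig).
  exact/measurable_EFinP.
move=> x Dx /=; rewrite lee_fin (le_trans (fg _ Dx))//; exact: ler_norm.
Qed.

Lemma integrable_add D f g : measurable D -> mu.-integrable D (EFin \o f) ->
  mu.-integrable D (EFin \o g) -> mu.-integrable D (EFin \o (fun x => f x + g x)).
Proof. by move=> mD fi gi; exact: (integrableD mD fi gi). Qed.

Lemma L2_integrable_sqr D f : measurable D -> L2 D f ->
  mu.-integrable D (EFin \o (fun x => f x ^+ 2)).
Proof.
move=> mD [mf fi]; apply/integrableP; split.
  by apply/measurable_EFinP; exact: measurable_funX.
rewrite (eq_integral (fun x => (f x ^+ 2)%:E))//.
by move=> x _ /=; rewrite ger0_norm ?sqr_ge0.
Qed.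

Lemma L2P D f : measurable D -> measurable_fun D f ->
  mu.-integrable D (EFin \o (fun x => f x ^+ 2)) -> L2 D f.
Proof.
move=> mD mf /integrableP[_ h]; split=> //; move: h.
rewrite (eq_integral (fun x => (f x ^+ 2)%:E))//.
by move=> x _ /=; rewrite ger0_norm ?sqr_ge0.
Qed.

Lemma L2_measurable D f : L2 D f -> measurable_fun D f.
Proof. by case. Qed.

Lemma L2_integrableM D f g : measurable D -> L2 D f -> L2 D g ->
  mu.-integrable D (EFin \o (fun x => f x * g x)).
Proof.
move=> mD f2 g2; have mf := L2_measurable f2; have mg := L2_measurable g2.
apply: (integrable_le (g := fun x => f x ^+ 2 + g x ^+ 2)) => //.
- exact: measurable_funM.
- by move=> x _; rewrite normrM -(real_normK (num_real (f x)))
    -(real_normK (num_real (g x))); nra.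
- by apply: integrable_add => //; exact: L2_integrable_sqr.
Qed.

Lemma L2_le D f g : measurable D -> measurable_fun D f ->
  (forall x, D x -> `|f x| <= `|g x|) -> L2 D g -> L2 D f.
Proof.
move=> mD mf fg g2; apply: L2P => //.
apply: (integrable_le (g := fun x => g x ^+ 2)) => //.
- exact: measurable_funX.
- by move=> x Dx; rewrite normrX -(real_normK (num_real (g x))) ler_sqr ?nnegrE// fg.
- exact: L2_integrable_sqr.
Qed.

Lemma L2D D f g : measurable D -> L2 D f -> L2 D g -> L2 D (fun x => f x + g x).
Proof.
move=> mD f2 g2; have mf := L2_measurable f2; have mg := L2_measurable g2.
apply: L2P => //; first exact: measurable_funD.
apply: (integrable_le (g := fun x => (f x ^+ 2 + f x ^+ 2) + (g x ^+ 2 + g x ^+ 2))) => //.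
- by apply: measurable_funX; exact: measurable_funD.
- by move=> x _; rewrite ger0_norm ?sqr_ge0//; have := sqr_ge0 (f x - g x); nra.
- have fi := L2_integrable_sqr mD f2; have gi := L2_integrable_sqr mD g2.
  by apply: integrable_add => //; exact: integrable_add.
Qed.

Lemma L2_bounded_mul D (b : 'rV[R]_n -> R) f (M : R) : measurable D ->
  measurable_fun D b -> (forall x, D x -> `|b x| <= M) -> L2 D f ->
  L2 D (fun x => b x * f x).
Proof.
move=> mD mb bM f2; have mf := L2_measurable f2; apply: L2P => //.
  exact: measurable_funM.
apply: (integrable_le (g := fun x => M ^+ 2 * f x ^+ 2)) => //.
- by apply: measurable_funX; exact: measurable_funM.
- move=> x Dx; rewrite ger0_norm ?sqr_ge0// exprMn ler_wpM2r ?sqr_ge0//.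
  have M0 : 0 <= M by apply: le_trans (bM _ Dx).
  by rewrite -(real_normK (num_real (b x))) ler_sqr ?nnegrE// bM.
- by apply: (integrableZl mD (M ^+ 2) (L2_integrable_sqr mD f2)).
Qed.

Lemma L2Z D (c : R) f : measurable D -> L2 D f -> L2 D (fun x => c * f x).
Proof.
by move=> mD; apply: (L2_bounded_mul (b := cst c) (M := `|c|)).
Qed.

Lemma L2N D f : measurable D -> L2 D f -> L2 D (fun x => - f x).
Proof.
move=> mD f2; rewrite (_ : (fun x => _) = (fun x => -1 * f x)); first exact: L2Z.
by apply/funext => x; rewrite mulN1r.
Qed.

Lemma L2B D f g : measurable D -> L2 D f -> L2 D g -> L2 D (fun x => f x - g x).
Proof. by move=> mD f2 g2; apply: L2D => //; exact: L2N. Qed.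

Lemma L2_sum D (I : Type) (s : seq I) (F : I -> 'rV[R]_n -> R) : measurable D ->
  (forall i, L2 D (F i)) -> L2 D (fun x => \sum_(i <- s) F i x).
Proof.
move=> mD F2; elim: s => [|i s IH].
  apply: L2P => //.
    by rewrite (_ : (fun x => _) = cst 0)//; apply/funext => x; rewrite big_nil.
  rewrite (_ : _ \o _ = cst 0%E); first exact: integrable0.
  by apply/funext => x /=; rewrite big_nil expr0n.
rewrite (_ : (fun x => _) = (fun x => F i x + \sum_(j <- s) F j x)).
  exact: L2D.
by apply/funext => x; rewrite big_cons.
Qed.

Lemma finite_integrable_cst D (c : R) : measurable D -> (mu D < +oo)%E ->
  mu.-integrable D (EFin \o cst c).
Proof.
move=> mD fD; apply/integrableP; split; first exact/measurable_EFinP.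
rewrite (eq_integral (cst `|c|%:E))// integral_cst//.
by rewrite lte_mul_pinfty ?lee_fin.
Qed.

Lemma L2_of_bounded D f (M : R) : measurable D -> (mu D < +oo)%E ->
  measurable_fun D f -> (forall x, D x -> `|f x| <= M) -> L2 D f.
Proof.
move=> mD fD mf fM; apply: L2P => //.
apply: (integrable_le (g := cst (M ^+ 2))) => //.
- exact: measurable_funX.
- move=> x Dx; rewrite ger0_norm ?sqr_ge0//.
  have M0 : 0 <= M by apply: le_trans (fM _ Dx).
  by rewrite -(real_normK (num_real (f x))) ler_sqr ?nnegrE// fM.
- exact: finite_integrable_cst.
Qed.

Lemma L2_cst D (c : R) : measurable D -> (mu D < +oo)%E -> L2 D (cst c).
Proof. by move=> mD fD; apply: (L2_of_bounded (M := `|c|)). Qed.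

Lemma L2_integrable D f : measurable D -> (mu D < +oo)%E -> L2 D f ->
  mu.-integrable D (EFin \o f).
Proof.
move=> mD fD f2; have := L2_integrableM mD f2 (L2_cst 1 mD fD).
by congr (_.-integrable _ (EFin \o _)); apply/funext => x; rewrite /= mulr1.
Qed.

Lemma L2_subset D A f : measurable D -> measurable A -> A `<=` D -> L2 D f -> L2 A f.
Proof.
move=> mD mA AD f2; apply: L2P => //.
  by apply: measurable_funS (L2_measurable f2).
by apply: (integrableS mD mA AD); exact: L2_integrable_sqr.
Qed.

Definition ip D f g : R := \int[mu]_(x in D) (f x * g x).

Lemma ipC D f g : ip D f g = ip D g f.
Proof. by apply: eq_Rintegral => x _; rewrite mulrC. Qed.

Lemma ipDl D f g h : measurable D -> L2 D f -> L2 D g -> L2 D h ->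
  ip D (fun x => f x + g x) h = ip D f h + ip D g h.
Proof.
move=> mD f2 g2 h2; rewrite /ip -RintegralD//; [|exact: L2_integrableM..].
by apply: eq_Rintegral => x _; rewrite mulrDl.
Qed.

Lemma ipZl D (c : R) f h : measurable D -> L2 D f -> L2 D h ->
  ip D (fun x => c * f x) h = c * ip D f h.
Proof.
move=> mD f2 h2; rewrite /ip -RintegralZl//; last exact: L2_integrableM.
by apply: eq_Rintegral => x _; rewrite mulrA.
Qed.

Lemma ipDr D f g h : measurable D -> L2 D f -> L2 D g -> L2 D h ->
  ip D h (fun x => f x + g x) = ip D h f + ip D h g.
Proof. by move=> mD f2 g2 h2; rewrite ipC ipDl// !(ipC _ h). Qed.

Lemma ipZr D (c : R) f h : measurable D -> L2 D f -> L2 D h ->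
  ip D h (fun x => c * f x) = c * ip D h f.
Proof. by move=> mD f2 h2; rewrite ipC ipZl// (ipC _ h). Qed.

Lemma ipBl D f g h : measurable D -> L2 D f -> L2 D g -> L2 D h ->
  ip D (fun x => f x - g x) h = ip D f h - ip D g h.
Proof.
move=> mD f2 g2 h2; rewrite /ip -RintegralB//; [|exact: L2_integrableM..].
by apply: eq_Rintegral => x _; rewrite mulrBl.
Qed.

Lemma ipBr D f g h : measurable D -> L2 D f -> L2 D g -> L2 D h ->
  ip D h (fun x => f x - g x) = ip D h f - ip D h g.
Proof. by move=> mD f2 g2 h2; rewrite ipC ipBl// !(ipC _ h). Qed.

Lemma ip_suml D (I : Type) (s : seq I) (F : I -> 'rV[R]_n -> R) g : measurable D ->
  (forall i, L2 D (F i)) -> L2 D g ->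
  ip D (fun x => \sum_(i <- s) F i x) g = \sum_(i <- s) ip D (F i) g.
Proof.
move=> mD F2 g2; elim: s => [|i s IH].
  rewrite big_nil /ip (_ : (fun x => _) = cst 0) ?Rintegral_cst ?mul0r//.
  by apply/funext => x; rewrite big_nil mul0r.
rewrite big_cons -IH -ipDl//; last exact: L2_sum.
by apply: eq_Rintegral => x _; rewrite big_cons.
Qed.

Lemma L2sqnormE D f : L2sqnorm D f = ip D f f.
Proof. by apply: eq_Rintegral => x _; rewrite expr2. Qed.

Lemma L2sqnorm_ge0 D f : 0 <= L2sqnorm D f.
Proof. by apply: Rintegral_ge0 => x _; exact: sqr_ge0. Qed.

Lemma ip_self_ge0 D f : 0 <= ip D f f.
Proof. by rewrite -L2sqnormE L2sqnorm_ge0. Qed.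

Lemma cauchy_schwarz D f g : measurable D -> L2 D f -> L2 D g ->
  ip D f g ^+ 2 <= L2sqnorm D f * L2sqnorm D g.
Proof.
move=> mD f2 g2; rewrite !L2sqnormE.
set a := ip D f f; set b := ip D f g; set c := ip D g g.
have q t : 0 <= a + 2 * t * b + t ^+ 2 * c.
  have tg2 := L2Z t mD g2.
  have := ip_self_ge0 D (fun x => f x + t * g x).
  rewrite ipDl ?ipDr ?ipZl ?ipZr//; [|exact: L2D..].
  by rewrite (ipC _ g f) -/a -/b -/c; congr (0 <= _); ring.
have a0 : 0 <= a := ip_self_ge0 D f.
have c0 : 0 <= c := ip_self_ge0 D g.
move: c0; rewrite le_eqVlt => /predU1P[c0|c0].
  rewrite -c0 mulr0.
  have [->|b0] := eqVneq b 0; first by rewrite expr0n.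
  (* When [c = 0] the quadratic form is affine in [t], and this value of [t] makes it equal to
     -1. *)
  have := q (- (a + 1) / (2 * b)).
  rewrite -c0 mulr0 addr0 (_ : 2 * _ * b = - (a + 1)); first by lra.
  by field.
have := q (- b / c).
rewrite (_ : _ + _ = (a * c - b ^+ 2) / c); last by field; rewrite gt_eqF.
by rewrite pmulr_lge0 ?invr_gt0// subr_ge0.
Qed.

Lemma ip_le D f g : measurable D -> L2 D f -> L2 D g ->
  `|ip D f g| <= Num.sqrt (L2sqnorm D f) * Num.sqrt (L2sqnorm D g).
Proof.
move=> mD f2 g2; rewrite -sqrtrM ?L2sqnorm_ge0// -sqrtr_sqr ler_wsqrtr//.
exact: cauchy_schwarz.
Qed.

Lemma L2sqnormD_le D f g : measurable D -> L2 D f -> L2 D g ->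
  L2sqnorm D (fun x => f x + g x) <= 2 * L2sqnorm D f + 2 * L2sqnorm D g.
Proof.
move=> mD f2 g2.
have := ip_self_ge0 D (fun x => f x - g x).
rewrite !L2sqnormE ipBl ?ipBr ?ipDl ?ipDr//; [|exact: L2D|exact: L2B].
by rewrite (ipC _ g f); lra.
Qed.

Lemma sqrt_L2sqnormD_le D f g : measurable D -> L2 D f -> L2 D g ->
  Num.sqrt (L2sqnorm D (fun x => f x + g x)) <=
  Num.sqrt (L2sqnorm D f) + Num.sqrt (L2sqnorm D g).
Proof.
move=> mD f2 g2.
have := ip_le mD f2 g2; set a := Num.sqrt _; set b := Num.sqrt _.
have a0 : 0 <= a by exact: sqrtr_ge0.
have b0 : 0 <= b by exact: sqrtr_ge0.
move=> h; rewrite -(@ger0_norm _ (a + b)) ?addr_ge0// -sqrtr_sqr ler_wsqrtr//.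
rewrite L2sqnormE ipDl ?ipDr//; last exact: L2D.
have -> : (a + b) ^+ 2 = L2sqnorm D f + 2 * (a * b) + L2sqnorm D g.
  rewrite -(sqr_sqrtr (L2sqnorm_ge0 D f)) -(sqr_sqrtr (L2sqnorm_ge0 D g)) -/a -/b.
  by ring.
rewrite (ipC _ g f) !L2sqnormE; have := ler_norm (ip D f g); lra.
Qed.

Lemma L2sqnormZ D (c : R) f : measurable D -> L2 D f ->
  L2sqnorm D (fun x => c * f x) = c ^+ 2 * L2sqnorm D f.
Proof.
by move=> mD f2; rewrite !L2sqnormE ipZl ?ipZr// ?mulrA//; exact: L2Z.
Qed.

Lemma le_L2sqnorm D f g : measurable D -> measurable_fun D f -> L2 D g ->
  (forall x, D x -> `|f x| <= `|g x|) -> L2sqnorm D f <= L2sqnorm D g.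
Proof.
move=> mD mf g2 fg; have f2 := L2_le mD mf fg g2.
apply: le_Rintegral => //; try exact: L2_integrable_sqr.
move=> x Dx; rewrite -(real_normK (num_real (f x))) -(real_normK (num_real (g x))).
by rewrite ler_sqr ?nnegrE// fg.
Qed.

Lemma le_L2sqnorm_subset D A f : measurable D -> measurable A -> A `<=` D ->
  L2 D f -> L2sqnorm A f <= L2sqnorm D f.
Proof.
move=> mD mA AD f2; rewrite /L2sqnorm /Rintegral fine_le//.
- exact: integrable_fin_num (L2_integrable_sqr mA (L2_subset mD mA AD f2)).
- exact: integrable_fin_num (L2_integrable_sqr mD f2).
- apply: ge0_subset_integral => //.
    by apply/measurable_EFinP; apply: measurable_funX; exact: L2_measurable f2.
  by move=> x _; rewrite lee_fin sqr_ge0.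
Qed.

Lemma dominated_Rintegral D (F : nat -> 'rV[R]_n -> R) f g : measurable D ->
  (forall k, measurable_fun D (F k)) -> measurable_fun D f ->
  (forall x, D x -> F k x @[k --> \oo] --> f x) ->
  mu.-integrable D (EFin \o g) ->
  (forall k x, D x -> `|F k x| <= g x) ->
  \int[mu]_(x in D) F k x @[k --> \oo] --> \int[mu]_(x in D) f x.
Proof.
move=> mD mF mf Ff ig Fg.
have [] := @dominated_convergence _ _ _ mu D mD (fun k => EFin \o F k)
  (EFin \o f) (EFin \o g).
- by move=> k; exact/measurable_EFinP.
- exact/measurable_EFinP.
- by apply: aeW => x Dx; apply/fine_cvgP; split; [exact: nearW|exact: Ff].
- exact: ig.
- by apply: aeW => x k Dx /=; rewrite lee_fin Fg.
move=> fi _ h.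
have : fine (\int[mu]_(x in D) (EFin \o F k) x)%E @[k --> \oo] -->
    fine (\int[mu]_(x in D) (EFin \o f) x)%E.
  by apply: fine_cvg; rewrite fineK//; exact: integrable_fin_num.
exact.
Qed.

Lemma dominated_L2 D (F : nat -> 'rV[R]_n -> R) f g : measurable D ->
  (forall k, measurable_fun D (F k)) -> measurable_fun D f ->
  (forall x, D x -> F k x @[k --> \oo] --> f x) ->
  L2 D g -> (forall k x, D x -> `|F k x| <= `|g x|) -> L2 D f ->
  L2sqnorm D (fun x => F k x - f x) @[k --> \oo] --> (0 : R).
Proof.
move=> mD mF mf Ff g2 Fg f2.
have -> : 0 = \int[mu]_(x in D) (0 : R) by rewrite Rintegral_cst// mul0r.
apply: (dominated_Rintegral (g := fun x => (g x ^+ 2 + g x ^+ 2) + (f x ^+ 2 + f x ^+ 2))) => //.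
- by move=> k; apply: measurable_funX; exact: measurable_funB.
- move=> x Dx; rewrite -(mul0r (0 : R)); under eq_fun do rewrite expr2.
  have h : F k x - f x @[k --> \oo] --> (0 : R) by apply/subr_cvg0; exact: Ff.
  exact: cvgM.
- have fi := L2_integrable_sqr mD f2; have gi := L2_integrable_sqr mD g2.
  by apply: integrable_add => //; exact: integrable_add.
- move=> k x Dx; rewrite ger0_norm ?sqr_ge0//.
  have h : F k x ^+ 2 <= g x ^+ 2.
    rewrite -(real_normK (num_real (F k x))) -(real_normK (num_real (g x))).
    by rewrite ler_sqr ?nnegrE// Fg.
  by have := sqr_ge0 (F k x + f x); nra.
Qed.

Lemma ae_eq_Rintegral D f g : measurable D -> measurable_fun D f ->
  measurable_fun D g -> {ae mu, forall x, D x -> f x = g x} ->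
  \int[mu]_(x in D) f x = \int[mu]_(x in D) g x.
Proof.
move=> mD mf mg fg; rewrite /Rintegral; congr fine.
apply: ae_eq_integral => //; [exact/measurable_EFinP|exact/measurable_EFinP|].
by apply: filterS fg => x h Dx; rewrite h.
Qed.

End L2_theory.

(** * Density of test functions *)

Section gamma_step.
Context {R : realType}.

Lemma gamma0_le1 (t : R) : gamma 0 t <= 1.
Proof.
rewrite /gamma; case: ifP => // t0.
by rewrite expr0 invr1 mul1r expR_le1 oppr_le0 invr_ge0 ltW.
Qed.

Lemma gamma0_cvg1 (a b : R) : 0 < a ->
  gamma 0 (a * k.+1%:R + b) @[k --> \oo] --> (1 : R).
Proof.
move=> a0; apply/cvgrPdist_lt => e e0.
near=> k.
have ek : e^-1 < a * k.+1%:R + b.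
  rewrite -ltrBlDr -ltr_pdivrMl// -natr1.
  apply: (@lt_trans _ _ k%:R); last by rewrite ltrDl.
  near: k; exact: nbhs_infty_gtr.
have ei : 0 < e^-1 by rewrite invr_gt0.
set t := (X in gamma 0 X); have t0 : 0 < t by exact: lt_trans ek.
rewrite ger0_norm ?subr_ge0 ?gamma0_le1// /gamma t0 expr0 invr1 mul1r.
have := expR_ge1Dx (- t^-1).
have : t^-1 < e by rewrite -[e]invrK ltf_pV2 ?posrE.
by lra.
Unshelve. all: end_near. Qed.

End gamma_step.

(** * Indicators of half-spaces as limits of smooth functions *)

Section coordinates.
Context {R : realType} {n : nat}.

Lemma smooth_of_partial (f : 'rV[R]_n -> R) : continuous f ->
  (forall i x, derivable f x (delta_mx ord0 i)) ->
  (forall i, smooth (partial i f)) -> smooth f.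
Proof.
move=> cf df sf; case/lastP => [|s i]; first by split.
by rewrite foldr_rcons; exact: sf.
Qed.

Lemma smooth_coord (i : 'I_n) : smooth (fun x : 'rV[R]_n => x ord0 i).
Proof.
have h j (x : 'rV[R]_n) : is_derive x (delta_mx ord0 j)
    (fun x : 'rV[R]_n => x ord0 i) ((delta_mx ord0 j : 'rV[R]_n) ord0 i).
  have c : h^-1 *: ((h *: (delta_mx ord0 j : 'rV[R]_n) + x) ord0 i - x ord0 i) @[h --> 0^']
      --> (delta_mx ord0 j : 'rV[R]_n) ord0 i.
    apply: cvg_near_cst; near=> h.
    have hn0 : h != 0 by near: h; exact: nbhs_dnbhs_neq.
    by rewrite !mxE addrK /GRing.scale/= mulKf.
  by apply: DeriveDef; [apply/cvg_ex; eexists; exact: c|apply/cvg_lim].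
apply: smooth_of_partial => [x|j x|j].
- exact: coord_continuous.
- by case: (h j x).
- rewrite (_ : partial j _ = cst ((delta_mx ord0 j : 'rV[R]_n) ord0 i)).
    exact: smooth_cst.
  by apply/funext => x; rewrite /partial; case: (h j x).
Unshelve. all: end_near. Qed.

(* Pointwise limits of smooth functions with values in [0, 1]; these sets form a
   pi-system that generates the Borel sigma-algebra. *)
Definition smooth_limit_set (A : set 'rV[R]_n) : Prop :=
  exists F : nat -> 'rV[R]_n -> R,
    [/\ forall k, smooth (F k), forall k x, 0 <= F k x <= 1 &
        forall x, F k x @[k --> \oo] --> (\1_A x : R)].

Lemma smooth_limit_setI : setI_closed smooth_limit_set.
Proof.
move=> A B [F [sF F01 FA]] [G [sG G01 GB]].
exists (fun k x => F k x * G k x); split=> [k|k x|x].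
- exact: smoothM.
- have /andP[f0 f1] := F01 k x; have /andP[g0 g1] := G01 k x.
  by rewrite mulr_ge0//= -[1]mulr1 ler_pM.
- by rewrite indicI; apply: cvgM; [exact: FA|exact: GB].
Qed.

Lemma smooth_limit_half_space (i : 'I_n) (a : R) :
  smooth_limit_set (coord_rV i @^-1` `]a, +oo[%classic).
Proof.
exists (fun k x => gamma 0 ((x ord0 i - a) * k.+1%:R)); split=> [k|k x|x].
- apply: smooth_gamma.
  have := smoothM (smoothD (smooth_coord i) (smooth_cst (- a))) (smooth_cst k.+1%:R).
  exact.
- by rewrite gamma_ge0 gamma0_le1.
- have [xa|xa] := ltP a (x ord0 i).
    rewrite indicE mem_set//=; last by rewrite in_itv/= xa.
    have := @gamma0_cvg1 R (x ord0 i - a) 0; rewrite subr_gt0 => /(_ xa).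
    by under eq_fun do rewrite addr0.
  rewrite indicE memNset//=; last by rewrite in_itv/= andbT /coord_rV; apply/negP; rewrite -leNgt.
  apply: cvg_near_cst; apply: nearW => k.
  by rewrite gamma_le0// mulr_le0_ge0// subr_le0.
Qed.

(** The sigma-algebra is generated by the half-spaces {x_i > a}, each of which is a smooth limit
    set. *)
Lemma measurable_smooth_limit_gen (A : set 'rV[R]_n) : measurable A ->
  <<s smooth_limit_set >> A.
Proof.
move: A; apply: smallest_sub; first exact: smallest_sigma_algebra.
rewrite -bigcup_seq; apply: bigcup_sub => i _ A [B mB <-].
have mB' : (@RGenOInfty.G R).-sigma.-measurable B by rewrite -RGenOInfty.measurableE.
have : preimage_set_system [set: 'rV[R]_n] (coord_rV i)
   (@RGenOInfty.G R).-sigma.-measurable ([set: 'rV[R]_n] `&` coord_rV i @^-1` B).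
  by exists B.
rewrite -g_sigma_preimageE; apply: smallest_sub.
  exact: smallest_sigma_algebra.
move=> _ [_ [a ->] <-]; apply: sub_sigma_algebra.
by rewrite setTI; exact: smooth_limit_half_space.
Qed.

End coordinates.

(** * Stability properties of test functions *)

Section test_functions.
Context {R : realType} {n : nat}.
Implicit Types (U : set 'rV[R]_n) (phi psi : 'rV[R]_n -> R).

Lemma compact_continuous_bounded (A : set 'rV[R]_n) (f : 'rV[R]_n -> R) :
  compact A -> {within A, continuous f} -> exists M, forall x, A x -> `|f x| <= M.
Proof.
move=> cA cf; have [A0|/set0P A0] := eqVneq A set0.
  by exists 0 => x; rewrite A0.
have cn : {within A, continuous (fun x => `|f x|)}.
  move=> x; exact: (@continuous_comp (subspace A) R R f Num.norm x (cf x) (@norm_continuous _ _ _)).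
have [c _ cmax] := compact_EVT_max A0 cA cn.
by exists `|f c| => x Ax; apply: cmax; rewrite inE.
Qed.

Lemma compact_bounded_continuous (A : set 'rV[R]_n) (f : 'rV[R]_n -> R) :
  compact A -> continuous f -> exists M, forall x, A x -> `|f x| <= M.
Proof.
by move=> cA cf; apply: compact_continuous_bounded => //; exact: continuous_subspaceT.
Qed.

Lemma test_function_support U phi x : test_function U phi -> phi x != 0 -> U x.
Proof. by move=> [_ _ h] px; apply: h; apply: subset_closure. Qed.

Lemma test_function_bounded U phi : test_function U phi ->
  exists M, forall x, `|phi x| <= M.
Proof.
move=> [sphi cphi _].
have [M Mb] := compact_bounded_continuous cphi (smooth_continuous sphi).
exists `|M| => x; have [->|px] := eqVneq (phi x) 0; first by rewrite normr0.
by apply: le_trans (ler_norm _); apply: Mb; apply: subset_closure.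
Qed.

Lemma test_function_L2 U phi : measurable U -> (lebesgue_rV n U < +oo)%E ->
  test_function U phi -> L2 U phi.
Proof.
move=> mU fU tphi; have [M Mb] := test_function_bounded tphi.
apply: (L2_of_bounded (M := M)) => //.
by apply: continuous_measurable_rV; apply: smooth_continuous; case: tphi.
Qed.

Lemma test_function_sub U phi psi : test_function U phi -> smooth psi ->
  (forall x, psi x != 0 -> closure [set x | phi x != 0] x) -> test_function U psi.
Proof.
move=> [_ cphi phiU] spsi sub.
have cs : closure [set x | psi x != 0] `<=` closure [set x | phi x != 0].
  by rewrite [X in _ `<=` X](closure_id _).1; [exact: closureS|exact: closed_closure].
split=> //; last exact: subset_trans phiU.
by apply: (subclosed_compact _ cphi) => //; exact: closed_closure.
Qed.

Lemma test_functionM U phi f : test_function U phi -> smooth f ->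
  test_function U (fun x => phi x * f x).
Proof.
move=> tphi sf; apply: (test_function_sub tphi).
  by have [sphi _ _] := tphi; exact: (smoothM sphi sf).
by move=> x; rewrite mulf_eq0 negb_or => /andP[px _]; exact: subset_closure.
Qed.

Lemma test_functionZ U (c : R) phi : test_function U phi ->
  test_function U (fun x => c * phi x).
Proof.
move=> tphi; apply: (test_function_sub tphi).
  by apply: smoothZ; case: tphi.
by move=> x; rewrite mulf_eq0 negb_or => /andP[_ px]; exact: subset_closure.
Qed.

Lemma test_functionD U phi psi : test_function U phi -> test_function U psi ->
  test_function U (fun x => phi x + psi x).
Proof.
move=> [sphi cphi phiU] [spsi cpsi psiU].
have cs : closure [set x | phi x + psi x != 0] `<=`
    closure [set x | phi x != 0] `|` closure [set x | psi x != 0].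
  rewrite -closureU; apply: closureS => x /=.
  have [->|px] := eqVneq (phi x) 0; last by left.
  by rewrite add0r; right.
split; first exact: smoothD.
  apply: (subclosed_compact _ (compactU cphi cpsi)) => //; exact: closed_closure.
by apply: (subset_trans cs) => x [/phiU|/psiU].
Qed.

Lemma partial_support U phi i x : test_function U phi -> partial i phi x != 0 ->
  closure [set x | phi x != 0] x.
Proof.
move=> tphi px; apply: contrapT => nx; move: px.
have nc : \forall y \near x, cst 0 y = phi y.
  have : (~` closure [set x | phi x != 0]) x by [].
  have /open_nbhs_nbhs : open_nbhs x (~` closure [set x | phi x != 0]).
    by split=> //; apply: closed_openC; exact: closed_closure.
  move=> + _; apply: filterS => y ny; apply/esym/eqP.
  by apply: contrapT => /negP py; apply: ny; exact: subset_closure.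
by rewrite /partial -(near_eq_derive _ nc) derive_cst eqxx.
Qed.

Lemma test_function_partial U phi i : test_function U phi ->
  test_function U (partial i phi).
Proof.
move=> tphi; apply: (test_function_sub tphi).
  by apply: smooth_partial; case: tphi.
by move=> x; exact: partial_support tphi.
Qed.

End test_functions.

(** * Test functions are dense in L^2 and determine its norm *)

Section density.
Context {R : realType} {n : nat} (U : set 'rV[R]_n).
Local Notation mu := (@lebesgue_rV R n).
Hypothesis oU : open U.
Hypothesis fU : (mu U < +oo)%E.

(** A product of [chi k] with any smooth function is a test function, and it has the same limit on
    [U]. The sublevel sets of a defining function satisfy this ([exhaustion_sublevel]). *)
Hypothesis exhaustion : exists chi : nat -> 'rV[R]_n -> R,
  [/\ forall k, test_function U (chi k), forall k x, 0 <= chi k x <= 1 &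
      forall x, U x -> chi k x @[k --> \oo] --> (1 : R)].

Let mU : measurable U := open_measurable_rV oU.

Definition L2_test_limit (f : 'rV[R]_n -> R) : Prop := L2 U f /\
  forall e, 0 < e -> exists2 phi, test_function U phi &
    L2sqnorm U (fun x => f x - phi x) < e.

Lemma test_limit_closed f : L2 U f ->
  (forall e, 0 < e -> exists2 g, L2_test_limit g &
     L2sqnorm U (fun x => f x - g x) < e) -> L2_test_limit f.
Proof.
move=> f2 h; split=> // e e0.
have e4 : 0 < e / 4 by rewrite divr_gt0.
have [g [g2 gphi] fg] := h _ e4; have [phi tphi gp] := gphi _ e4.
exists phi => //.
have := @L2sqnormD_le R n U (fun x => f x - g x) (fun x => g x - phi x) mU
  (L2B mU f2 g2) (L2B mU g2 (test_function_L2 mU fU tphi)).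
under [X in L2sqnorm U X <= _]eq_fun do rewrite addrA subrK.
by lra.
Qed.

Lemma test_limit_test phi : test_function U phi -> L2_test_limit phi.
Proof.
move=> tphi; split=> [|e e0]; first exact: (test_function_L2 mU fU).
exists phi => //; rewrite /L2sqnorm.
by under eq_Rintegral do rewrite subrr expr0n /=; rewrite Rintegral_cst// mul0r.
Qed.

Lemma test_limitD f g : L2_test_limit f -> L2_test_limit g ->
  L2_test_limit (fun x => f x + g x).
Proof.
move=> [f2 fl] [g2 gl]; split=> [|e e0]; first exact: L2D.
have e4 : 0 < e / 4 by rewrite divr_gt0.
have [phi tphi fp] := fl _ e4; have [psi tpsi gp] := gl _ e4.
have phi2 := test_function_L2 mU fU tphi; have psi2 := test_function_L2 mU fU tpsi.
exists (fun x => phi x + psi x); first exact: test_functionD.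
have := L2sqnormD_le mU (L2B mU f2 phi2) (L2B mU g2 psi2).
have -> : (fun x => f x - phi x + (g x - psi x)) = (fun x => f x + g x - (phi x + psi x)).
  by apply/funext => x; ring.
by lra.
Qed.

Lemma test_limitZ (c : R) f : L2_test_limit f -> L2_test_limit (fun x => c * f x).
Proof.
move=> [f2 fl]; split=> [|e e0]; first exact: L2Z.
have c0 : 0 < c ^+ 2 + 1 by have := sqr_ge0 c; lra.
have [phi tphi fp] := fl (e / (c ^+ 2 + 1)) (divr_gt0 e0 c0).
have phi2 := test_function_L2 mU fU tphi.
exists (fun x => c * phi x); first exact: test_functionZ.
have -> : (fun x => c * f x - c * phi x) = (fun x => c * (f x - phi x)).
  by apply/funext => x; rewrite mulrBr.
rewrite L2sqnormZ//; last exact: L2B.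
rewrite ltr_pdivlMr// in fp; apply: le_lt_trans fp.
by have := L2sqnorm_ge0 U (fun x => f x - phi x); nra.
Qed.

Lemma test_limit_cvg (F : nat -> 'rV[R]_n -> R) f g :
  (forall k, L2_test_limit (F k)) -> L2 U f -> L2 U g ->
  (forall k x, U x -> `|F k x| <= `|g x|) ->
  (forall x, U x -> F k x @[k --> \oo] --> f x) -> L2_test_limit f.
Proof.
move=> Fl f2 g2 Fg Ff; apply: test_limit_closed => // e e0.
have F2 k := (Fl k).1.
have := dominated_L2 mU (fun k => L2_measurable (F2 k)) (L2_measurable f2) Ff g2 Fg f2.
move=> /cvgrPdist_lt/(_ _ e0)[k _ /(_ k (leqnn k))/=].
rewrite sub0r normrN ger0_norm ?L2sqnorm_ge0// => h.
exists (F k) => //; apply: le_lt_trans h.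
apply: le_L2sqnorm => //.
- exact: L2_measurable (L2B mU f2 (F2 k)).
- exact: L2B.
- by move=> x _; rewrite distrC.
Qed.

Lemma L2_indic (A : set 'rV[R]_n) : measurable A -> L2 U \1_A.
Proof.
move=> mA; apply: (L2_of_bounded (M := 1)) => //.
by move=> x _; rewrite indicE; case: (_ \in _); rewrite ?normr1 ?normr0.
Qed.

(** Dynkin's theorem: the sets whose indicator is an L^2 limit of test functions form a
    lambda-system, by dominated convergence. It contains the pi-system of smooth limit sets, since
    [chi k * F k] is a test function that tends to the indicator on [U]. *)
Lemma test_limit_indic (A : set 'rV[R]_n) : measurable A -> L2_test_limit \1_A.
Proof.
move=> mA.
pose H := [set A : set 'rV[R]_n | measurable A /\ L2_test_limit \1_A].
have [chi [tchi chi01 chi1]] := exhaustion.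
suff : <<s @smooth_limit_set R n >> `<=` H.
  by move=> /(_ _ (measurable_smooth_limit_gen mA))[].
have norm01 (t : R) : 0 <= t <= 1 -> `|t| <= `|cst (1 : R) (0 : 'rV[R]_n)|.
  by move=> /andP[t0 t1]; rewrite normr1 ger0_norm.
have cst2 := L2_cst 1 mU fU.
apply: lambda_system_subset => //.
- exact: smooth_limit_setI.
- split => //.
  + split; first exact: measurableT.
    apply: (test_limit_cvg (F := chi) (g := cst 1)) => //.
    * by move=> k; exact: test_limit_test.
    * exact: L2_indic.
    * by move=> k x _; exact: norm01.
    * by move=> x Ux; rewrite indicT; exact: chi1.
  + move=> A1 B BA [mA1 A1l] [mB Bl]; split; first exact: measurableD.
    rewrite (_ : \1__ = (fun x => \1_A1 x + -1 * \1_B x)).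
      by apply: test_limitD => //; exact: test_limitZ.
    apply/funext => x; rewrite !indicE in_setD.
    have [xB|xB] := boolP (x \in B); last by rewrite andbT mulr0 addr0.
    by rewrite (mem_set (BA _ (set_mem xB))) andbF mulr1 subrr.
  + move=> F ndF HF; have mF k : measurable (F k) := (HF k).1.
    have mUF : measurable (\bigcup_k F k) by exact: bigcup_measurable.
    split=> //.
    apply: (test_limit_cvg (F := fun k => \1_(F k)) (g := cst 1)) => //.
    * by move=> k; exact: (HF k).2.
    * exact: L2_indic.
    * by move=> k x _; apply: norm01; rewrite indicE; case: (_ \in _); rewrite /= ?ler01 ?lexx.
    * move=> x _; rewrite [X in _ --> X]indicE.
      have [[k _ Fkx]|h] := pselect ((\bigcup_k F k) x).
        rewrite mem_set/=; last by exists k.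
        apply: cvg_near_cst; exists k => // m /= km; rewrite indicE mem_set//.
        by have := ndF _ _ km; rewrite subsetEset; exact.
      rewrite memNset//=; apply: cvg_near_cst; apply: nearW => k.
      by rewrite indicE memNset// => Fkx; apply: h; exists k.
- move=> A1 A1l; have [F [sF F01 FA]] := A1l.
  have mA1 : measurable A1.
    rewrite (_ : A1 = \1_A1 @^-1` [set (1 : R)]).
      rewrite -[X in measurable X]setTI.
      have mF : measurable_fun setT (\1_A1 : 'rV[R]_n -> R).
        apply: (@measurable_fun_cvg _ _ _ setT (fun k => F k)) => //.
          by move=> k; apply: continuous_measurable_rV; exact: smooth_continuous.
      by apply: mF => //; exact: measurable_set1.
    apply/seteqP; split=> x /=; first by move=> h; rewrite indicE mem_set.
    rewrite indicE; have [/set_mem//|_ /eqP] := boolP (x \in A1).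
    by rewrite eq_sym oner_eq0.
  split=> //.
  apply: (test_limit_cvg (F := fun k x => chi k x * F k x) (g := cst 1)) => //.
  + by move=> k; apply: test_limit_test; exact: test_functionM.
  + exact: L2_indic.
  + move=> k x _; apply: norm01; have /andP[f0 f1] := F01 k x.
    have /andP[g0 g1] := chi01 k x.
    by rewrite mulr_ge0//= -[1]mulr1 ler_pM.
  + move=> x Ux; rewrite -[X in _ --> X]mul1r.
    by apply: cvgM; [exact: chi1|exact: FA].
Qed.

Lemma test_limit_sum (I : Type) (s : seq I) (F : I -> 'rV[R]_n -> R) :
  (forall i, L2_test_limit (F i)) -> L2_test_limit (fun x => \sum_(i <- s) F i x).
Proof.
move=> Fl; elim: s => [|i s IH].
  rewrite (_ : (fun x => _) = (fun x => 0 * \1_setT x)).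
    by apply: test_limitZ; exact: test_limit_indic.
  by apply/funext => x; rewrite big_nil mul0r.
rewrite (_ : (fun x => _) = (fun x => F i x + \sum_(j <- s) F j x)).
  exact: test_limitD.
by apply/funext => x; rewrite big_cons.
Qed.

Import HBNNSimple.

Lemma test_limit_ge0 (f : 'rV[R]_n -> R) : (forall x, 0 <= f x) -> L2 U f -> L2_test_limit f.
Proof.
move=> f0 f2.
have mf : measurable_fun U (EFin \o f) by apply/measurable_EFinP; exact: L2_measurable.
have ef0 x : U x -> (0 <= (EFin \o f) x)%E by move=> _; rewrite lee_fin.
pose h k := nnsfun_approx mU mf k : {nnsfun _ >-> R}.
have hl k : L2_test_limit (h k : 'rV[R]_n -> R).
  rewrite (_ : (h k : 'rV[R]_n -> R) = (fun x => \sum_(y <- finmap.enum_fset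
    (fset_set (range (h k)))) y * \1_(h k @^-1` [set y]) x)).
    apply: test_limit_sum => y; apply: test_limitZ; apply: test_limit_indic.
    exact: measurable_sfunP.
  by apply/funext => x; rewrite {1}fimfunE fsbig_finite.
apply: (@test_limit_cvg (fun k => h k : 'rV[R]_n -> R) f f hl) => //.
- move=> k x Ux; rewrite !ger0_norm//.
  have := le_approx k ef0 Ux.
  by rewrite /= -lee_fin /h nnsfun_approxE.
- move=> x Ux; have := cvg_nnsfun_approx mU mf ef0 Ux.
  by move/fine_cvg; exact.
Qed.

Lemma test_limit_L2 f : L2 U f -> L2_test_limit f.
Proof.
move=> f2.
have mf := L2_measurable f2.
have -> : f = (fun x => Num.max (f x) 0 + -1 * Num.max (- f x) 0).
  apply/funext => x; have [fx|fx] := leP 0 (f x).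
    by rewrite max_r ?mulr0 ?addr0// oppr_le0.
  by rewrite max_l ?oppr_ge0 ?ltW// add0r mulN1r opprK.
apply: test_limitD; last apply: test_limitZ; apply: test_limit_ge0.
- by move=> x; rewrite le_max lexx orbT.
- apply: (L2_le mU (g := f)) => //; first exact: measurable_maxr.
  by move=> x _; rewrite maxEle; case: ifP; rewrite ?normr0.
- by move=> x; rewrite le_max lexx orbT.
- apply: (L2_le mU (g := f)) => //.
    by apply: measurable_maxr => //; exact: measurable_funN.
  by move=> x _; rewrite maxEle; case: ifP; rewrite ?normr0 ?normrN.
Qed.

(** A test function close to [f] is nearly the optimal partner of [f] in the pairing. This is how a
    bound on pairings, in which [f] itself is never differentiated, becomes a bound on [f]. *)
Lemma L2sqnorm_le_dual f (M : R) : 0 <= M -> L2 U f ->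
  (forall phi, test_function U phi ->
     `|ip U f phi| <= M * Num.sqrt (L2sqnorm U phi)) ->
  L2sqnorm U f <= M ^+ 2.
Proof.
move=> M0 f2 h.
have [_ fl] := test_limit_L2 f2.
suff hs : Num.sqrt (L2sqnorm U f) <= M.
  by rewrite -(sqr_sqrtr (L2sqnorm_ge0 U f)) ler_sqr ?nnegrE// sqrtr_ge0.
set a := Num.sqrt _; rewrite leNgt; apply/negP => aM.
have a0 : 0 < a by exact: le_lt_trans aM.
(* Pairing [f] with [phi] will give [a ^+ 2 <= a * b + M * (a + b)], that is a (a - M) <= (a + M) b,
   where [b] is the distance from [f] to [phi]. This fails for [b < e]. *)
pose e := a * (a - M) / (a + M + 1).
have e0 : 0 < e by rewrite divr_gt0 ?mulr_gt0 ?subr_gt0//; lra.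
have [phi tphi fp] := fl _ (exprn_gt0 2 e0).
have phi2 := test_function_L2 mU fU tphi.
set b := Num.sqrt (L2sqnorm U (fun x => f x - phi x)).
have be : b < e.
  rewrite /b -(@ger0_norm _ e (ltW e0)) -sqrtr_sqr ltr_sqrt//.
  exact: exprn_gt0.
have b0 : 0 <= b by exact: sqrtr_ge0.
have pa : Num.sqrt (L2sqnorm U phi) <= a + b.
  have := sqrt_L2sqnormD_le mU f2 (L2N mU (L2B mU f2 phi2)).
  have -> : (fun x => f x - (f x - phi x)) = phi by apply/funext => x; ring.
  have -> : L2sqnorm U (fun x => - (f x - phi x)) = L2sqnorm U (fun x => f x - phi x).
    by apply: eq_Rintegral => x _; rewrite sqrrN.
  exact.
have h1 := h _ tphi.
have h2 := ip_le mU f2 (L2B mU f2 phi2); rewrite -/a -/b in h2.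
have h3 : a ^+ 2 <= a * b + M * (a + b).
  rewrite sqr_sqrtr ?L2sqnorm_ge0// L2sqnormE.
  have -> : ip U f f = ip U f (fun x => f x - phi x) + ip U f phi.
    by rewrite ipBr// subrK.
  apply: le_trans (ler_norm _) _; apply: le_trans (ler_normD _ _) _.
  apply: lerD => //; apply: le_trans h1 _; exact: ler_wpM2l.
have h4 : e * (a + M + 1) = a * (a - M) by rewrite /e divfK// gt_eqF//; lra.
have : a * b + M * b < a * (a - M).
  rewrite -h4; nra.
by nra.
Qed.

End density.

(** * Difference quotients and weak derivatives *)

Section one_variable.
Context {R : realType}.

Lemma lipschitz_of_is_derive (D dD : R -> R) (s M t : R) :
  (forall x, `|x| < s -> is_derive x (1 : R) D (dD x)) ->
  (forall x, `|x| < s -> `|dD x| <= M) -> `|t| < s ->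
  `|D t - D 0| <= M * `|t|.
Proof.
move=> DdD dM ts.
have s0 : 0 < s by exact: le_lt_trans ts.
have key (a b : R) : a <= b -> - s < a -> b < s -> exists2 c, `|c| < s & D b - D a = dD c * (b - a).
  move=> ab sa bs.
  have itvs x : x \in `[a, b] -> `|x| < s.
    by rewrite in_itv/= ltr_norml => /andP[ax xb]; apply/andP; split; lra.
  have [|x|c cab h] := @MVT_segment R D dD a b ab.
  - by move=> x /subset_itv_oo_cc/itvs; exact: DdD.
  - by apply: derivable_within_continuous => y yab; case: (DdD y (itvs _ yab)).
  - by exists c => //; exact: itvs.
have [t0|t0] := leP 0 t.
  have [||c cs ->] := key 0 t t0; [lra|by move: ts; rewrite ger0_norm|].
  by rewrite subr0 normrM ler_wpM2r// dM.
have [||c cs h] := key t 0 (ltW t0); [|lra|].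
  by move: ts; rewrite ltr0_norm//; lra.
by rewrite distrC h sub0r normrM normrN ler_wpM2r// dM.
Qed.

Lemma dnbhs0_opp (P : set R) : (\forall t \near 0^', P t) ->
  \forall t \near (0 : R)^', P (- t).
Proof.
move=> /nbhs_ballP[e /= e0 he]; apply/nbhs_ballP; exists e => // t.
rewrite -ball_normE /ball_/= sub0r normrN => te t0; apply: he; last by rewrite oppr_eq0.
by rewrite -ball_normE /ball_/= opprK add0r.
Qed.

Lemma is_derive_line n (f : 'rV[R]_n -> R) (i : 'I_n) (x : 'rV[R]_n) (t : R) :
  smooth f -> is_derive t (1 : R) (fun t : R => f (x + t *: delta_mx ord0 i))
    (partial i f (x + t *: delta_mx ord0 i)).
Proof.
move=> sf; set e : 'rV[R]_n := delta_mx ord0 i.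
have E : (fun h : R => h^-1 *: (((fun t : R => f (x + t *: e)) \o shift t) (h *: 1) - f (x + t *: e))) =
         (fun h : R => h^-1 *: ((f \o shift (x + t *: e)) (h *: e) - f (x + t *: e))).
  by apply/funext => h /=; rewrite [h *: 1]mulr1 scalerDl addrCA.
have df := @smooth_derivable R n f i (x + t *: e) sf.
apply: DeriveDef; first by move: df; rewrite /derivable -E.
by rewrite /partial /derive E.
Qed.

End one_variable.

Section integral_support.
Context {R : realType} {n : nat}.
Local Notation mu := (@lebesgue_rV R n).
Implicit Types (A B : set 'rV[R]_n) (f g : 'rV[R]_n -> R).

Lemma Rintegral_support A B f : A `<=` B -> (forall x, B x -> ~ A x -> f x = 0) ->
  \int[mu]_(x in B) f x = \int[mu]_(x in A) f x.
Proof.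
move=> AB f0; rewrite Rintegral_mkcond [RHS]Rintegral_mkcond.
apply: eq_Rintegral => x _; rewrite /patch.
have [/set_mem Bx|Bx] := boolP (x \in B).
  by have [//|/negP Ax] := boolP (x \in A); rewrite f0// => Ax'; apply: Ax; rewrite inE.
by case: ifPn => // /set_mem/AB/mem_set Bx'; rewrite Bx' in Bx.
Qed.

Lemma L2_translate (s : 'rV[R]_n) B f : measurable B -> L2 B f ->
  L2 ((fun x => x + s) @^-1` B) (fun x => f (x + s)).
Proof.
move=> mB [mf fi]; split; first exact: measurable_fun_translate.
rewrite (ge0_integral_translate s mB (f := fun x => (f x ^+ 2)%:E))//.
  by apply/measurable_EFinP; exact: measurable_funX.
by move=> x _; rewrite lee_fin sqr_ge0.
Qed.

Lemma L2sqnorm_translate (s : 'rV[R]_n) B f : measurable B -> measurable_fun B f ->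
  L2sqnorm ((fun x => x + s) @^-1` B) (fun x => f (x + s)) = L2sqnorm B f.
Proof.
move=> mB mf; apply: (Rintegral_translate s mB (f := fun x => f x ^+ 2)).
exact: measurable_funX.
Qed.

End integral_support.

Lemma bounded_closure (R : realType) n (A : set 'rV[R]_n) :
  bounded_set A -> bounded_set (closure A).
Proof.
move=> [M [Mr h]]; exists M; split=> // m Mm.
have cl : closed [set x : 'rV[R]_n | `|x| <= m].
  rewrite (_ : [set x : 'rV[R]_n | `|x| <= m] = (fun x : 'rV[R]_n => `|x|) @^-1` [set t | t <= m])//.
  by apply: closed_comp; [move=> x _; exact: norm_continuous|exact: closed_le].
by move=> x /= Ax; apply: cl; apply: closureS Ax => y; exact: h.
Qed.

(** * Sublevel sets of the defining function and small translations *)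

Section domain.
Context {R : realType} {n : nat} (Omega : set 'rV[R]_n) (rho : 'rV[R]_n -> R).
Hypothesis srho : smooth rho.
Hypothesis OE : Omega = [set x | rho x < 0].
Hypothesis bO : bounded_set Omega.

Local Notation mu := (@lebesgue_rV R n).
Implicit Types (k s t : R) (x y : 'rV[R]_n) (phi psi : 'rV[R]_n -> R).
Local Notation e_ i := (delta_mx ord0 i : 'rV[R]_n).

(** Plays the role of the points at distance more than k from the boundary. Going from [k] to a
    smaller level leaves room for small translations, see [level_translate]. *)
Definition sublevel (k : R) : set 'rV[R]_n := [set x | rho x < - k].

Lemma sublevel0 : sublevel 0 = Omega.
Proof. by rewrite OE /sublevel oppr0. Qed.

Lemma open_sublevel k : open (sublevel k).
Proof.
rewrite (_ : sublevel k = rho @^-1` [set t | t < - k])//.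
by apply: open_comp; [move=> x _; exact: smooth_continuous|exact: open_lt].
Qed.

Lemma measurable_sublevel k : measurable (sublevel k).
Proof. exact: (open_measurable_rV (@open_sublevel k)). Qed.

Lemma sublevel_sub k k' : k' <= k -> sublevel k `<=` sublevel k'.
Proof. by move=> kk x; rewrite /sublevel/=; lra. Qed.

Lemma sublevel_Omega k : 0 <= k -> sublevel k `<=` Omega.
Proof. by rewrite -sublevel0; exact: sublevel_sub. Qed.

Lemma measurable_Omega : measurable Omega.
Proof. by rewrite -sublevel0; exact: measurable_sublevel. Qed.
Let mO := measurable_Omega.

Lemma finite_Omega : (mu Omega < +oo)%E.
Proof. exact: lebesgue_rV_bounded. Qed.

Lemma finite_sublevel k : 0 <= k -> (mu (sublevel k) < +oo)%E.
Proof.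
move=> k0; apply: le_lt_trans finite_Omega; apply: le_measure; rewrite ?inE//.
  exact: measurable_sublevel.
exact: sublevel_Omega.
Qed.

Lemma compact_level k : 0 < k -> compact [set x | rho x <= - k].
Proof.
move=> k0; apply: bounded_closed_compact.
  case: bO => M [Mr h]; exists M; split=> // m Mm x /= xk.
  by apply: (h m Mm); rewrite OE/=; lra.
rewrite (_ : [set x | _] = rho @^-1` [set t | t <= - k])//.
by apply: closed_comp; [move=> x _; exact: smooth_continuous|exact: closed_le].
Qed.

Lemma test_of_level k k' phi : 0 <= k -> k < k' -> smooth phi ->
  (forall x, phi x != 0 -> rho x <= - k') -> test_function (sublevel k) phi.
Proof.
move=> k0 kk sphi h.
have cl : closed [set x | rho x <= - k'].
  by apply: compact_closed; [exact: norm_hausdorff|apply: compact_level; lra].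
have sub : closure [set x | phi x != 0] `<=` [set x | rho x <= - k'].
  by rewrite [X in _ `<=` X](closure_id _).1//; exact: closureS.
split=> //.
- apply: (subclosed_compact _ (compact_level _) sub); last lra.
  exact: closed_closure.
- by move=> x /sub /=; rewrite /sublevel/=; lra.
Qed.

Lemma test_in_level phi : test_function Omega phi ->
  exists2 k, 0 < k & closure [set x | phi x != 0] `<=` [set x | rho x <= - k].
Proof.
move=> [sphi cphi phiO].
have [p0|/set0P p0] := eqVneq (closure [set x | phi x != 0]) set0.
  by exists 1 => //; rewrite p0.
have [c /set_mem cs cmax] := compact_EVT_max p0 cphi
  (continuous_subspaceT (smooth_continuous srho)).
exists (- rho c).
  by have := phiO _ cs; rewrite OE/= oppr_gt0.
by move=> x xs; rewrite /= opprK; apply: cmax; rewrite inE.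
Qed.

(** Each point can be moved a little by continuity of [rho]; compactness of {rho <= - k} makes the
    admissible length uniform. *)
Lemma level_translate k k' : 0 <= k' -> k' < k ->
  exists2 s, 0 < s & forall x y, rho x <= - k -> `|y| < s -> rho (x + y) < - k'.
Proof.
move=> k'0 kk.
have k0 : 0 < k by lra.
have /compact_near_coveringP cov := compact_level k0.
have := cov _ (nbhs (0 : 'rV[R]_n)) (fun y x => rho (x + y) < - k') _.
case=> [|I I0 IE]; last first.
  have /nbhs_ballP[e /= e0 he] : nbhs (0 : 'rV[R]_n)
      (fun y => [set x | rho x <= - k] `<=` (fun x => rho (x + y) < - k')) by exists I.
  exists e => // x y xk ye; apply: (he y) => //=.
  by rewrite -ball_normE /ball_/= sub0r normrN.
move=> x /= xk.
have crho : rho (q.1 + q.2) @[q --> (x, (0 : 'rV[R]_n))] --> rho (x + 0).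
  apply: (cvg_comp (fun q : 'rV[R]_n * 'rV[R]_n => q.1 + q.2) rho).
    by apply: cvgD; [exact: cvg_fst|exact: cvg_snd].
  exact: smooth_continuous.
by apply: (cvgr_lt _ crho); rewrite addr0; lra.
Qed.

Lemma exhaustion_sublevel k : 0 <= k -> exists chi : nat -> 'rV[R]_n -> R,
  [/\ forall j, test_function (sublevel k) (chi j), forall j x, 0 <= chi j x <= 1 &
      forall x, sublevel k x -> chi j x @[j --> \oo] --> (1 : R)].
Proof.
(* The shift by -1 keeps the support inside {rho <= - k - 1/(j+1)}, a compact subset of the open
   sublevel set. *)
move=> k0; exists (fun j x => gamma 0 ((- k + - rho x) * j.+1%:R + - 1)).
split=> [j|j x|x kx].
- apply: (@test_of_level k (k + j.+1%:R^-1) _ k0).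
  + by rewrite ltrDl invr_gt0 ltr0n.
  + apply: smooth_gamma.
    have := smoothD (smoothM (smoothD (smooth_cst (- k))
      (smoothZ (-1) srho)) (smooth_cst j.+1%:R)) (smooth_cst (- 1)).
    by under eq_fun do rewrite /= mulN1r.
  + move=> x; apply: contraNT; rewrite -ltNge => h.
    rewrite gamma_le0// subr_le0 -ler_pdivlMr ?ltr0n//.
    by move: h; rewrite mul1r; set a := _^-1; lra.
- by rewrite gamma_ge0 gamma0_le1.
- by apply: gamma0_cvg1; move: kx; rewrite /sublevel/=; lra.
Qed.

Lemma delta_norm (t : R) (i : 'I_n) : `|t *: e_ i| <= `|t|.
Proof.
rewrite normrZ -[leRHS]mulr1 ler_wpM2l//.
rewrite [leLHS]mx_normrE; apply/bigmax_leP; split=> //= -[a b] _ /=.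
by rewrite mxE; case: (_ && _); rewrite ?normr1 ?normr0.
Qed.

(** * Difference quotients of a weakly differentiable function *)

Section difference_quotients.
Variables (w g : 'rV[R]_n -> R) (i : 'I_n).
Hypothesis w2 : L2 Omega w.

(** For small [t] this is the pairing of [psi] with x -> w (x + t e_i), as used in
    [difference_test]. In the present form only the smooth factor depends on [t], so it can be
    differentiated. *)
Definition translate_pairing (psi : 'rV[R]_n -> R) (t : R) : R := ip Omega w (fun x => psi (x + (- t) *: e_ i)).

Lemma test_translate k psi s : 0 < k -> test_function (sublevel k) psi ->
  (forall x y, rho x <= - k -> `|y| < s -> rho (x + y) < - (k / 2)) ->
  forall t, `|t| < s -> test_function Omega (fun x => psi (x + t *: e_ i)).
Proof.
move=> k0 tpsi sh t ts; rewrite -sublevel0.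
apply: (@test_of_level 0 (k / 2) _ (lexx 0)); first lra.
  by apply: smooth_translate; case: tpsi.
move=> x px.
have /ltW xk : rho (x + t *: e_ i) < - k := test_function_support tpsi px.
have := sh _ (- (t *: e_ i)) xk.
by rewrite addrK normrN => h; apply/ltW/h; apply: le_lt_trans ts; exact: delta_norm.
Qed.

(** Differentiation under the integral sign: the derivative of the integrand is at most a constant
    times |w|, which is integrable because [Omega] has finite measure. *)
Lemma is_derive_ip_translate k psi s : 0 < k -> test_function (sublevel k) psi ->
  (forall x y, rho x <= - k -> `|y| < s -> rho (x + y) < - (k / 2)) ->
  forall t, `|t| < s -> is_derive t (1 : R) (translate_pairing psi)
    (- ip Omega w (fun x => partial i psi (x + (- t) *: e_ i))).
Proof.
move=> k0 tpsi sh t ts.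
have spsi : smooth psi by case: tpsi.
have tt u : `|u| < s -> test_function Omega (fun x => psi (x + (- u) *: e_ i)).
  by move=> us; apply: (test_translate k0 tpsi sh); rewrite normrN.
have [M Mb] := test_function_bounded (test_function_partial i tpsi).
pose f (u : R) (x : 'rV[R]_n) : R := w x * psi (x + (- u) *: e_ i).
have df u x : is_derive u (1 : R) (f ^~ x) (w x * - partial i psi (x + (- u) *: e_ i)).
  have d1 := @is_derive_line R n psi i x (- u) spsi.
  have d0 : is_derive u (1 : R) (fun u : R => - u) (- 1).
    exact: (is_deriveN (is_derive_id u (1 : R))).
  have d2 := is_derive1_comp d1 d0.
  have := is_deriveZ (w x) d2.
  by rewrite /GRing.scale/= mulrN1; exact.
have fi u : `|u| < s -> mu.-integrable Omega (EFin \o f u).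
  move=> us; apply: L2_integrableM => //.
  exact: (test_function_L2 mO finite_Omega (tt _ us)).
have E : partial1of2 f t = (fun x => - (w x * partial i psi (x + (- t) *: e_ i))).
  apply/funext => x; rewrite partial1of2E; have [_ ->] := df t x.
  by rewrite mulrN.
have Iuv u : u \in `]- s, s[ -> `|u| < s by rewrite in_itv/= ltr_norml.
have It : t \in `]- s, s[ by rewrite in_itv/= -ltr_norml.
have int_u u : (`]- s, s[%classic : set R) u -> mu.-integrable Omega (EFin \o f u).
  by move=> /Iuv; exact: fi.
have der_u u y : (`]- s, s[%classic : set R) u -> Omega y -> derivable (f ^~ y) u 1.
  by move=> _ _; case: (df u y).
have w1 : mu.-integrable Omega (EFin \o (fun x => `|M| * `|w x|)).
  have := integrableZl mO (`|M|) (integrable_norm (L2_integrable mO finite_Omega w2)).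
  exact.
have ub u y : (`]- s, s[%classic : set R) u -> Omega y ->
    `|partial1of2 f u y| <= `|M| * `|w y|.
  move=> _ _; rewrite partial1of2E; have [_ ->] := df u y.
  rewrite normrM normrN mulrC ler_wpM2r//.
  by apply: le_trans (ler_norm _); exact: Mb.
have pos y : 0 <= `|M| * `|w y| by rewrite mulr_ge0.
apply: DeriveDef.
  exact: (derivable_under_integral mO It int_u der_u pos w1 ub).
rewrite -derive1E (differentiation_under_integral mO It int_u der_u pos w1 ub).
rewrite E; have p2 : L2 Omega (fun x => partial i psi (x + (- t) *: e_ i)).
  have := test_function_L2 mO finite_Omega (test_function_partial i (tt _ ts)).
  rewrite (_ : partial i _ = (fun x => partial i psi (x + (- t) *: e_ i)))//.
  by apply/funext => x; rewrite partial_translate.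
have := RintegralZl (-1) mO (L2_integrableM mO w2 p2).
by rewrite mulN1r; under eq_Rintegral do rewrite mulN1r.
Qed.

Hypothesis wg : is_weak_partial Omega i w g.
Let g2 : L2 Omega g := wg.1.

(** The translate of [psi] is still a test function of [Omega], so the definition of the weak
    derivative applies to it at every small [t], not just at 0. *)
Lemma is_derive_translate k psi s : 0 < k -> test_function (sublevel k) psi ->
  (forall x y, rho x <= - k -> `|y| < s -> rho (x + y) < - (k / 2)) ->
  forall t, `|t| < s -> is_derive t (1 : R) (translate_pairing psi)
    (ip Omega g (fun x => psi (x + (- t) *: e_ i))).
Proof.
move=> k0 tpsi sh t ts.
have tt : test_function Omega (fun x => psi (x + (- t) *: e_ i)).
  by apply: (test_translate k0 tpsi sh); rewrite normrN.
have := wg.2 _ tt; under eq_Rintegral do rewrite partial_translate.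
move=> h; have -> : ip Omega g (fun x => psi (x + (- t) *: e_ i)) =
    - ip Omega w (fun x => partial i psi (x + (- t) *: e_ i)) by rewrite /ip h opprK.
exact: is_derive_ip_translate k0 tpsi sh t ts.
Qed.

Lemma L2sqnorm_test_translate k psi t : 0 <= k -> test_function (sublevel k) psi ->
  test_function Omega (fun x => psi (x + t *: e_ i)) ->
  L2sqnorm Omega (fun x => psi (x + t *: e_ i)) = L2sqnorm (sublevel k) psi.
Proof.
move=> k0 tpsi tt.
have cpsi : continuous psi by apply: smooth_continuous; case: tpsi.
transitivity (L2sqnorm [set: 'rV[R]_n] psi); last first.
  apply: Rintegral_support => // x _ kx.
  have [->|/(test_function_support tpsi)//] := eqVneq (psi x) 0.
  by rewrite expr0n.
rewrite -(L2sqnorm_translate (t *: e_ i) measurableT (continuous_measurable_rV (D := setT) cpsi)).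
apply/esym; apply: Rintegral_support => // x _ kx.
have [->|/(test_function_support tt)//] := eqVneq (psi (x + t *: e_ i)) 0.
by rewrite expr0n.
Qed.

Lemma ip_translate (f v : 'rV[R]_n -> R) (A : set 'rV[R]_n) t : measurable A ->
  L2 Omega v -> measurable_fun setT f ->
  (forall x, f x != 0 -> A x) -> (forall x, A x -> Omega (x + t *: e_ i)) ->
  ip Omega v (fun x => f (x + (- t) *: e_ i)) =
  ip A (fun x => v (x + t *: e_ i)) f.
Proof.
move=> mA v2 mf fA AO.
rewrite /ip -(Rintegral_translate (t *: e_ i) mO); last first.
  apply: measurable_funM; first exact: L2_measurable v2.
  have := @measurable_fun_translate R n ((- t) *: e_ i) _ R setT f measurableT mf.
  by apply: measurable_funS => //; rewrite preimage_setT.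
rewrite (Rintegral_support (A := A)); last first.
- move=> x _ Ax; rewrite scaleNr addrK.
  by have [->|/fA//] := eqVneq (f x) 0; rewrite mulr0.
- by move=> x Ax; exact: AO.
by apply: eq_Rintegral => x _; rewrite scaleNr addrK.
Qed.

Lemma difference_test k psi s t : 0 < k -> test_function (sublevel k) psi ->
  (forall x y, rho x <= - k -> `|y| < s -> rho (x + y) < - (k / 2)) ->
  `|t| < s ->
  ip (sublevel k) (fun x => w (x + t *: e_ i) - w x) psi = translate_pairing psi t - translate_pairing psi 0.
Proof.
move=> k0 tpsi sh ts.
have s0 : 0 < s by exact: le_lt_trans ts.
have key u : `|u| < s -> translate_pairing psi u = ip (sublevel k) (fun x => w (x + u *: e_ i)) psi.
  move=> us; apply: ip_translate => //.
  - exact: measurable_sublevel.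
  - by apply: continuous_measurable_rV; apply: smooth_continuous; case: tpsi.
  - by move=> x; exact: test_function_support.
  - move=> x kx; have := sh x (u *: e_ i) (ltW kx) (le_lt_trans (delta_norm _ _) us).
    by rewrite OE/=; lra.
rewrite key// key ?normr0//.
have mk := measurable_sublevel k.
have w2k : L2 (sublevel k) w.
  by apply: (L2_subset mO) => //; apply: sublevel_Omega; lra.
have wt2 : L2 (sublevel k) (fun x => w (x + t *: e_ i)).
  apply: (L2_subset _ mk _ (L2_translate (t *: e_ i) mO w2)).
    exact: measurable_preimage_translate.
  move=> x kx /=; have := sh x (t *: e_ i) (ltW kx) (le_lt_trans (delta_norm _ _) ts).
  by rewrite OE/=; lra.
rewrite ipBl//; last by apply: (test_function_L2 mk) => //; apply: finite_sublevel; lra.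
by congr (_ - _); apply: eq_Rintegral => x _; rewrite scale0r addr0.
Qed.

Lemma L2_difference k s t : 0 < k ->
  (forall x y, rho x <= - k -> `|y| < s -> rho (x + y) < - (k / 2)) ->
  `|t| < s -> L2 (sublevel k) (fun x => w (x + t *: e_ i) - w x).
Proof.
move=> k0 sh ts; have mk := measurable_sublevel k; apply: L2B => //.
  apply: (L2_subset _ mk _ (L2_translate (t *: e_ i) mO w2)).
    exact: measurable_preimage_translate.
  move=> x kx /=; have := sh x (t *: e_ i) (ltW kx) (le_lt_trans (delta_norm _ _) ts).
  by rewrite OE/=; lra.
by apply: (L2_subset mO) => //; apply: sublevel_Omega; lra.
Qed.

(** By duality it suffices to pair the difference with a test function. The pairing is an increment
    of [translate_pairing], whose derivative is bounded by |g| |psi| by Cauchy-Schwarz, and the mean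
    value theorem applies. *)
Lemma L2sqnorm_difference k s t : 0 < k ->
  (forall x y, rho x <= - k -> `|y| < s -> rho (x + y) < - (k / 2)) ->
  `|t| < s -> L2sqnorm (sublevel k) (fun x => w (x + t *: e_ i) - w x) <=
    t ^+ 2 * L2sqnorm Omega g.
Proof.
move=> k0 sh ts; have k0' := ltW k0.
have -> : t ^+ 2 * L2sqnorm Omega g = (Num.sqrt (L2sqnorm Omega g) * `|t|) ^+ 2.
  by rewrite exprMn sqr_sqrtr ?L2sqnorm_ge0// real_normK ?num_real// mulrC.
apply: (L2sqnorm_le_dual (open_sublevel (k := k)) (finite_sublevel k0')
  (exhaustion_sublevel k0')).
- by rewrite mulr_ge0 ?sqrtr_ge0.
- exact: L2_difference sh ts.
move=> psi tpsi; rewrite (difference_test k0 tpsi sh ts).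
rewrite mulrAC; apply: (lipschitz_of_is_derive (is_derive_translate k0 tpsi sh) _ ts).
move=> u us.
have tt : test_function Omega (fun x => psi (x + (- u) *: e_ i)).
  by apply: (test_translate k0 tpsi sh); rewrite normrN.
have := ip_le mO g2 (test_function_L2 mO finite_Omega tt).
by rewrite (L2sqnorm_test_translate k0' tpsi tt).
Qed.

(** For a test function this is the derivative of [translate_pairing] at 0. Density reaches a
    general [f], because the difference quotients are bounded in L^2 uniformly in [t]. *)
Lemma difference_quotient_weak_cvg k f : 0 < k -> L2 (sublevel k) f ->
  t^-1 * ip (sublevel k) (fun x => w (x + t *: e_ i) - w x) f @[t --> 0^'] -->
  ip (sublevel k) g f.
Proof.
move=> k0 f2; have k0' := ltW k0; have mk := measurable_sublevel k.
have [s s0 sh] : exists2 s, 0 < s &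
    forall x y, rho x <= - k -> `|y| < s -> rho (x + y) < - (k / 2).
  by apply: level_translate; lra.
set G := Num.sqrt (L2sqnorm Omega g).
have G0 : 0 <= G := sqrtr_ge0 _.
have g2k : L2 (sublevel k) g by apply: (L2_subset mO) => //; apply: sublevel_Omega.
have gG : Num.sqrt (L2sqnorm (sublevel k) g) <= G.
  by rewrite ler_wsqrtr// le_L2sqnorm_subset//; apply: sublevel_Omega.
apply/cvgrPdist_lt => e e0.
(* Each of the two errors caused by replacing [f] with [psi] is at most [G * eta <= e / 3]; the
   [+ 1] covers [G = 0]. *)
pose eta := e / (3 * (G + 1)).
have eta0 : 0 < eta by rewrite divr_gt0// mulr_gt0//; lra.
have [_ fl] := test_limit_L2 (open_sublevel (k := k)) (finite_sublevel k0')
  (exhaustion_sublevel k0') f2.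
have [psi tpsi fp] := fl _ (exprn_gt0 2 eta0).
have psi2 := test_function_L2 mk (finite_sublevel k0') tpsi.
have d2 := L2B mk f2 psi2.
have fpe : Num.sqrt (L2sqnorm (sublevel k) (fun x => f x - psi x)) < eta.
  by rewrite -(@ger0_norm _ eta (ltW eta0)) -sqrtr_sqr ltr_sqrt// exprn_gt0.
have [D1 D2] : is_derive (0 : R) (1 : R) (translate_pairing psi) (ip Omega g (fun x => psi (x + (- 0) *: e_ i))).
  by apply: (is_derive_translate k0 tpsi sh); rewrite normr0.
have Dg : ip Omega g (fun x => psi (x + (- 0) *: e_ i)) = ip (sublevel k) g psi.
  rewrite /ip; under eq_Rintegral do rewrite oppr0 scale0r addr0.
  apply: Rintegral_support; first exact: sublevel_Omega.
  move=> x _ kx; have [->|/(test_function_support tpsi)//] := eqVneq (psi x) 0.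
  by rewrite mulr0.
have quo : h^-1 * (translate_pairing psi h - translate_pairing psi 0) @[h --> 0^'] --> ip (sublevel k) g psi.
  have /cvg_ex[/= l hl] := D1.
  have El : l = ip (sublevel k) g psi by rewrite -Dg -D2; apply/esym/cvg_lim.
  move: hl; rewrite El; set u := (X in X @ _ --> _ -> _); set v := (X in _ -> X @ _ --> _).
  by have -> : u = v by apply/funext => h; rewrite /u /v /= addr0 [h *: 1]mulr1.
have bound : G * eta <= e / 3.
  have G1 : 0 < 3 * (G + 1) by lra.
  rewrite /eta mulrA ler_pdivrMr//.
  have -> : e / 3 * (3 * (G + 1)) = e * (G + 1) by field.
  by nra.
near=> t.
have t0 : t != 0 by near: t; exact: nbhs_dnbhs_neq.
have ts : `|t| < s by near: t; exact: dnbhs0_lt.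
have Dt2 : L2 (sublevel k) (fun x => w (x + t *: e_ i) - w x) := L2_difference k0 sh ts.
have q1 : `|ip (sublevel k) g psi - t^-1 * (translate_pairing psi t - translate_pairing psi 0)| < e / 3.
  near: t; move/cvgrPdist_lt : quo; apply; lra.
have q2 : `|ip (sublevel k) g (fun x => f x - psi x)| <= G * eta.
  apply: le_trans (ip_le mk g2k d2) _; apply: ler_pM => //; try exact: sqrtr_ge0.
  exact: ltW.
have q3 : `|t^-1 * ip (sublevel k) (fun x => w (x + t *: e_ i) - w x)
    (fun x => f x - psi x)| <= G * eta.
  rewrite normrM normfV ler_pdivrMl ?normr_gt0//.
  apply: le_trans (ip_le mk Dt2 d2) _; rewrite mulrA.
  apply: ler_pM; try exact: sqrtr_ge0; last exact: ltW.
  have := L2sqnorm_difference k0 sh ts.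
  have -> : t ^+ 2 * L2sqnorm Omega g = (`|t| * G) ^+ 2.
    by rewrite exprMn sqr_sqrtr ?L2sqnorm_ge0// real_normK ?num_real.
  by move/ler_wsqrtr; rewrite sqrtr_sqr ger0_norm// mulr_ge0.
have -> : ip (sublevel k) g f = ip (sublevel k) g (fun x => f x - psi x) + ip (sublevel k) g psi.
  by rewrite ipBr// subrK.
have -> : ip (sublevel k) (fun x => w (x + t *: e_ i) - w x) f =
  ip (sublevel k) (fun x => w (x + t *: e_ i) - w x) (fun x => f x - psi x) +
  (translate_pairing psi t - translate_pairing psi 0).
  by rewrite -(difference_test k0 tpsi sh ts) ipBr// subrK.
move: q1 q2 q3.
set a := ip _ g (fun x => f x - psi x); set b := ip _ g psi; set X := ip _ _ _.
set Y := translate_pairing psi t - _; move=> q1 q2 q3.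
have -> : a + b - t^-1 * (X + Y) = (b - t^-1 * Y) + (a - t^-1 * X) by ring.
apply: le_lt_trans (ler_normD _ _) _.
have := ler_normB a (t^-1 * X); lra.
Unshelve. all: end_near. Qed.

End difference_quotients.

(** Up to sign the integral is the derivative at 0 of the integral of a translate of [phi], which is
    constant by translation invariance. *)
Lemma Rintegral_partial_test phi i : test_function Omega phi ->
  \int[mu]_(x in Omega) partial i phi x = 0.
Proof.
move=> tphi; have sphi : smooth phi by case: tphi.
have [k2 k20 supp] := test_in_level tphi.
pose k := k2 / 2; have k0 : 0 < k by rewrite /k; lra.
have tk : test_function (sublevel k) phi.
  apply: (test_of_level (ltW k0) (k' := k2)) => //; first by rewrite /k; lra.
  by move=> x px; apply: supp; exact: subset_closure.
have [s s0 sh] : exists2 s, 0 < s &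
    forall x y, rho x <= - k -> `|y| < s -> rho (x + y) < - (k / 2).
  by apply: level_translate; lra.
have one2 : L2 Omega (cst 1) by exact: (L2_cst 1 mO finite_Omega).
have [D1 D2] : is_derive (0 : R) (1 : R)
    (translate_pairing (cst 1) i phi)
    (- ip Omega (cst 1) (fun x => partial i phi (x + (- 0) *: e_ i))).
  have z0 : `|0 : R| < s by rewrite normr0.
  exact: (@is_derive_ip_translate (cst 1) i one2 k phi s k0 tk sh 0 z0).
have nc : \forall t \near (0 : R), cst (ip (sublevel k) (cst 1) phi) t =
    translate_pairing (cst 1) i phi t.
  apply/nbhs_ballP; exists s => // t; rewrite -ball_normE /ball_/= sub0r normrN => ts.
  apply/esym; apply: ip_translate => //.
  - exact: measurable_sublevel.
  - by apply: continuous_measurable_rV; exact: smooth_continuous.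
  - by move=> x; exact: test_function_support.
  - move=> x kx; have := sh x (t *: e_ i) (ltW kx) (le_lt_trans (delta_norm _ _) ts).
    by rewrite OE/=; lra.
move: D2; rewrite -(near_eq_derive (1 : R) nc) derive_cst => /esym/eqP.
rewrite oppr_eq0 => /eqP; rewrite /ip => <-.
by apply: eq_Rintegral => x _; rewrite mul1r oppr0 scale0r addr0.
Qed.

Lemma is_weak_partial_addc (w g : 'rV[R]_n -> R) i (c : R) : L2 Omega w ->
  is_weak_partial Omega i w g -> is_weak_partial Omega i (fun x => w x + c) g.
Proof.
move=> w2 [g2 wg]; split=> // phi tphi; rewrite -wg//.
have p2 := test_function_L2 mO finite_Omega (test_function_partial i tphi).
have c2 := L2_cst c mO finite_Omega.
have -> : \int[mu]_(x in Omega) ((w x + c) * partial i phi x) =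
    ip Omega w (partial i phi) + ip Omega (cst c) (partial i phi) by rewrite -ipDl.
have -> : ip Omega (cst c) (partial i phi) = c * \int[mu]_(x in Omega) partial i phi x.
  by rewrite -RintegralZl//; exact: L2_integrable mO finite_Omega p2.
by rewrite Rintegral_partial_test// mulr0 addr0.
Qed.

Lemma row_le_norm (x : 'rV[R]_n) (i : 'I_n) : `|x ord0 i| <= `|x|.
Proof.
by rewrite [leRHS]mx_normrE; apply/bigmax_geP; right; exists (ord0, i).
Qed.

(** The translation by [y] is performed one coordinate at a time, and [L2sqnorm_difference] bounds
    each step. One pair [s], [C] serves all functions [w], as the Poincare inequality requires. *)
Lemma translation_bound k : 0 < k -> exists s C : R, [/\ 0 < s, 0 <= C &
  forall (w : 'rV[R]_n -> R) (g : 'I_n -> 'rV[R]_n -> R), L2 Omega w ->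
    (forall i, is_weak_partial Omega i w (g i)) ->
  forall y, `|y| < s -> (forall x, sublevel k x -> Omega (x + y)) /\
    L2sqnorm (sublevel k) (fun x => w (x + y) - w x) <= C * \sum_i L2sqnorm Omega (g i)].
Proof.
move=> k0.
have [s1 s10 sh1] : exists2 s, 0 < s &
    forall x y, rho x <= - k -> `|y| < s -> rho (x + y) < - (k / 2).
  by apply: level_translate; lra.
have k20 : 0 < k / 2 by lra.
have [s2 s20 sh2] : exists2 s, 0 < s &
    forall x y, rho x <= - (k / 2) -> `|y| < s -> rho (x + y) < - (k / 2 / 2).
  by apply: level_translate; lra.
pose s := Num.min s1 s2.
have ss1 : s <= s1 by rewrite /s ge_min lexx.
have ss2 : s <= s2 by rewrite /s ge_min lexx orbT.
(* The recursion reflects |f + g|^2 <= 2 |f|^2 + 2 |g|^2: one new coordinate step, plus the steps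
   already made. *)
pose C := fix C j : R := if j is j'.+1 then 2 * (s ^+ 2) + 2 * C j' else 0.
have C0 j : 0 <= C j by elim: j => //= j IH; rewrite addr_ge0// mulr_ge0// sqr_ge0.
exists s, (C n); split=> [|//|w g w2 wg y ys]; first by rewrite /s lt_min s10.
have g0 i : 0 <= L2sqnorm Omega (g i) := L2sqnorm_ge0 _ _.
set G := \sum_i _; have G0 : 0 <= G by apply: sumr_ge0.
have mk := measurable_sublevel k; have mk2 := measurable_sublevel (k / 2).
have kO : sublevel k `<=` Omega by apply: sublevel_Omega; lra.
have w2k : L2 (sublevel k) w by apply: (L2_subset mO).
(* The first [j] coordinates of [y]. In the sup norm these are no longer than [y], so the
   intermediate points stay in the sublevel set of [k / 2], on which the next step is controlled. *)
pose yy (j : nat) : 'rV[R]_n := \row_i (if (i < j)%N then y ord0 i else 0).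
have yys j : `|yy j| < s.
  apply: le_lt_trans ys; rewrite [leLHS]mx_normrE; apply/bigmax_leP; split=> //= -[a b] _ /=.
  rewrite mxE ord1; case: ifP => _; first exact: row_le_norm.
  by rewrite normr0.
have inO j x : sublevel k x -> Omega (x + yy j).
  by move=> kx; have := sh1 x (yy j) (ltW kx) (lt_le_trans (yys j) ss1); rewrite OE/=; lra.
have wy2 j : L2 (sublevel k) (fun x => w (x + yy j)).
  apply: (L2_subset _ mk _ (L2_translate (yy j) mO w2)).
    exact: measurable_preimage_translate.
  by move=> x; exact: inO.
have yn : yy n = y by apply/rowP => i; rewrite mxE ltn_ord.
suff key j : (j <= n)%N -> L2sqnorm (sublevel k) (fun x => w (x + yy j) - w x) <= C j * G.
  by split; [move=> x; rewrite -yn; exact: inO|rewrite -{1}yn; exact: key].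
elim: j => [_|j IH jn].
  rewrite (_ : yy 0%N = 0); last by apply/rowP => i; rewrite !mxE ltn0.
  rewrite /= mul0r /L2sqnorm; under eq_Rintegral do rewrite addr0 subrr expr0n /=.
  by rewrite Rintegral_cst// mul0r.
pose i := Ordinal jn; pose t := y ord0 i.
have ts : `|t| < s2.
  by apply: (lt_le_trans _ ss2); apply: le_lt_trans ys; exact: row_le_norm.
have yS : yy j.+1 = yy j + t *: e_ i.
  apply/rowP => l; rewrite !mxE eqxx /= ltnS leq_eqVlt.
  have [li|li] := eqVneq l i.
    by rewrite li /= eqxx ltnn mulr1 add0r.
  by rewrite mulr0 addr0; case: eqP => //= lj; case/eqP: li; apply/val_inj.
pose f x := w (x + t *: e_ i) - w x.
have f2 : L2 (sublevel (k / 2)) f := L2_difference i w2 k20 sh2 ts.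
have fb := L2sqnorm_difference w2 (wg i) k20 sh2 ts.
have sub : sublevel k `<=` (fun x => x + yy j) @^-1` sublevel (k / 2).
  move=> x kx /=.
  by have := sh1 x (yy j) (ltW kx) (lt_le_trans (yys j) ss1).
have mpre : measurable ((fun x => x + yy j) @^-1` sublevel (k / 2)).
  exact: measurable_preimage_translate.
have fy2 := L2_translate (yy j) mk2 f2.
have -> : (fun x => w (x + yy j.+1) - w x) =
    (fun x => f (x + yy j) + (w (x + yy j) - w x)).
  by apply/funext => x; rewrite /f yS addrA subrKA.
apply: le_trans (L2sqnormD_le mk (L2_subset mpre mk sub fy2) (L2B mk (wy2 j) w2k)) _.
have -> : C j.+1 * G = 2 * (s ^+ 2 * G) + 2 * (C j * G) by rewrite /C -/C; ring.
apply: lerD; rewrite ler_pM2l//; last exact: IH (ltnW jn).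
apply: le_trans (le_L2sqnorm_subset mpre mk sub fy2) _.
rewrite (L2sqnorm_translate (yy j) mk2 (L2_measurable f2)).
apply: le_trans fb _; apply: ler_pM; rewrite ?sqr_ge0//.
  rewrite -(real_normK (num_real t)) ler_sqr ?nnegrE//; last by rewrite /s le_min !ltW.
  by apply/ltW; apply: le_lt_trans ys; exact: row_le_norm.
by rewrite /G (bigD1 i)//= lerDl; apply: sumr_ge0.
Qed.

Lemma continuous_bounded_on_domain (f : 'rV[R]_n -> R) : continuous f -> exists M : R, forall x, Omega x -> `|f x| <= M.
Proof.
move=> cf.
have cO : compact (closure Omega).
  apply: bounded_closed_compact; last exact: closed_closure.
  exact: bounded_closure.
have [M Mb] := compact_bounded_continuous cO cf.
by exists M => x Ox; apply: Mb; exact: subset_closure.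
Qed.

Lemma L2_continuous_mul (b f : 'rV[R]_n -> R) : continuous b -> L2 Omega f -> L2 Omega (fun x => b x * f x).
Proof.
move=> cb f2; have [M Mb] := continuous_bounded_on_domain cb.
by apply: (L2_bounded_mul mO _ Mb) => //; exact: continuous_measurable_rV.
Qed.

Lemma L2_smooth_mul b f : smooth b -> L2 Omega f -> L2 Omega (fun x => b x * f x).
Proof. by move=> sb; apply: L2_continuous_mul; exact: smooth_continuous. Qed.

(** The weak derivative of [w] is tested against [psi * phi], and the classical product rule is
    applied to the two smooth factors. *)
Lemma weak_partialM (phi w g : 'rV[R]_n -> R) (i : 'I_n) : smooth phi ->
  L2 Omega w -> is_weak_partial Omega i w g ->
  is_weak_partial Omega i (fun x => phi x * w x)
    (fun x => phi x * g x + partial i phi x * w x).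
Proof.
move=> sphi w2 wg; have g2 := wg.1.
have dphi := smooth_partial i sphi.
have pg2 := L2_smooth_mul sphi g2; have dpw2 := L2_smooth_mul dphi w2.
split; first exact: L2D.
move=> psi tpsi; have spsi : smooth psi by case: tpsi.
have psi2 := test_function_L2 mO finite_Omega tpsi.
have dpsi2 := test_function_L2 mO finite_Omega (test_function_partial i tpsi).
have := wg.2 _ (test_functionM tpsi sphi).
under eq_Rintegral do rewrite partialM//.
have -> : \int[mu]_(x in Omega) (w x * (psi x * partial i phi x + phi x * partial i psi x)) =
    ip Omega (fun x => partial i phi x * w x) psi + ip Omega (fun x => phi x * w x) (partial i psi).
  rewrite /ip -RintegralD//; last 2 first.
  - exact: L2_integrableM.
  - by apply: L2_integrableM => //; exact: L2_smooth_mul.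
  by apply: eq_Rintegral => x _; ring.
have -> : \int[mu]_(x in Omega) (g x * (psi x * phi x)) = ip Omega (fun x => phi x * g x) psi.
  by apply: eq_Rintegral => x _; ring.
have -> : \int[mu]_(x in Omega) ((phi x * g x + partial i phi x * w x) * psi x) =
    ip Omega (fun x => phi x * g x) psi + ip Omega (fun x => partial i phi x * w x) psi.
  by rewrite -ipDl.
by rewrite /ip; lra.
Qed.

(* Both sides are limits of the same difference quotients, the increment being
   moved from one factor to the other by a translation. *)
Lemma weak_integration_by_parts (phi w v gw gv : 'rV[R]_n -> R) (i : 'I_n) :
  test_function Omega phi -> L2 Omega w -> L2 Omega v ->
  is_weak_partial Omega i w gw -> is_weak_partial Omega i v gv ->
  ip Omega (fun x => phi x * w x) gv +
  ip Omega (fun x => phi x * gw x + partial i phi x * w x) v = 0.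
Proof.
move=> tphi w2 v2 wgw vgv; have sphi : smooth phi by case: tphi.
pose f x := phi x * w x; pose gf x := phi x * gw x + partial i phi x * w x.
have f2 : L2 Omega f by exact: L2_smooth_mul.
have fgf : is_weak_partial Omega i f gf by exact: weak_partialM.
have gf2 : L2 Omega gf := fgf.1.
have [k2 k20 supp] := test_in_level tphi.
pose k := k2 / 2.
have k0 : 0 < k by rewrite /k; lra.
have mk := measurable_sublevel k.
have kO := @sublevel_Omega k (ltW k0).
have fsupp x : f x != 0 -> rho x <= - k2.
  rewrite mulf_eq0 negb_or => /andP[px _]; apply: supp; exact: subset_closure.
have gfsupp x : gf x != 0 -> rho x <= - k2.
  move=> gfx; apply: supp; apply: contrapT => nx; move: gfx; rewrite /gf.
  have -> : phi x = 0 by apply: contrapT => /eqP px; apply: nx; exact: subset_closure.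
  have -> : partial i phi x = 0.
    by apply: contrapT => /eqP px; apply: nx; exact: partial_support tphi px.
  by rewrite !mul0r addr0 eqxx.
have inK (h g : 'rV[R]_n -> R) : (forall x, h x != 0 -> rho x <= - k2) -> ip Omega h g = ip (sublevel k) h g.
  move=> hs; apply: Rintegral_support => // x _ kx.
  have [->|/hs hx] := eqVneq (h x) 0; first by rewrite mul0r.
  by exfalso; apply: kx; rewrite /sublevel/= /k; lra.
have f2k : L2 (sublevel k) f by exact: (L2_subset mO).
have v2k : L2 (sublevel k) v by exact: (L2_subset mO).
have c1 := difference_quotient_weak_cvg v2 vgv k0 f2k.
have c2 := difference_quotient_weak_cvg f2 fgf k0 v2k.
have [s s0 sh] : exists2 s, 0 < s &
    forall x y, rho x <= - k2 -> `|y| < s -> rho (x + y) < - k.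
  by apply: level_translate; rewrite /k; lra.
have [s' s'0 sh'] : exists2 s, 0 < s &
    forall x y, rho x <= - k -> `|y| < s -> rho (x + y) < - (k / 2).
  by apply: level_translate; lra.
(* Moving a translation by [t] to the other factor turns it into one by [- t], so the second limit
   is needed along [- t]. *)
have c2' : (- t)^-1 * ip (sublevel k) (fun x => f (x + (- t) *: e_ i) - f x) v @[t --> 0^'] -->
  ip (sublevel k) gf v.
  by apply: (cvg_comp (fun t : R => - t) _ _ c2) => P; exact: dnbhs0_opp.
suff E : \forall t \near (0 : R)^', - (t^-1 * ip (sublevel k) (fun x => v (x + t *: e_ i) - v x) f) =
    (- t)^-1 * ip (sublevel k) (fun x => f (x + (- t) *: e_ i) - f x) v.
  pose F t : R := - (t^-1 * ip (sublevel k) (fun x => v (x + t *: e_ i) - v x) f).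
  have c3 : F t @[t --> 0^'] --> - ip (sublevel k) gv f by apply: cvgN.
  have c3' : F t @[t --> 0^'] --> ip (sublevel k) gf v.
    by apply: cvg_trans c2'; apply: near_eq_cvg; apply: filterS E => t Et; rewrite /F Et.
  have : - ip (sublevel k) gv f = ip (sublevel k) gf v.
    by rewrite -(cvg_lim (@norm_hausdorff _ R) c3) -(cvg_lim (@norm_hausdorff _ R) c3').
  by rewrite (inK f gv fsupp) (inK gf v gfsupp) (ipC _ f gv) => <-; rewrite subrr.
near=> t.
have ts : `|t| < s by near: t; exact: dnbhs0_lt.
have ts' : `|t| < s' by near: t; exact: dnbhs0_lt.
rewrite invrN mulNr; congr (- (_ * _)).
have vt2 : L2 (sublevel k) (fun x => v (x + t *: e_ i)).
  have := L2D mk (L2_difference i v2 k0 sh' ts') v2k.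
  by under eq_fun do rewrite subrK.
have nts' : `|- t| < s' by rewrite normrN.
have ft2 : L2 (sublevel k) (fun x => f (x + (- t) *: e_ i)).
  have := L2D mk (L2_difference i f2 k0 sh' nts') f2k.
  by under eq_fun do rewrite subrK.
rewrite !ipBl// (ipC _ v f); congr (_ - _).
have mf : measurable_fun setT f.
  rewrite (_ : f = f \_ Omega).
    apply/(measurable_restrict _ mO measurableT).
    by rewrite setTI; exact: L2_measurable.
  apply/funext => x; rewrite /patch; case: ifPn => //.
  apply: contraNeq => /fsupp h; rewrite inE OE/=; lra.
rewrite -(ip_translate mk v2 mf (t := t)); last 2 first.
- by move=> x /fsupp; rewrite /sublevel/= /k; lra.
- move=> x kx; have := sh' x (t *: e_ i) (ltW kx) (le_lt_trans (delta_norm _ _) ts').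
  by rewrite OE/=; lra.
rewrite ipC; apply: Rintegral_support => // x _ kx.
have [->|/fsupp h] := eqVneq (f (x + (- t) *: e_ i)) 0; first by rewrite mul0r.
exfalso; apply: kx.
have := sh _ (t *: e_ i) h (le_lt_trans (delta_norm _ _) ts).
by rewrite scaleNr subrK.
Unshelve. all: end_near. Qed.

End domain.

(** * The Green identity *)

Section green.
Context {R : realType} {n : nat} (Omega : set 'rV[R]_n) (rho : 'rV[R]_n -> R).
Hypothesis drho : defining_function Omega rho.
Hypothesis bO : bounded_set Omega.

Local Notation mu := (@lebesgue_rV R n).

Let srho : smooth rho. Proof. by case: drho. Qed.
Let OE : Omega = [set x | rho x < 0]. Proof. by case: drho. Qed.
Let gradn0 x : rho x = 0 -> gradient rho x != 0. Proof. by case: drho => _ _; exact. Qed.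
Let mO : measurable Omega := measurable_Omega srho OE.
Let fO : (mu Omega < +oo)%E := finite_Omega srho OE bO.

(** Vanishes where -rho <= 1/(j+1) and tends to 1 inside. As a function of [rho] alone it has its
    gradient parallel to grad rho. *)
Definition cutoff (j : nat) (x : 'rV[R]_n) : R := gamma 0 (- rho x * j.+1%:R - 1).

Lemma test_cutoff j : test_function Omega (cutoff j).
Proof.
rewrite -(sublevel0 OE); apply: (test_of_level srho OE bO (lexx 0) (k' := j.+1%:R^-1)).
- by rewrite invr_gt0 ltr0n.
- apply: smooth_gamma.
  have := smoothD (smoothM (smoothZ (-1) srho) (smooth_cst j.+1%:R)) (smooth_cst (- 1)).
  by under eq_fun do rewrite /= mulN1r.
- move=> x; apply: contraNT; rewrite -ltNge => h.
  rewrite /cutoff gamma_le0// subr_le0 -ler_pdivlMr ?ltr0n//.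
  by move: h; rewrite mul1r; set a := _^-1; lra.
Qed.

Lemma cutoff_ge0 j x : 0 <= cutoff j x. Proof. exact: gamma_ge0. Qed.
Lemma cutoff_le1 j x : cutoff j x <= 1. Proof. exact: gamma0_le1. Qed.

Lemma cutoff_cvg x : Omega x -> cutoff j x @[j --> \oo] --> (1 : R).
Proof. by move=> Ox; apply: gamma0_cvg1; move: Ox; rewrite OE/= oppr_gt0. Qed.

(** Minus [rho] times the derivative of the cutoff with respect to [rho]. The cutoff itself has a
    gradient of order [j] near the boundary, but after multiplication by [rho] it is bounded
    independently of [j] and tends to 0 pointwise, as dominated convergence demands. *)
Definition cutoff_slope (j : nat) (x : 'rV[R]_n) : R :=
  rho x * (gamma 2 (- rho x * j.+1%:R - 1) * j.+1%:R).

Lemma partial_cutoff j i x : partial i (cutoff j) x =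
  - (gamma 2 (- rho x * j.+1%:R - 1) * j.+1%:R) * partial i rho x.
Proof.
have d : is_derive (rho x) (1 : R) (fun s : R => gamma 0 (- s * j.+1%:R - 1))
   (- (gamma 2 (- rho x * j.+1%:R - 1) * j.+1%:R)).
  have d1 : is_derive (rho x) (1 : R) (fun s : R => - s * j.+1%:R - 1) (- j.+1%:R).
    have h1 := is_deriveN (is_derive_id (rho x) (1 : R)).
    have h2 := is_deriveM h1 (is_derive_cst (j.+1%:R : R) (rho x) (1 : R)).
    have h3 := is_deriveD h2 (is_derive_cst (- 1 : R) (rho x) (1 : R)).
    apply: (DeriveDef _ _); first by case: h3.
    have [_ h] := h3; apply: (etrans h).
    by rewrite /GRing.scale/= mulr0 add0r addr0 mulrN1.
  have [d2 d3] := is_derive1_comp (f := gamma 0) (g := fun s : R => - s * j.+1%:R - 1) (is_derive_gamma 0 (- rho x * j.+1%:R - 1)) d1.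
  apply: DeriveDef; first exact: d2.
  by apply: (etrans d3); rewrite mul0r subr0 mulrN.
exact: (partial_comp _ srho d).
Qed.

(** With s = 1/t this reads s + s^2 <= 3 e^s, which follows from 1 + s <= e^s and 1 + s^2/2 <= e^s.
    For t = -rho (j+1) - 1 the left side is the absolute value of [cutoff_slope] on [Omega]. *)
Lemma gamma2_bound (t : R) : 0 < t -> (t + 1) * gamma 2 t <= 3.
Proof.
move=> t0; rewrite /gamma t0 expRN -exprVn; set s := t^-1.
have s0 : 0 < s by rewrite invr_gt0.
have ts : t * s = 1 by rewrite mulfV// gt_eqF.
have e0 := expR_gt0 s.
rewrite mulrA ler_pdivrMr//.
have := @expR_ge1Dxn R s 1 (ltW s0); have := expR_ge1Dx s.
have -> : (t + 1) * s ^+ 2 = s + s ^+ 2 by rewrite mulrDl expr2 mulrA ts !mul1r.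
rewrite (_ : 2`!%:R = 2 :> R)//; set E := expR s; nra.
Qed.

Lemma cutoff_slope_bound j x : Omega x -> `|cutoff_slope j x| <= 3.
Proof.
rewrite OE/= => rx; rewrite /cutoff_slope.
set t := _ - 1; have [t0|t0] := leP t 0.
  by rewrite gamma_le0// mul0r mulr0 normr0.
rewrite normrM ltr0_norm// ger0_norm; last by rewrite mulr_ge0// gamma_ge0.
have := gamma2_bound t0.
have -> : t + 1 = - rho x * j.+1%:R by rewrite /t subrK.
by rewrite mulrAC -mulrA.
Qed.

Lemma cutoff_slope_cvg x : Omega x -> cutoff_slope j x @[j --> \oo] --> (0 : R).
Proof.
rewrite OE/= => rx; apply/cvgr0Pnorm_lt => e e0.
near=> j.
set t := - rho x * j.+1%:R - 1.
(* Then t > 1 and e t > 2, hence t + 1 < 2 t < e t^2. *)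
have t2 : 2 / e + 1 < t.
  rewrite ltrBrDr -ltr_pdivrMl ?oppr_gt0//.
  apply: (@lt_trans _ _ j%:R); last by rewrite -natr1 ltrDl.
  near: j; exact: nbhs_infty_gtr.
have e2 : 0 < 2 / e by rewrite divr_gt0.
have t0 : 0 < t by lra.
rewrite /cutoff_slope -/t normrM ltr0_norm// ger0_norm; last by rewrite mulr_ge0// gamma_ge0.
have -> : - rho x * (gamma 2 t * j.+1%:R) = (t + 1) * gamma 2 t.
  by rewrite /t subrK -/t; ring.
rewrite /gamma t0.
have E1 : expR (- t^-1) <= 1 by rewrite expR_le1 oppr_le0 invr_ge0 ltW.
apply: (@le_lt_trans _ _ ((t + 1) * t ^- 2)).
  rewrite mulrA -[leRHS]mulr1 ler_wpM2l// mulr_ge0//; first lra.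
  by rewrite invr_ge0 sqr_ge0.
rewrite ltr_pdivrMr ?exprn_gt0//.
have : 2 < e * t by move: t2; rewrite -ltr_pdivrMl// mulrC; lra.
nra.
Unshelve. all: end_near. Qed.

Lemma cutoff_ip_cvg f g : L2 Omega f -> L2 Omega g ->
  ip Omega (fun x => cutoff j x * f x) g @[j --> \oo] --> ip Omega f g.
Proof.
move=> f2 g2.
have mc j D : measurable_fun D (cutoff j).
  by apply: continuous_measurable_rV; apply: smooth_continuous; case: (test_cutoff j).
have mf := L2_measurable f2; have mg := L2_measurable g2.
apply: (dominated_Rintegral (g := fun x => `|f x * g x|)) => //.
- by move=> j; apply: measurable_funM => //; exact: measurable_funM.
- exact: measurable_funM.
- move=> x Ox; rewrite -[f x in X in _ --> X]mul1r.
  apply: cvgM; last exact: cvg_cst.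
  by apply: cvgM; [exact: cutoff_cvg|exact: cvg_cst].
- exact: (integrable_norm (L2_integrableM mO f2 g2)).
- move=> j x _; rewrite -mulrA normrM ler_piMl// ger0_norm ?cutoff_ge0//.
  exact: cutoff_le1.
Qed.

Definition grad_weight (x : 'rV[R]_n) : R := \sum_i partial i rho x ^+ 2 + rho x ^+ 2.

Lemma grad_weight_gt0 x : 0 < grad_weight x.
Proof.
have s0 : 0 <= \sum_i partial i rho x ^+ 2 by apply: sumr_ge0 => i _; exact: sqr_ge0.
have [r0|r0] := eqVneq (rho x) 0; last first.
  by rewrite /grad_weight ltr_wpDl// lt0r sqrf_eq0 r0 sqr_ge0.
rewrite /grad_weight r0 expr0n addr0 lt0r s0 andbT.
apply: contra_neq (gradn0 r0) => /eqP.
rewrite psumr_eq0; last by move=> i _; exact: sqr_ge0.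
move=> /allP h; apply/rowP => i; rewrite !mxE.
by have := h i (mem_index_enum _); rewrite sqrf_eq0 => /eqP.
Qed.

Lemma smooth_grad_weight : smooth grad_weight.
Proof.
apply: smoothD; last by under eq_fun do rewrite expr2; exact: smoothM.
by apply: smooth_sum => i; under eq_fun do rewrite expr2; apply: smoothM; exact: smooth_partial.
Qed.

Definition normal_scale (x : 'rV[R]_n) : R := grad_weight x `^ (- 2^-1).

Lemma smooth_normal_scale : smooth normal_scale.
Proof. by apply: smooth_powR; [exact: smooth_grad_weight|exact: grad_weight_gt0]. Qed.

Lemma normal_scaleE x : normal_scale x = (Num.sqrt (grad_weight x))^-1.
Proof. by rewrite /normal_scale powRN powR12_sqrt// ltW// grad_weight_gt0. Qed.

Lemma normal_scale_sqr x : normal_scale x ^+ 2 * grad_weight x = 1.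
Proof.
rewrite normal_scaleE exprVn sqr_sqrtr ?mulVf ?gt_eqF ?ltW//; exact: grad_weight_gt0.
Qed.

(* A smooth extension of the outward unit normal; adding rho^2 under the square
   root makes it defined everywhere without changing it on the boundary. *)
Definition normal_field (i : 'I_n) (x : 'rV[R]_n) : R := partial i rho x * normal_scale x.

Lemma smooth_normal_field i : smooth (normal_field i).
Proof. by apply: smoothM; [exact: smooth_partial|exact: smooth_normal_scale]. Qed.

Lemma boundary_rho x : boundary Omega x -> rho x = 0.
Proof.
have oO : open Omega by rewrite -(sublevel0 OE); exact: open_sublevel.
move=> [cx]; rewrite (interior_id _).1// => nx.
apply: le_anti; apply/andP; split; last by rewrite leNgt; apply/negP => h; apply: nx; rewrite OE.
have cl : closed [set x | rho x <= 0].
  rewrite (_ : [set x | _] = rho @^-1` [set t | t <= 0])//.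
  by apply: closed_comp; [move=> y _; exact: smooth_continuous|exact: closed_le].
by apply: cl; apply: closureS cx => y; rewrite OE/=; exact: ltW.
Qed.

Lemma normal_field_normal x : boundary Omega x ->
  outward_unit_normal Omega x (\row_i normal_field i x).
Proof.
move=> /boundary_rho r0; exists rho => //; apply/rowP => i.
rewrite !mxE /normal_field mulrC normal_scaleE; congr (_^-1 * _).
rewrite /euclidean_norm /grad_weight r0 expr0n addr0; congr Num.sqrt.
by apply: eq_bigr => j _; rewrite mxE.
Qed.

Lemma weak_partialP i y : H1 Omega y -> is_weak_partial Omega i y (weak_partial Omega i y).
Proof. by move=> [_ /(_ i) [g yg]]; apply: (getPex (ex_intro _ g yg)). Qed.

Lemma L2_weak_partial i y : H1 Omega y -> L2 Omega (weak_partial Omega i y).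
Proof. by move=> /(weak_partialP i)[]. Qed.

Lemma L2_laplacian y : H2 Omega y -> L2 Omega (laplacian Omega y).
Proof. by move=> [_ h]; apply: L2_sum => // i; exact: L2_weak_partial. Qed.

Lemma Rintegral_bigsum (I : Type) (s : seq I) (f : I -> 'rV[R]_n -> R) D :
  measurable D -> (forall i, mu.-integrable D (EFin \o f i)) ->
  \int[mu]_(x in D) (\sum_(i <- s) f i x) = \sum_(i <- s) \int[mu]_(x in D) f i x.
Proof.
move=> mD fi.
suff [] : mu.-integrable D (EFin \o (fun x => \sum_(i <- s) f i x)) /\
    \int[mu]_(x in D) (\sum_(i <- s) f i x) = \sum_(i <- s) \int[mu]_(x in D) f i x by [].
elim: s => [|i s [IH1 IH2]].
  rewrite (_ : (fun x => _) = cst 0); last by apply/funext => x; rewrite big_nil.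
  by rewrite big_nil Rintegral_cst// mul0r; split=> //; exact: integrable0.
rewrite (_ : (fun x => _) = (fun x => f i x + \sum_(j <- s) f j x)); last first.
  by apply/funext => x; rewrite big_cons.
split; first exact: integrable_add.
by rewrite big_cons -IH2 -RintegralD.
Qed.

(** * Vanishing flux of a field with zero normal trace *)

Section flux.
Variables (phi : 'rV[R]_n -> R) (dphi : 'I_n -> 'rV[R]_n -> R).
Hypothesis phi2 : L2 Omega phi.
Hypothesis phid : forall i, is_weak_partial Omega i phi (dphi i).
Let dphi2 i : L2 Omega (dphi i) := (phid i).1.

Variables (nu : 'I_n -> 'rV[R]_n -> R).
Hypothesis sn : forall i, smooth (nu i).
Let Lsm (b f : 'rV[R]_n -> R) : smooth b -> L2 Omega f -> L2 Omega (fun x => b x * f x) :=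
  @L2_smooth_mul R n Omega rho srho OE bO b f.

Definition flux_coeff i x := nu i x * dphi i x + partial i (nu i) x * phi x.

Lemma flux_coeff2 i : L2 Omega (flux_coeff i).
Proof.
exact: (L2D mO (Lsm (sn i) (dphi2 i)) (Lsm (smooth_partial i (sn i)) phi2)).
Qed.

(** [flux_coeff i] is the weak derivative of [nu i * phi], so the sum is the integral of the
    divergence of G phi nu. For a test function [psi] instead of [G] it vanishes, by testing the
    weak derivative of [phi] against [psi * nu i]. The sum changes by at most [K] times the H^1
    distance between [G] and [psi], so the identity passes to the closure. *)
Lemma normal_flux_eq0 G : H10 Omega G ->
  \sum_i (ip Omega (fun x => nu i x * phi x) (weak_partial Omega i G) +
          ip Omega (flux_coeff i) G) = 0.
Proof.
move=> [G1 Gapp]; have G2 := G1.1.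
set J := \sum_i _.
pose K := \sum_i (Num.sqrt (L2sqnorm Omega (fun x => nu i x * phi x)) +
  Num.sqrt (L2sqnorm Omega (flux_coeff i))).
have K0 : 0 <= K by apply: sumr_ge0 => i _; rewrite addr_ge0 ?sqrtr_ge0.
suff key e : 0 < e -> `|J| <= K * e.
  apply/eqP; rewrite -normr_le0; apply/ler_addgt0Pl => e e0; rewrite addr0.
  have K1 : 0 < K + 1 by lra.
  have := key (e / (K + 1)) (divr_gt0 e0 K1).
  rewrite mulrA; move=> h; apply: (le_trans h).
  rewrite ler_pdivrMr//; nra.
move=> e0; have [psi tpsi psie] := Gapp _ (exprn_gt0 2 e0).
have spsi : smooth psi by case: tpsi.
have psi2 := test_function_L2 mO fO tpsi.
have dpsi2 i := test_function_L2 mO fO (test_function_partial i tpsi).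
have dG2 i := L2_weak_partial i G1.
have Jpsi : \sum_i (ip Omega (fun x => nu i x * phi x) (partial i psi) +
          ip Omega (flux_coeff i) psi) = 0.
  apply: big1 => i _.
  have := (phid i).2 _ (test_functionM tpsi (sn i)).
  under eq_Rintegral do rewrite (partialM _ _ spsi (sn i)).
  have a1 : L2 Omega (fun x => nu i x * phi x) := Lsm (sn i) phi2.
  have a2 : L2 Omega (fun x => partial i (nu i) x * phi x) :=
    Lsm (smooth_partial i (sn i)) phi2.
  have a3 : L2 Omega (fun x => nu i x * dphi i x) := Lsm (sn i) (dphi2 i).
  rewrite (ipDl mO a3 a2 psi2).
  have -> : \int[mu]_(x in Omega) (phi x * (psi x * partial i (nu i) x +
      nu i x * partial i psi x)) =
    ip Omega (fun x => partial i (nu i) x * phi x) psi +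
    ip Omega (fun x => nu i x * phi x) (partial i psi).
    rewrite /ip -RintegralD//; [|exact: L2_integrableM..].
    by apply: eq_Rintegral => x _; ring.
  have -> : \int[mu]_(x in Omega) (dphi i x * (psi x * nu i x)) =
    ip Omega (fun x => nu i x * dphi i x) psi.
    by apply: eq_Rintegral => x _; ring.
  by lra.
rewrite -[J]subr0 -Jpsi /J -sumrB mulr_suml.
apply: le_trans (ler_norm_sum _ _ _) _; apply: ler_sum => i _.
have a1 : L2 Omega (fun x => nu i x * phi x) := Lsm (sn i) phi2.
rewrite opprD addrACA -!ipBr//.
have small f : L2sqnorm Omega f <= e ^+ 2 -> Num.sqrt (L2sqnorm Omega f) <= e.
  by move=> /ler_wsqrtr; rewrite sqrtr_sqr ger0_norm// ltW.
have n0 j : 0 <= L2sqnorm Omega (weak_partial Omega j G \- partial j psi) := L2sqnorm_ge0 _ _.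
have s0 := L2sqnorm_ge0 Omega (G \- psi).
have s1 : 0 <= \sum_(j | j != i) L2sqnorm Omega (weak_partial Omega j G \- partial j psi).
  by apply: sumr_ge0 => j _; exact: n0.
rewrite (bigD1 i)//= in psie; have n0i := n0 i.
have b1 := small (G \- psi) ltac:(lra).
have b2 := small (weak_partial Omega i G \- partial i psi) ltac:(lra).
rewrite mulrDl; apply: le_trans (ler_normD _ _) _; apply: lerD.
- apply: le_trans (ip_le mO a1 (L2B mO (dG2 i) (dpsi2 i))) _.
  exact: (ler_wpM2l (sqrtr_ge0 _) b2).
- apply: le_trans (ip_le mO (flux_coeff2 i) (L2B mO G2 psi2)) _.
  exact: (ler_wpM2l (sqrtr_ge0 _) b1).
exact: flux_coeff2.
Qed.

End flux.

Lemma cvg_finite_sum (I : Type) (s : seq I) (u : I -> nat -> R) (l : I -> R) :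
  (forall i, u i j @[j --> \oo] --> l i) ->
  \sum_(i <- s) u i j @[j --> \oo] --> \sum_(i <- s) l i.
Proof.
move=> ul; elim: s => [|i s IH].
  by rewrite big_nil; under eq_fun do rewrite big_nil; exact: cvg_cst.
by rewrite big_cons; under eq_fun do rewrite big_cons; apply: cvgD.
Qed.

Section green_identity.
Variables (phi : 'rV[R]_n -> R) (dphi : 'I_n -> 'rV[R]_n -> R).
Hypothesis phi2 : L2 Omega phi.
Hypothesis phid : forall i, is_weak_partial Omega i phi (dphi i).
Let dphi2 i : L2 Omega (dphi i) := (phid i).1.

Let sn := smooth_normal_field.
Let Lsm (b f : 'rV[R]_n -> R) : smooth b -> L2 Omega f -> L2 Omega (fun x => b x * f x) :=
  @L2_smooth_mul R n Omega rho srho OE bO b f.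
Local Notation flux_coeff := (flux_coeff phi dphi normal_field).

(** The vanishing flux of G phi nu, with G = nu . grad y, is subtracted from the left side; this
    replaces grad y by grad y - G nu, whose normal component vanishes on the boundary. With a cutoff
    inserted, integration by parts leaves only the gradient of the cutoff against that field, and
    this term tends to 0. *)
Lemma green y : H2 Omega y -> neumann Omega y ->
  ip Omega phi (laplacian Omega y) + \sum_i ip Omega (dphi i) (weak_partial Omega i y) = 0.
Proof.
move=> [y1 y2] neu.
pose F i := weak_partial Omega i y.
pose dF i := weak_partial Omega i (F i).
pose G x := \sum_i normal_field i x * F i x.
have G10 : H10 Omega G := neu normal_field sn normal_field_normal.
have [G1 _] := G10; have G2 := G1.1.
pose dG i := weak_partial Omega i G.
have F2 i : L2 Omega (F i) := L2_weak_partial i y1.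
have dF2 i : L2 Omega (dF i) := L2_weak_partial i (y2 i).
have dG2 i : L2 Omega (dG i) := L2_weak_partial i G1.
have nphi2 i : L2 Omega (fun x => normal_field i x * phi x) := Lsm (sn i) phi2.
have fc2 i : L2 Omega (flux_coeff i) := flux_coeff2 phi2 phid sn i.
have flux := normal_flux_eq0 phi2 phid sn G10.
(* The cut-off version of div (phi (grad y - G nu)). It is evaluated in two ways: it tends to [L],
   the left side of the identity, and by [SE] it tends to 0. *)
pose S j := \sum_i (ip Omega (fun x => cutoff j x * phi x) (dF i) +
  ip Omega (fun x => cutoff j x * dphi i x) (F i) -
  (ip Omega (fun x => cutoff j x * (normal_field i x * phi x)) (dG i) +
  ip Omega (fun x => cutoff j x * flux_coeff i x) G)).
pose L := \sum_i (ip Omega phi (dF i) + ip Omega (dphi i) (F i) -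
  (ip Omega (fun x => normal_field i x * phi x) (dG i) + ip Omega (flux_coeff i) G)).
have LE : L = ip Omega phi (laplacian Omega y) + \sum_i ip Omega (dphi i) (F i).
  rewrite /L sumrB flux subr0 big_split/=; congr (_ + _).
  rewrite ipC; apply: (etrans _ (esym (ip_suml (index_enum _) mO dF2 phi2))).
  by apply: eq_bigr => i _; exact: ipC.
rewrite -LE.
have SL : S j @[j --> \oo] --> L.
  apply: cvg_finite_sum => i; apply: cvgB.
    by apply: cvgD; [exact: (cutoff_ip_cvg phi2 (dF2 i))|exact: (cutoff_ip_cvg (dphi2 i) (F2 i))].
  by apply: cvgD; [exact: (cutoff_ip_cvg (nphi2 i) (dG2 i))|exact: (cutoff_ip_cvg (fc2 i) G2)].
suff S0 : S j @[j --> \oo] --> (0 : R).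
  by rewrite -(cvg_lim (@norm_hausdorff _ R) SL) (cvg_lim (@norm_hausdorff _ R) S0).
have SE j : S j = \int[mu]_(x in Omega) (cutoff_slope j x * (rho x * normal_scale x * (phi x * G x))).
  have sc : smooth (cutoff j) by case: (test_cutoff j).
  have c1 i := weak_integration_by_parts srho OE bO (test_cutoff j) phi2 (F2 i) (phid i)
    (weak_partialP i (y2 i)).
  have c2 i := weak_integration_by_parts srho OE bO (test_functionM (test_cutoff j) (sn i)) phi2 G2
    (phid i) (weak_partialP i G1).
  have a1 i : L2 Omega (fun x => cutoff j x * dphi i x) := Lsm sc (dphi2 i).
  have a2 i : L2 Omega (fun x => partial i (cutoff j) x * phi x) :=
    Lsm (smooth_partial i sc) phi2.
  have a3 i : L2 Omega (fun x => cutoff j x * flux_coeff i x) := Lsm sc (fc2 i).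
  have a4 i : L2 Omega (fun x => partial i (cutoff j) x * (normal_field i x * phi x)) :=
    Lsm (smooth_partial i sc) (nphi2 i).
  have e1 i : ip Omega (fun x => cutoff j x * phi x) (dF i) +
      ip Omega (fun x => cutoff j x * dphi i x) (F i) =
      - ip Omega (fun x => partial i (cutoff j) x * phi x) (F i).
    have := c1 i; rewrite (ipDl mO (a1 i) (a2 i) (F2 i)).
    by set u1 := ip _ _ _; set u2 := ip _ _ _; set u3 := ip _ _ _; lra.
  have e2 i : ip Omega (fun x => cutoff j x * (normal_field i x * phi x)) (dG i) +
      ip Omega (fun x => cutoff j x * flux_coeff i x) G =
      - ip Omega (fun x => partial i (cutoff j) x * (normal_field i x * phi x)) G.
    have := c2 i.
    rewrite (_ : (fun x => cutoff j x * normal_field i x * dphi i x + _) =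
      (fun x => cutoff j x * flux_coeff i x + partial i (cutoff j) x * (normal_field i x * phi x))).
      rewrite (ipDl mO (a3 i) (a4 i) G2).
      have -> : (fun x => cutoff j x * normal_field i x * phi x) =
        (fun x => cutoff j x * (normal_field i x * phi x)) by apply/funext => x; rewrite mulrA.
      by set u1 := ip _ _ _; set u2 := ip _ _ _; set u3 := ip _ _ _; lra.
    apply/funext => x; rewrite (partialM _ _ sc (sn i)) /flux_coeff.
    by set p1 := partial _ _ _; set p2 := partial _ _ _; ring.
  have -> : S j = \sum_i (- ip Omega (fun x => partial i (cutoff j) x * phi x) (F i) +
      ip Omega (fun x => partial i (cutoff j) x * (normal_field i x * phi x)) G).
    have sub (a b c d : R) : a = - c -> b = - d -> a - b = - c + d.
      by move=> -> ->; rewrite opprK.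
    by apply: eq_bigr => i _; exact: (sub _ _ _ _ (e1 i) (e2 i)).
  have -> : \sum_i (- ip Omega (fun x => partial i (cutoff j) x * phi x) (F i) +
      ip Omega (fun x => partial i (cutoff j) x * (normal_field i x * phi x)) G) =
    \sum_i \int[mu]_(x in Omega) (partial i (cutoff j) x * phi x * (normal_field i x * G x - F i x)).
    apply: eq_bigr => i _; rewrite addrC /ip -RintegralB//; [|exact: L2_integrableM..].
    by apply: eq_Rintegral => x _; ring.
  have ii i : mu.-integrable Omega (EFin \o (fun x =>
      partial i (cutoff j) x * phi x * (normal_field i x * G x - F i x))).
    apply: L2_integrableM => //; apply: (L2B mO) => //; exact: (Lsm (sn i) G2).
  rewrite -(Rintegral_bigsum (index_enum _) mO ii); apply: eq_Rintegral => x _.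
  set c := gamma 2 (- rho x * j.+1%:R - 1) * j.+1%:R.
  pose A := \sum_i partial i rho x * F i x.
  (* Since the gradient of the cutoff is [- c] times grad rho, tangential components drop out; [A]
     is grad rho . grad y. *)
  transitivity (- c * phi x * (normal_scale x * G x * (\sum_i partial i rho x ^+ 2) - A)).
    rewrite mulr_sumr /A -sumrB mulr_sumr; apply: eq_bigr => i _.
    rewrite partial_cutoff -/c /normal_field.
    by set p1 := partial _ _ _; ring.
  have -> : G x = normal_scale x * A.
    by rewrite /G /A mulr_sumr; apply: eq_bigr => i _; rewrite /normal_field mulrAC mulrC.
  have -> : \sum_i partial i rho x ^+ 2 = grad_weight x - rho x ^+ 2.
    by rewrite /grad_weight addrK.
  (* The normalization cancels [A] against itself. The remainder comes from the rho^2 inside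
     [grad_weight]: one factor [rho] turns [c] into [cutoff_slope], the other stays in the
     integrand. *)
  have w1 := normal_scale_sqr x.
  rewrite /cutoff_slope -/c; set m := normal_scale x in w1 *; set W := grad_weight x in w1 *.
  have -> : m * (m * A) * (W - rho x ^+ 2) = (m ^+ 2 * W) * A - m ^+ 2 * rho x ^+ 2 * A by ring.
  by rewrite w1; ring.
have -> : S = (fun j => \int[mu]_(x in Omega)
    (cutoff_slope j x * (rho x * normal_scale x * (phi x * G x)))) by apply/funext => j; exact: SE.
rewrite (_ : 0 = \int[mu]_(x in Omega) (0 : R)); last by rewrite Rintegral_cst// mul0r.
have b2 : L2 Omega (fun x => rho x * normal_scale x * phi x).
  exact: (Lsm (smoothM srho smooth_normal_scale) phi2).
have bi := L2_integrableM mO b2 G2.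
have mslope j : measurable_fun Omega (cutoff_slope j).
  apply: continuous_measurable_rV; apply: smooth_continuous; apply: smoothM => //.
  apply: smoothM; last exact: smooth_cst.
  apply: smooth_gamma.
  have := smoothD (smoothM (smoothZ (-1) srho) (smooth_cst j.+1%:R)) (smooth_cst (- 1)).
  by under eq_fun do rewrite /= mulN1r.
have mb : measurable_fun Omega (fun x => rho x * normal_scale x * (phi x * G x)).
  have /integrableP[/measurable_EFinP + _] := bi.
  by under eq_fun do rewrite -mulrA.
apply: (dominated_Rintegral (g := fun x => 3 * `|rho x * normal_scale x * phi x * G x|)) => //.
- by move=> j; apply: measurable_funM.
- move=> x Ox; rewrite -[X in _ --> X](mul0r (rho x * normal_scale x * (phi x * G x))).
  by apply: cvgM; [exact: cutoff_slope_cvg|exact: cvg_cst].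
- exact: (integrableZl mO 3 (integrable_norm bi)).
- by move=> j x Ox; rewrite normrM -[in leRHS]mulrA ler_wpM2r// cutoff_slope_bound.
Qed.

End green_identity.

End green.

(** * The Poincare inequality *)

Section poincare.
Context {R : realType} {n : nat} (Omega : set 'rV[R]_n) (rho : 'rV[R]_n -> R).
Hypothesis drho : defining_function Omega rho.
Hypothesis bO : bounded_set Omega.
Hypothesis cO : connected Omega.
Hypothesis O0 : Omega !=set0.

Local Notation mu := (@lebesgue_rV R n).

Let srho : smooth rho. Proof. by case: drho. Qed.
Let OE : Omega = [set x | rho x < 0]. Proof. by case: drho. Qed.
Let mO : measurable Omega := measurable_Omega srho OE.
Let fO : (mu Omega < +oo)%E := finite_Omega srho OE bO.
Let oO : open Omega. Proof. by rewrite -(sublevel0 OE); exact: open_sublevel. Qed.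

(** A coefficient of size O(rho) kills the boundary term, so no condition on [w] or [v] at the
    boundary is needed: the error [T] produced by the cutoff is bounded by [cutoff_slope] times an
    integrable function. *)
Lemma integration_by_parts_vanishing (b w v gw gv : 'rV[R]_n -> R) (i : 'I_n) (K : R) :
  smooth b -> (forall x, Omega x -> `|b x| <= K * `|rho x|) ->
  L2 Omega w -> L2 Omega v ->
  is_weak_partial Omega i w gw -> is_weak_partial Omega i v gv ->
  ip Omega (fun x => b x * w x) gv +
  (ip Omega (fun x => b x * gw x) v + ip Omega (fun x => partial i b x * w x) v) = 0.
Proof.
move=> sb bK w2 v2 wgw vgv.
have Lsm (c f : 'rV[R]_n -> R) : smooth c -> L2 Omega f -> L2 Omega (fun x => c x * f x) :=
  @L2_smooth_mul R n Omega rho srho OE bO c f.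
have a1 := Lsm _ _ sb w2; have a2 := Lsm _ _ sb wgw.1.
have a3 := Lsm _ _ (smooth_partial i sb) w2.
have tc := test_cutoff drho bO.
have sc j : smooth (cutoff rho j) by case: (tc j).
have c1 := cutoff_ip_cvg drho bO a1 vgv.1.
have c2 := cutoff_ip_cvg drho bO a2 v2.
have c3 := cutoff_ip_cvg drho bO a3 v2.
pose T j x := partial i (cutoff rho j) x * b x * w x * v x.
have c4 : \int[mu]_(x in Omega) T j x @[j --> \oo] --> (0 : R).
  rewrite (_ : 0 = \int[mu]_(x in Omega) (0 : R)); last by rewrite Rintegral_cst// mul0r.
  have mc f : smooth f -> measurable_fun Omega f.
    by move=> sf; apply: continuous_measurable_rV; exact: smooth_continuous.
  have [M Mb] := continuous_bounded_on_domain bO (smooth_continuous (smooth_partial i srho)).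
  have eT j x : T j x = - (gamma 2 (- rho x * j.+1%:R - 1) * j.+1%:R) * partial i rho x * b x * w x * v x.
    by rewrite /T (partial_cutoff drho).
  have bT j x : Omega x -> `|T j x| <= `|cutoff_slope rho j x| * (`|K| * `|M|) * `|w x * v x|.
    move=> Ox; rewrite eT -[_ * w x * v x]mulrA normrM ler_wpM2r//.
    rewrite /cutoff_slope; move: (gamma 2 _ * _) => q.
    rewrite !normrM normrN; set c := `|q|.
    have h1 := bK x Ox; have h2 : `|partial i rho x| <= `|M|.
      by apply: le_trans (ler_norm _); exact: Mb.
    have h3 : `|b x| <= `|K| * `|rho x|.
      by apply: le_trans h1 _; apply: ler_wpM2r => //; exact: ler_norm.
    have -> : `|rho x| * c * (`|K| * `|M|) = c * `|M| * (`|K| * `|rho x|) by ring.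
    by rewrite /c; apply: ler_pM => //; rewrite ?mulr_ge0// ler_wpM2l.
  apply: (dominated_Rintegral (g := fun x => 3 * (`|K| * `|M|) * `|w x * v x|)) => //.
  - move=> j; apply: measurable_funM; last exact: L2_measurable v2.
    apply: measurable_funM; last exact: L2_measurable w2.
    exact: mc (smoothM (smooth_partial i (sc j)) sb).
  - move=> x Ox; apply/cvgr0Pnorm_lt => e e0.
    have [e1 e10 e1b] : exists2 e1, 0 < e1 & e1 * (`|K| * `|M|) * `|w x * v x| < e.
      exists (e / ((`|K| * `|M|) * `|w x * v x| + 1)).
        by rewrite divr_gt0// ltr_wpDl// !mulr_ge0.
      have p0 : 0 <= `|K| * `|M| * `|w x * v x| by rewrite !mulr_ge0.
      have p1 : 0 < `|K| * `|M| * `|w x * v x| + 1 by rewrite ltr_wpDl.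
      rewrite -mulrA mulrAC ltr_pdivrMr// ltr_pM2l//; lra.
    have := cutoff_slope_cvg drho Ox; move/cvgr0Pnorm_lt => /(_ _ e10).
    apply: filterS => j hj; apply: le_lt_trans (bT j x Ox) _; apply: le_lt_trans e1b.
    by rewrite -!mulrA; apply: ler_wpM2r; rewrite ?mulr_ge0// ltW.
  - exact: (integrableZl mO (3 * (`|K| * `|M|)) (integrable_norm (L2_integrableM mO w2 v2))).
  - move=> j x Ox; apply: le_trans (bT j x Ox) _.
    by rewrite -!mulrA ler_wpM2r ?mulr_ge0// (cutoff_slope_bound drho).
have E j : ip Omega (fun x => cutoff rho j x * (b x * w x)) gv +
  (ip Omega (fun x => cutoff rho j x * (b x * gw x)) v +
   ip Omega (fun x => cutoff rho j x * (partial i b x * w x)) v) = - \int[mu]_(x in Omega) T j x.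
  have := weak_integration_by_parts srho OE bO (test_functionM (tc j) sb) w2 v2 wgw vgv.
  have b1 := Lsm _ _ (sc j) a2; have b2 := Lsm _ _ (sc j) a3.
  have b3 : L2 Omega (fun x => partial i (cutoff rho j) x * b x * w x).
    exact: (Lsm _ _ (smoothM (smooth_partial i (sc j)) sb) w2).
  rewrite (_ : (fun x => cutoff rho j x * b x * gw x + _) =
    (fun x => (cutoff rho j x * (b x * gw x) + cutoff rho j x * (partial i b x * w x)) +
      partial i (cutoff rho j) x * b x * w x)); last first.
    apply/funext => x; rewrite (partialM _ _ (sc j) sb).
    by set p1 := partial _ _ _; set p2 := partial _ _ _; ring.
  rewrite (ipDl mO (L2D mO b1 b2) b3 v2) (ipDl mO b1 b2 v2).
  have -> : (fun x => cutoff rho j x * b x * w x) = (fun x => cutoff rho j x * (b x * w x)).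
    by apply/funext => x; rewrite mulrA.
  rewrite -/(ip Omega (fun x => partial i (cutoff rho j) x * b x * w x) v).
  set u1 := ip _ _ gv; set u2 := ip _ _ v; set u3 := ip _ _ v; set u4 := ip _ _ v; lra.
have c5 : (- \int[mu]_(x in Omega) T j x) @[j --> \oo] -->
    ip Omega (fun x => b x * w x) gv +
    (ip Omega (fun x => b x * gw x) v + ip Omega (fun x => partial i b x * w x) v).
  by under eq_fun do rewrite -E; exact: (cvgD c1 (cvgD c2 c3)).
have c6 : (- \int[mu]_(x in Omega) T j x) @[j --> \oo] --> (0 : R).
  by rewrite -[0 in X in _ --> X]oppr0; exact: (cvgN c4).
exact: (cvg_unique (@norm_hausdorff _ R) c5 c6).
Qed.

Definition strip (e : R) : set 'rV[R]_n := [set x | - e < rho x < 0].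

Lemma measurable_strip e : measurable (strip e).
Proof.
have -> : strip e = Omega `&` rho @^-1` [set t | - e < t].
  by rewrite /strip OE; apply/seteqP; split=> x /=; [move=> /andP[? ?]|move=> [? ?]; apply/andP].
apply: open_measurable_rV; apply: openI => //.
by apply: open_comp; [move=> x _; exact: smooth_continuous|exact: open_gt].
Qed.

Lemma strip_Omega e : strip e `<=` Omega.
Proof. by rewrite OE => x /= /andP[]. Qed.

(* Integrate by parts against the inward field eps (e^(rho/eps) - 1) grad rho,
   which is of size eps but has divergence of order one near the boundary. *)
Lemma strip_estimate : exists C e0 : R, [/\ 0 < C, 0 < e0 &
  forall e : R, 0 < e < e0 -> forall (w : 'rV[R]_n -> R) (g : 'I_n -> 'rV[R]_n -> R),
    L2 Omega w -> (forall i, is_weak_partial Omega i w (g i)) ->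
    L2sqnorm (strip e) w <= C * e * (L2sqnorm Omega w + \sum_i L2sqnorm Omega (g i))].
Proof.
have Lsm (c f : 'rV[R]_n -> R) : smooth c -> L2 Omega f -> L2 Omega (fun x => c x * f x) :=
  @L2_smooth_mul R n Omega rho srho OE bO c f.
have cO' : compact (closure Omega).
  apply: bounded_closed_compact; last exact: closed_closure.
  exact: bounded_closure.
have cO0 : closure Omega !=set0 by case: O0 => x Ox; exists x; exact: subset_closure.
have [xm _ xmin] := compact_EVT_min cO0 cO'
  (continuous_subspaceT (smooth_continuous (smooth_grad_weight drho))).
set m := grad_weight rho xm in xmin.
have m0 : 0 < m := grad_weight_gt0 drho xm.
(* In the strip |rho| < e, so rho^2 < e^2 < m / 2, which leaves at least m / 2 for |grad rho|^2 out
   of [grad_weight >= m]. *)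
pose e0 := Num.min 1 (m / 2).
have e00 : 0 < e0 by rewrite /e0 lt_min ltr01 divr_gt0.
pose D1 i := partial i rho.
pose D2 i := partial i (partial i rho).
have bd f : smooth f -> exists2 M : R, 0 <= M & forall x, Omega x -> `|f x| <= M.
  move=> sf; have [M Mb] := continuous_bounded_on_domain bO (smooth_continuous sf).
  by exists `|M| => // x Ox; apply: le_trans (ler_norm _); exact: Mb.
have /choice[M1 M1b] : forall i, exists M : R, 0 <= M /\ forall x, Omega x -> `|D1 i x| <= M.
  by move=> i; have [M M0 Mb] := bd _ (smooth_partial i srho); exists M.
have /choice[M2 M2b] : forall i, exists M : R, 0 <= M /\ forall x, Omega x -> `|D2 i x| <= M.
  by move=> i; have [M M0 Mb] := bd _ (smooth_partial i (smooth_partial i srho)); exists M.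
pose S : R := \sum_i (M1 i + M2 i).
have S0 : 0 <= S by apply: sumr_ge0 => i _; rewrite addr_ge0 ?(M1b i).1 ?(M2b i).1.
have E1 := @expR_gt0 R (- 1).
(* In the strip e^(rho/e) >= e^(-1) and |grad rho|^2 >= m / 2, while the sum of the weighted
   integrals is at most e S times the H^1 energy. [S + 1] keeps the constant positive. *)
exists (2 * (S + 1) / (m * expR (-1))), e0; split=> //.
  by rewrite divr_gt0 ?mulr_gt0//; lra.
move=> e /andP[e_gt0 ee0] w g w2 wg.
have e1 : e < 1 by apply: lt_le_trans ee0 _; rewrite /e0 ge_min lexx.
have em : e < m / 2 by apply: lt_le_trans ee0 _; rewrite /e0 ge_min lexx orbT.
pose zeta x : R := e * (expR (rho x * e^-1) - 1).
have szeta : smooth zeta.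
  apply: smoothZ; apply: (smoothD (smooth_expRc (smoothM srho (smooth_cst e^-1))) (smooth_cst (-1))).
have zE x : Omega x -> [/\ `|zeta x| <= `|rho x| & `|zeta x| <= e].
  rewrite OE/= => rx; have x1 : expR (rho x * e^-1) <= 1.
    by rewrite expR_le1 mulr_le0_ge0// ?invr_ge0 ltW.
  have x2 := expR_ge1Dx (rho x * e^-1); have x3 := expR_ge0 (rho x * e^-1).
  have zn : `|zeta x| = e * (1 - expR (rho x * e^-1)).
    by rewrite /zeta normrM gtr0_norm// ler0_norm ?opprB// subr_le0.
  rewrite zn (ltr0_norm rx); split; last by rewrite -[leRHS]mulr1 ler_pM2l//; lra.
  have -> : - rho x = e * (- (rho x * e^-1)) by field; rewrite gt_eqF.
  by rewrite ler_pM2l//; lra.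
have dz i x : partial i zeta x = expR (rho x * e^-1) * D1 i x.
  have d1 : is_derive (rho x) (1 : R) (fun s : R => s * e^-1) e^-1.
    have [h1 h2] := is_deriveM (is_derive_id (rho x) (1 : R)) (is_derive_cst (e^-1 : R) (rho x) (1 : R)).
    by apply: DeriveDef; [exact: h1|apply: (etrans h2); rewrite /GRing.scale/= mulr0 add0r mulr1].
  have [d2 d3] := is_derive1_comp (f := expR) (g := fun s : R => s * e^-1) (is_derive_expR _) d1.
  have d4 : is_derive (rho x) (1 : R) (fun s : R => expR (s * e^-1)) (expR (rho x * e^-1) * e^-1).
    by apply: DeriveDef; [exact: d2|exact: d3].
  have [d5 d6] := is_deriveB d4 (is_derive_cst (1 : R) (rho x) (1 : R)).
  have d7 : is_derive (rho x) (1 : R) (fun s : R => expR (s * e^-1) - 1) (expR (rho x * e^-1) * e^-1).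
    by apply: DeriveDef; [exact: d5|apply: (etrans d6); rewrite subr0].
  have [d8 d9] := is_deriveZ e d7.
  have d10 : is_derive (rho x) (1 : R) (fun s : R => e * (expR (s * e^-1) - 1)) (expR (rho x * e^-1)).
    apply: DeriveDef; [exact: d8|apply: (etrans d9)].
    by rewrite /GRing.scale/= mulrCA mulfV ?mulr1// gt_eqF.
  exact: (partial_comp i srho d10).
pose b i x := zeta x * D1 i x.
have sb i : smooth (b i) := smoothM szeta (smooth_partial i srho).
have bb i x : Omega x -> `|b i x| <= M1 i * `|rho x|.
  by move=> Ox; rewrite /b normrM mulrC; apply: ler_pM => //; [exact: (M1b i).2|case: (zE x Ox)].
have I i := integration_by_parts_vanishing (sb i) (bb i) w2 w2 (wg i) (wg i).
have g2 i : L2 Omega (g i) := (wg i).1.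
have db i x : partial i (b i) x = expR (rho x * e^-1) * D1 i x ^+ 2 + zeta x * D2 i x.
  rewrite /b (partialM _ _ szeta (smooth_partial i srho)) dz -/(D1 i) -/(D2 i).
  by rewrite addrC; congr (_ + _); ring.
set W := L2sqnorm Omega w; set G := \sum_i _.
have W0 : 0 <= W := L2sqnorm_ge0 _ _.
have G0 : 0 <= G by apply: sumr_ge0 => i _; exact: L2sqnorm_ge0.
have gG i : L2sqnorm Omega (g i) <= G.
  by rewrite /G (bigD1 i)//= lerDl; apply: sumr_ge0 => j _; exact: L2sqnorm_ge0.
have swg : Num.sqrt W * Num.sqrt G <= (W + G) / 2.
  have := sqr_ge0 (Num.sqrt W - Num.sqrt G).
  rewrite sqrrB !sqr_sqrtr//; set p := Num.sqrt W * _; lra.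
have sE : smooth (fun x => expR (rho x * e^-1)).
  exact: (smooth_expRc (smoothM srho (smooth_cst e^-1))).
pose P i x := expR (rho x * e^-1) * D1 i x ^+ 2.
have sP i : smooth (P i).
  exact: (smoothM sE (smoothM (smooth_partial i srho) (smooth_partial i srho))).
(* With v = w the term with [g i] occurs twice, whence 2 * (W + G) / 2 for the part with [M1]. The
   derivative of the field is [P i], of order one, plus [zeta * D2 i], of size [e]. *)
have PB i : ip Omega (fun x => P i x * w x) w <= e * (M1 i + M2 i) * (W + G).
  have a1 : L2 Omega (fun x => P i x * w x) := Lsm _ _ (sP i) w2.
  have a2 : L2 Omega (fun x => zeta x * D2 i x * w x).
    exact: (Lsm _ _ (smoothM szeta (smooth_partial i (smooth_partial i srho))) w2).
  have := I i.
  rewrite (_ : (fun x => partial i (b i) x * w x) = (fun x => P i x * w x + zeta x * D2 i x * w x)); last first.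
    by apply/funext => x; rewrite db mulrDl.
  rewrite (ipDl mO a1 a2 w2).
  have b1 : `|ip Omega (fun x => b i x * w x) (g i)| <= e * M1 i * ((W + G) / 2).
    apply: le_trans (ip_le mO (Lsm _ _ (sb i) w2) (g2 i)) _.
    apply: (@le_trans _ _ (e * M1 i * (Num.sqrt W * Num.sqrt G))).
      rewrite mulrA; apply: ler_pM; rewrite ?sqrtr_ge0//; last by rewrite ler_wsqrtr// gG.
      have eM : 0 <= e * M1 i by rewrite mulr_ge0 ?(M1b i).1// ltW.
      rewrite -[X in _ <= X * _](ger0_norm eM) -sqrtr_sqr -sqrtrM ?sqr_ge0//.
      rewrite ler_wsqrtr// -L2sqnormZ//; apply: le_L2sqnorm => //.
      - exact: L2_measurable (Lsm _ _ (sb i) w2).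
      - exact: L2Z.
      - move=> x Ox; rewrite normrM [leRHS]normrM ler_wpM2r// [leRHS]ger0_norm//.
        by rewrite /b normrM; apply: ler_pM => //; [case: (zE x Ox)|exact: (M1b i).2].
    by rewrite ler_wpM2l ?mulr_ge0 ?(M1b i).1// ltW.
  have b2 : ip Omega (fun x => b i x * g i x) w = ip Omega (fun x => b i x * w x) (g i).
    by apply: eq_Rintegral => x _; ring.
  have b3 : `|ip Omega (fun x => zeta x * D2 i x * w x) w| <= e * M2 i * (W + G).
    apply: le_trans (le_normr_Rintegral mO (L2_integrableM mO a2 w2)) _.
    apply: (@le_trans _ _ (\int[mu]_(x in Omega) (e * M2 i * w x ^+ 2))).
      apply: le_Rintegral => //.
      - exact: (integrable_norm (L2_integrableM mO a2 w2)).
      - exact: (integrableZl mO (e * M2 i) (L2_integrable_sqr mO w2)).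
      - move=> x Ox; rewrite -mulrA normrM -expr2 [`|w x ^+ 2|]ger0_norm ?sqr_ge0//.
        rewrite ler_wpM2r ?sqr_ge0// normrM; apply: ler_pM => //; [by case: (zE x Ox)|exact: (M2b i).2].
    rewrite (RintegralZl (e * M2 i) mO (L2_integrable_sqr mO w2)).
    apply: ler_wpM2l; first by rewrite mulr_ge0 ?(M2b i).1// ltW.
    by rewrite -/(L2sqnorm Omega w) -/W lerDl.
  rewrite b2; move: b1 b3; rewrite !ler_norml => /andP[b1 _] /andP[b3 _].
  set u := ip _ _ (g i) in b1 *; set v := ip _ _ w; set z := ip _ _ w in b3 *.
  set q := e * M1 i * _ in b1; set r := e * M2 i * _ in b3.
  have -> : e * (M1 i + M2 i) * (W + G) = 2 * q + r by rewrite /q /r; field.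
  lra.
have tot : \sum_i ip Omega (fun x => P i x * w x) w <= e * S * (W + G).
  rewrite /S mulr_sumr mulr_suml; apply: ler_sum => i _; exact: PB.
have low : expR (-1) * (m / 2) * L2sqnorm (strip e) w <= \sum_i ip Omega (fun x => P i x * w x) w.
  have ms := measurable_strip e.
  have w2s : L2 (strip e) w := L2_subset mO ms (@strip_Omega e) w2.
  have a1 i : L2 Omega (fun x => P i x * w x) := Lsm _ _ (sP i) w2.
  have ii i : mu.-integrable Omega (EFin \o (fun x => P i x * w x * w x)) := L2_integrableM mO (a1 i) w2.
  rewrite /ip -(Rintegral_bigsum (index_enum _) mO ii).
  have iS : mu.-integrable Omega (EFin \o (fun x => \sum_i P i x * w x * w x)).
    rewrite (_ : (fun x => _) = (fun x => (\sum_i P i x * w x) * w x)).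
      by apply: L2_integrableM => //; exact: L2_sum.
    by apply/funext => x; rewrite mulr_suml.
  have iSs := integrableS mO ms (@strip_Omega e) iS.
  apply: (@le_trans _ _ (\int[mu]_(x in strip e) (\sum_i P i x * w x * w x))).
    rewrite -(RintegralZl _ ms (L2_integrable_sqr ms w2s)).
    apply: le_Rintegral => //.
      exact: (integrableZl ms (expR (-1) * (m / 2)) (L2_integrable_sqr ms w2s)).
    move=> x xs; have Ox := strip_Omega xs.
    have -> : \sum_i P i x * w x * w x = expR (rho x * e^-1) * (\sum_i D1 i x ^+ 2) * w x ^+ 2.
      by rewrite mulr_sumr mulr_suml; apply: eq_bigr => i _; rewrite /P; ring.
    rewrite ler_wpM2r ?sqr_ge0//; apply: ler_pM.
    - exact: expR_ge0.
    - by rewrite divr_ge0// ltW.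
    - rewrite ler_expR; move: xs => /= /andP[xs _].
      by rewrite ler_pdivlMr// mulN1r ltW.
    - have := xmin x; rewrite inE => /(_ (subset_closure Ox)); rewrite /grad_weight -/(D1 _).
      have : rho x ^+ 2 <= m / 2.
        move: xs => /= /andP[xs1 xs2]; nra.
      by set q := \sum_i _; move=> h1 h2; have : m <= q + rho x ^+ 2 by []; lra.
  have sT x : 0 <= \sum_i P i x * w x * w x.
    apply: sumr_ge0 => i _; rewrite -mulrA -expr2 mulr_ge0 ?sqr_ge0//.
    by rewrite /P mulr_ge0 ?expR_ge0 ?sqr_ge0.
  rewrite /Rintegral; apply: fine_le.
  - exact: integrable_fin_num iSs.
  - exact: integrable_fin_num iS.
  - apply: ge0_subset_integral => //.
      by have /integrableP[] := iS.
    by move=> x _; rewrite lee_fin.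
    exact: strip_Omega.
have mE : 0 < m * expR (-1) by rewrite mulr_gt0.
have -> : 2 * (S + 1) / (m * expR (-1)) * e * (W + G) =
   (2 * (S + 1) * e * (W + G)) / (m * expR (-1)) by field; rewrite !gt_eqF.
rewrite ler_pdivlMr//.
have h := le_trans low tot.
have : e * S * (W + G) <= e * (S + 1) * (W + G).
  by apply: ler_wpM2r; [rewrite addr_ge0|rewrite ler_pM2l//; lra].
set L := L2sqnorm _ _ in h *; nra.
Qed.

End poincare.

(** * From small balls to the whole domain *)

Section poincare.
Context {R : realType} {n : nat} (Omega : set 'rV[R]_n) (rho : 'rV[R]_n -> R).
Hypothesis drho : defining_function Omega rho.
Hypothesis bO : bounded_set Omega.
Hypothesis cO : connected Omega.
Hypothesis O0 : Omega !=set0.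

Local Notation mu := (@lebesgue_rV R n).

Let srho : smooth rho. Proof. by case: drho. Qed.
Let OE : Omega = [set x | rho x < 0]. Proof. by case: drho. Qed.
Let mO : measurable Omega := measurable_Omega srho OE.
Let fO : (mu Omega < +oo)%E := finite_Omega srho OE bO.
Let oO : open Omega. Proof. by rewrite -(sublevel0 OE); exact: open_sublevel. Qed.

Lemma measurable_fun_rV_add : measurable_fun [set: 'rV[R]_n * 'rV[R]_n] (fun z => z.2 + z.1).
Proof.
apply: measurable_fun_rVP => i.
rewrite (_ : _ \o _ = (fun z : 'rV[R]_n * 'rV[R]_n => coord_rV i z.2 + coord_rV i z.1)).
  apply: measurable_funD; apply: (measurableT_comp (measurable_coord_rV i)).
    exact: measurable_snd.
  exact: measurable_fst.
by apply/funext => z; rewrite /= /coord_rV mxE.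
Qed.

(** The function (f (x + y) - f x)^2 is integrated over B x V in both orders. For fixed x in B the
    points x + y cover B, because B - B lies in V, so the inner integral is at least [c]; for fixed
    y it is at most [k]. *)
Lemma double_integral_translate (B V : set 'rV[R]_n) (f : 'rV[R]_n -> R) (c k : R) :
  measurable B -> measurable V -> measurable_fun [set: 'rV[R]_n] f -> 0 <= c -> 0 <= k ->
  (forall x y, B x -> B y -> V (x - y)) ->
  (forall y, B y -> (c%:E <= \int[mu]_(x in B) ((f x - f y) ^+ 2)%:E)%E) ->
  (forall y, V y -> (\int[mu]_(x in B) ((f (x + y) - f x) ^+ 2)%:E <= k%:E)%E) ->
  (c%:E * mu B <= k%:E * mu V)%E.
Proof.
move=> mB mV mf c0 k0 BV hc hk.
pose F (z : 'rV[R]_n * 'rV[R]_n) : \bar R := ((f (z.2 + z.1) - f z.1) ^+ 2)%:E.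
have mF : measurable_fun [set: 'rV[R]_n * 'rV[R]_n] F.
  apply/measurable_EFinP; apply: measurable_funX; apply: measurable_funB.
    exact: (measurableT_comp mf measurable_fun_rV_add).
  exact: (measurableT_comp mf measurable_fst).
have mf2 (t : 'rV[R]_n) (D : set 'rV[R]_n) : measurable_fun D (fun x => ((f x - f t) ^+ 2)%:E).
  apply: measurable_funTS; apply/measurable_EFinP; apply: measurable_funX.
  exact: measurable_funB.
pose G : 'rV[R]_n * 'rV[R]_n -> \bar R := (F \_ (B `*` V)).
have G0 z : (0 <= G z)%E by rewrite /G /patch; case: ifP => // _; rewrite lee_fin sqr_ge0.
have mG : measurable_fun [set: 'rV[R]_n * 'rV[R]_n] G.
  have mBV : measurable (B `*` V) by exact: measurableX.
  by apply/(measurable_restrictT _ mBV); exact: measurable_funTS.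
have GB x : B x -> (\int[mu]_y G (x, y) = \int[mu]_(y in V) F (x, y))%E.
  move=> Bx; rewrite [RHS]integral_mkcond; apply: eq_integral => y _.
  rewrite /G /patch; congr (if _ then _ else _).
  by apply/idP/idP; rewrite !inE//=; case.
have GV y : (\int[mu]_x G (x, y) = if y \in V then \int[mu]_(x in B) F (x, y) else 0)%E.
  case: ifPn => [|] yV.
    rewrite inE in yV.
    rewrite [RHS]integral_mkcond; apply: eq_integral => x _.
    rewrite /G /patch; congr (if _ then _ else _).
    by apply/idP/idP; rewrite !inE//=; case.
  rewrite integral0_eq// => x _; rewrite /G patchN//; apply: contra yV.
  by rewrite !inE => -[].
have mV' (x : 'rV[R]_n) : measurable ((fun y => y + x) @^-1` B).
  by rewrite -[X in measurable X]setTI; exact: measurable_translate.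
apply: (@le_trans _ _ (\int[mu]_x \int[mu]_y G (x, y))%E).
  apply: (@le_trans _ _ (\int[mu]_(x in B) \int[mu]_y G (x, y))%E).
    rewrite -(integral_cst mu mB); apply: ge0_le_integral => //.
    - by apply: measurable_funTS; exact: measurable_fun_fubini_tonelli_F.
    - move=> x Bx; rewrite GB//; apply: le_trans (hc x Bx) _.
      rewrite -(ge0_integral_translate x mB (mf2 x B)); last first.
        by move=> t _; rewrite lee_fin sqr_ge0.
      apply: ge0_subset_integral => //.
      + apply: measurable_funTS.
        exact: (measurableT_comp mF (measurable_pair1 x)).
      + by move=> y _; rewrite lee_fin sqr_ge0.
      + by move=> y /= By; have := BV _ _ By Bx; rewrite addrK.
  apply: ge0_subset_integral => //.
  - exact: measurable_fun_fubini_tonelli_F.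
  - by move=> x _; apply: integral_ge0.
rewrite fubini_tonelli//.
under eq_integral do rewrite GV.
have -> : (fun y => if y \in V then \int[mu]_(x in B) F (x, y) else 0)%E =
   ((fun y => \int[mu]_x G (x, y)) \_ V)%E.
  by apply/funext => y; rewrite /patch GV; case: ifP.
rewrite -integral_mkcond -(integral_cst mu mV).
apply: ge0_le_integral => //.
- by move=> y _; apply: integral_ge0.
- by apply: measurable_funTS; exact: measurable_fun_fubini_tonelli_G.
- move=> y Vy; rewrite GV; case: ifP => // _.
  rewrite (eq_integral (fun x : 'rV[R]_n => ((f (x + y) - f x) ^+ 2)%:E)); first exact: hk.
  by move=> x _; rewrite /F/= (addrC y).
Qed.

Lemma L2sqnorm_fineK (D : set 'rV[R]_n) (f : 'rV[R]_n -> R) : measurable D -> L2 D f ->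
  (\int[mu]_(x in D) (f x ^+ 2)%:E)%E = (L2sqnorm D f)%:E.
Proof.
move=> mD f2; rewrite /L2sqnorm /Rintegral fineK//.
exact: (integrable_fin_num mD (L2_integrable_sqr mD f2)).
Qed.

Lemma finite_subset (A : set 'rV[R]_n) : measurable A -> A `<=` Omega -> (mu A < +oo)%E.
Proof. by move=> mA AO; apply: le_lt_trans fO; apply: le_measure; rewrite ?inE. Qed.

(* Bounding the energy by some K > 0, instead of using the energy itself, leaves
   room for choosing c among the values of w on a ball: they cannot all have a
   deviation above the average one. *)
Definition poincare_set (A : set 'rV[R]_n) := [/\ open A, A `<=` Omega &
  exists2 C : R, 0 <= C & forall (w : 'rV[R]_n -> R) (g : 'I_n -> 'rV[R]_n -> R) (K : R),
    L2 Omega w -> (forall i, is_weak_partial Omega i w (g i)) ->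
    0 < K -> \sum_i L2sqnorm Omega (g i) <= K ->
    exists c : R, L2sqnorm A (fun x => w x - c) <= C * K].

(** If every constant failed, so would every value [w y] with y in the ball.
    [double_integral_translate] would then contradict the bound on small translations. *)
Lemma poincare_set_ball (x : 'rV[R]_n) : Omega x -> exists2 l : R, 0 < l & poincare_set (ball x l).
Proof.
rewrite OE => /= rx; pose k : R := - rho x / 2.
have k0 : 0 < k by rewrite /k; lra.
have [s [C [s0 C0 sC]]] := translation_bound srho OE bO k0.
have [l1 l10 l1k] : exists2 l : R, 0 < l & ball x l `<=` sublevel rho k.
  have : nbhs x (sublevel rho k).
    by apply: open_nbhs_nbhs; split; [exact: open_sublevel|rewrite /sublevel/= /k; lra].
  by move=> /nbhs_ballP[l /= l0 h]; exists l.
(* Differences of two points of the ball have norm below 2 l <= s, within reach of the translation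
   bound. *)
pose l : R := Num.min l1 (s / 2).
have l0 : 0 < l by rewrite /l lt_min l10 divr_gt0.
have ls : l + l <= s by have : l <= s / 2 by [rewrite /l ge_min lexx orbT]; lra.
exists l => //.
have Bk : ball x l `<=` sublevel rho k.
  by move=> y h; apply: l1k; apply: le_ball h; rewrite /l ge_min lexx.
have BO : ball x l `<=` Omega by move=> y /Bk; apply: (sublevel_Omega OE); exact: ltW.
have mB := measurable_rV_ball x l.
have mV := measurable_rV_ball (0 : 'rV[R]_n) (l + l).
set B := ball x l in Bk BO mB *; set V := ball 0 (l + l) in mV.
have fB := finite_subset mB BO.
have muB : mu B = ((l *+ 2) ^+ n)%:E by rewrite lebesgue_rV_ball.
have muV : mu V = (((l + l) *+ 2) ^+ n)%:E by rewrite lebesgue_rV_ball// addr_gt0.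
have b0 : 0 < (l *+ 2) ^+ n by rewrite exprn_gt0// pmulrn_lgt0.
have v0 : 0 < ((l + l) *+ 2) ^+ n by rewrite exprn_gt0// pmulrn_lgt0// addr_gt0.
set b := (l *+ 2) ^+ n in muB b0; set v := _ ^+ n in muV v0.
have ms := open_measurable_rV (@open_sublevel _ _ _ srho k).
split=> //; first exact: ball_open.
(* Averaging only yields a weak inequality with C v / b; the extra 1 and [K > 0] turn it into a
   contradiction. *)
exists ((C * v + 1) / b) => [|w g K w2 wg K0 GK].
  by rewrite divr_ge0 ?addr_ge0 ?mulr_ge0// ltW.
apply: contrapT => /forallNP h.
have w2B : L2 B w := L2_subset mO mB BO w2.
have wc2 c : L2 B (fun y => w y - c) := L2B mB w2B (L2_cst c mB fB).
pose f := w \_ Omega.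
have mf : measurable_fun [set: 'rV[R]_n] f.
  by apply/(measurable_restrictT _ mO); exact: L2_measurable w2.
have fE y : Omega y -> f y = w y by move=> Oy; rewrite /f patchE mem_set.
have := @double_integral_translate B V f ((C * v + 1) / b * K) (C * K) mB mV mf.
rewrite muB muV -!EFinM lee_fin => H.
have {H} : (C * v + 1) / b * K * b <= C * K * v.
  apply: H.
  - by rewrite !mulr_ge0 ?invr_ge0 ?addr_ge0 ?mulr_ge0// ltW.
  - by rewrite mulr_ge0// ltW.
  - move=> y z [_ By] [_ Bz]; split=> [|i j]; first by rewrite addr_gt0.
    have := By i j; have := Bz i j; rewrite /ball /= !mxE => h1 h2.
    rewrite sub0r normrN.
    have -> : y i j - z i j = (x i j - z i j) - (x i j - y i j) by ring.
    by apply: le_lt_trans (ler_normB _ _) _; rewrite ltrD.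
  - move=> y By; have {h} /negP := h (w y); rewrite -ltNge => /ltW h.
    rewrite (eq_integral (fun t : 'rV[R]_n => ((w t - w y) ^+ 2)%:E)); last first.
      by move=> t; rewrite inE => Bt; rewrite !fE//; exact: BO.
    by rewrite (L2sqnorm_fineK mB (wc2 _)) lee_fin.
  - move=> y Vy.
    have ys : `|y| < s.
      by apply: lt_le_trans ls; move: Vy; rewrite /V -ball_normE /= sub0r normrN.
    have [h1 h2] := sC w g w2 wg y ys.
    have w2s : L2 (sublevel rho k) w by apply: (L2_subset mO ms _ w2); apply: (sublevel_Omega OE); exact: ltW.
    have w2t : L2 (sublevel rho k) (fun z => w (z + y)).
      apply: (L2_subset _ ms _ (L2_translate y mO w2)); last by move=> z; exact: h1.
      by rewrite -[X in measurable X]setTI; exact: measurable_translate.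
    apply: (@le_trans _ _ (L2sqnorm (sublevel rho k) (fun z => w (z + y) - w z))%:E); last first.
      by rewrite lee_fin; apply: le_trans h2 _; exact: ler_wpM2l.
    rewrite -(L2sqnorm_fineK ms (L2B ms w2t w2s)).
    rewrite (eq_integral (fun z : 'rV[R]_n => ((w (z + y) - w z) ^+ 2)%:E)); last first.
      by move=> z; rewrite inE => Bz; rewrite !fE//; [exact: BO|exact: h1 (Bk _ Bz)].
    apply: ge0_subset_integral => //.
      by have /integrableP[] := L2_integrable_sqr ms (L2B ms w2t w2s).
    by move=> z _; rewrite lee_fin sqr_ge0.
have -> : (C * v + 1) / b * K * b = (C * v + 1) * K by field; rewrite gt_eqF.
nra.
Qed.

Lemma L2sqnormU_le (A B : set 'rV[R]_n) (f : 'rV[R]_n -> R) : measurable A -> measurable B ->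
  L2 A f -> L2 B f -> L2sqnorm (A `|` B) f <= L2sqnorm A f + L2sqnorm B f.
Proof.
move=> mA mB fA fB; have mU : measurable (A `|` B) by exact: measurableU.
have mD : measurable (B `\` A) by exact: measurableD.
have mf : measurable_fun (A `|` B) f.
  by apply/measurable_funU => //; split; exact: L2_measurable.
have mf2 : measurable_fun (A `|` B) (fun x => (f x ^+ 2)%:E).
  by apply/measurable_EFinP; exact: measurable_funX.
have f0 x : (0 <= (f x ^+ 2)%:E)%E by rewrite lee_fin sqr_ge0.
have UE : A `|` B = A `|` (B `\` A).
  by apply/seteqP; split=> x [] Hx; [left|have [?|?] := pselect (A x); [left|right]|left|right; case: Hx].
have le : (\int[mu]_(x in A `|` B) (f x ^+ 2)%:E <= (L2sqnorm A f + L2sqnorm B f)%:E)%E.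
  rewrite EFinD -!L2sqnorm_fineK//; move: mf2; rewrite UE => mf2.
  rewrite ge0_integral_setU//; last by rewrite disj_set2E setDE setICA setICr setI0.
  rewrite leeD2l//; apply: ge0_subset_integral => //.
    by apply/measurable_EFinP; apply: measurable_funX; exact: L2_measurable.
have U2 : L2 (A `|` B) f by split=> //; apply: le_lt_trans le _; rewrite ltry.
by rewrite -lee_fin -L2sqnorm_fineK.
Qed.

(** The intersection is open and nonempty, hence of positive measure. There [w] is close to both
    constants, which bounds the difference [cB - cA], and [cA] then serves for the union. *)
Lemma poincare_setU (A B : set 'rV[R]_n) : poincare_set A -> poincare_set B ->
  A `&` B !=set0 -> poincare_set (A `|` B).
Proof.
move=> [oA AO [CA CA0 hA]] [oB BO [CB CB0 hB]] AB0.
have mA := open_measurable_rV oA; have mB := open_measurable_rV oB.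
have oI : open (A `&` B) by exact: openI.
have mI := open_measurable_rV oI.
have IA : A `&` B `<=` A by move=> x [].
have IB : A `&` B `<=` B by move=> x [].
have fI : (mu (A `&` B) < +oo)%E := finite_subset mI (subset_trans IA AO).
have m0 := lebesgue_rV_open_gt0 oI AB0.
pose m := fine (mu (A `&` B)).
have m00 : 0 < m by rewrite fine_gt0// m0 fI.
have fB := finite_subset mB BO.
have fA := finite_subset mA AO.
pose b := fine (mu B); have b0 : 0 <= b by exact: fine_ge0.
split; [exact: openU|by move=> x [/AO|/BO]|].
exists (CA + 2 * CB + 2 * (2 * CA + 2 * CB) / m * b).
  by rewrite !addr_ge0 ?mulr_ge0 ?addr_ge0 ?mulr_ge0 ?invr_ge0// ltW.
move=> w g K w2 wg K0 GK.
have [cA hcA] := hA w g K w2 wg K0 GK; have [cB hcB] := hB w g K w2 wg K0 GK.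
have wA c : L2 A (fun y => w y - c) := L2B mA (L2_subset mO mA AO w2) (L2_cst c mA fA).
have wB c : L2 B (fun y => w y - c) := L2B mB (L2_subset mO mB BO w2) (L2_cst c mB fB).
have sqcst D (c : R) : measurable D -> L2sqnorm D (fun _ => c) = c ^+ 2 * fine (mu D).
  by move=> mD; rewrite /L2sqnorm Rintegral_cst.
have d1 : (cB - cA) ^+ 2 * m <= 2 * (CA * K) + 2 * (CB * K).
  rewrite -sqcst//.
  have -> : (fun _ : 'rV[R]_n => cB - cA) = (fun x => (w x - cA) + (-1) * (w x - cB)).
    by apply/funext => x; ring.
  have v1 : L2 (A `&` B) (fun x => w x - cA) := L2_subset mA mI IA (wA cA).
  have v2 : L2 (A `&` B) (fun x => w x - cB) := L2_subset mB mI IB (wB cB).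
  have h := L2sqnormD_le mI v1 (L2Z (-1) mI v2); apply: (le_trans h).
  rewrite L2sqnormZ//.
  rewrite sqrrN expr1n mul1r; apply: lerD; rewrite ler_pM2l//.
    by apply: le_trans hcA; exact: le_L2sqnorm_subset.
  by apply: le_trans hcB; exact: le_L2sqnorm_subset.
have d2 : L2sqnorm B (fun y => w y - cA) <= 2 * (CB * K) + 2 * ((cB - cA) ^+ 2 * b).
  rewrite -sqcst//.
  have -> : (fun y => w y - cA) = (fun x => (w x - cB) + (cB - cA)).
    by apply/funext => x; ring.
  apply: le_trans (L2sqnormD_le mB (wB _) (L2_cst _ mB fB)) _.
  by rewrite lerD2r ler_pM2l.
exists cA; apply: le_trans (L2sqnormU_le mA mB (wA _) (wB _)) _.
have d3 : (cB - cA) ^+ 2 <= (2 * (CA * K) + 2 * (CB * K)) / m by rewrite ler_pdivlMr.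
have d4 : (cB - cA) ^+ 2 * b <= (2 * (CA * K) + 2 * (CB * K)) / m * b by exact: ler_wpM2r.
have -> : (CA + 2 * CB + 2 * (2 * CA + 2 * CB) / m * b) * K =
  CA * K + (2 * (CB * K) + 2 * ((2 * (CA * K) + 2 * (CB * K)) / m * b)) by ring.
apply: lerD => //; apply: le_trans d2 _.
by rewrite lerD2l ler_pM2l.
Qed.

(** The points that share a Poincare set with [x] form an open subset of [Omega]. It is also
    relatively closed, since a ball around a limit point meets one of these sets and can be joined
    to it. *)
Lemma poincare_set_connect (x y : 'rV[R]_n) : Omega x -> Omega y ->
  exists A, [/\ poincare_set A, A x & A y].
Proof.
move=> Ox Oy.
pose S := [set z | exists A, [/\ poincare_set A, A x & A z]].
have SO : S `<=` Omega by move=> z [A [[_ AO _] _ /AO]].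
have oS : open S.
  rewrite openE => z [A [gA Ax Az]]; have [oA _ _] := gA.
  apply: filterS (open_nbhs_nbhs (conj oA Az)) => t At.
  by exists A.
have [l l0 gl] := poincare_set_ball Ox.
suff SE : S = Omega by move: Oy; rewrite -SE => -[A hA]; exists A.
apply: cO.
- by exists x, (ball x l); split=> //; exact: ballxx.
- by exists S => //; rewrite setIidr.
- exists (closure S); first exact: closed_closure.
  apply/seteqP; split=> [z Sz|z [Oz cz]]; first by split; [exact: SO|exact: subset_closure].
  have [r r0 gr] := poincare_set_ball Oz.
  have [t [[A [gA Ax At]] Bt]] := cz _ (nbhsx_ballx z r r0).
  exists (A `|` ball z r); split; [|by left|by right; exact: ballxx].
  by apply: poincare_setU => //; exists t.
Qed.

(** All sets of the cover are chosen to contain the base point [x0], so that any finite union is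
    built from overlapping sets. *)
Lemma poincare_set_compact (K : set 'rV[R]_n) : compact K -> K `<=` Omega ->
  exists2 A, poincare_set A & K `<=` A.
Proof.
move=> cK KO; have [x0 Ox0] := O0.
have /choice[A hA] : forall x, exists A, Omega x -> [/\ poincare_set A, A x0 & A x].
  move=> x; have [Ox|nO] := pselect (Omega x); last by exists set0.
  by have [A hA] := poincare_set_connect Ox0 Ox; exists A.
have U (s : seq 'rV[R]_n) : (forall x, x \in s -> Omega x) ->
    exists B, [/\ poincare_set B, B x0 & forall x, x \in s -> A x `<=` B].
  elim: s => [_|x s IH h].
    by have [B [gB Bx _]] := poincare_set_connect Ox0 Ox0; exists B.
  have [y ys|B [gB Bx0 hB]] := IH; first by apply: h; rewrite inE ys orbT.
  have Ox : Omega x by apply: h; rewrite inE eqxx.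
  have [gA Ax0 Ax] := hA x Ox.
  exists (A x `|` B); split; [|by left|].
    by apply: poincare_setU => //; exists x0.
  by move=> y; rewrite inE => /orP[/eqP ->|/hB yB] z Az; [left|right; exact: yB].
have : cover_compact K by rewrite -compact_cover.
move=> /(_ _ Omega A)[|x Kx|D DO KD].
- by move=> x Ox; have [[]] := hA x Ox.
- by exists x; [exact: KO|have [] := hA x (KO _ Kx)].
have [B [gB _ hB]] : exists B, [/\ poincare_set B, B x0 & forall x, x \in finmap.enum_fset D -> A x `<=` B].
  by apply: U => x xD; have := DO x xD; rewrite inE.
by exists B => // z /KD[x /= xD Az]; exact: (hB x xD).
Qed.

Lemma volume_gt0 : 0 < volume Omega.
Proof. by rewrite /volume fine_gt0// lebesgue_rV_open_gt0//= fO. Qed.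

(** [w] minus its mean is orthogonal to the constants, so the mean is the best constant. *)
Lemma L2sqnorm_mean_le (w : 'rV[R]_n -> R) (c : R) : L2 Omega w ->
  L2sqnorm Omega (fun x => w x - mean Omega w) <= L2sqnorm Omega (fun x => w x - c).
Proof.
move=> w2; set m := mean Omega w.
have L2c k : L2 Omega (fun _ => k) := L2_cst k mO fO.
have v2 : L2 Omega (fun x => w x - m) := L2B mO w2 (L2c m).
have v0 k : ip Omega (fun x => w x - m) (fun _ => k) = 0.
  rewrite ipC (_ : (fun _ => k) = (fun x => k * 1)); last by apply/funext => x; rewrite mulr1.
  rewrite (ipZl k mO (L2c 1) v2) ipC (ipBl mO w2 (L2c m) (L2c 1)) /ip.
  under eq_Rintegral do rewrite mulr1.
  rewrite Rintegral_cst// mulr1 -/(volume Omega) /m /mean.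
  by rewrite mulrAC mulVf ?mul1r ?subrr ?mulr0// gt_eqF// volume_gt0.
rewrite [leRHS]L2sqnormE (_ : (fun x => w x - c) = (fun x => (w x - m) + (m - c))); last first.
  by apply/funext => x; ring.
rewrite (ipDl mO v2 (L2c _) (L2D mO v2 (L2c _))).
rewrite (ipDr mO v2 (L2c _) v2) (ipDr mO v2 (L2c _) (L2c _)).
rewrite v0 (ipC _ (fun _ => m - c)) v0 addr0 add0r -L2sqnormE lerDl.
exact: ip_self_ge0.
Qed.

Theorem poincare_inequality : exists2 C : R, 0 <= C &
  forall (w : 'rV[R]_n -> R) (g : 'I_n -> 'rV[R]_n -> R), L2 Omega w ->
    (forall i, is_weak_partial Omega i w (g i)) ->
    L2sqnorm Omega (fun x => w x - mean Omega w) <= C * \sum_i L2sqnorm Omega (g i).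
Proof.
have [C [e0 [C0 e00 hs]]] := strip_estimate drho bO O0.
(* With C e <= 1/2 the strip contributes at most half of the deviation plus half of the energy;
   absorbing it on the left gives the factor 2 CA + 1. *)
pose e : R := Num.min (e0 / 2) (2 * C)^-1.
have e_gt0 : 0 < e by rewrite /e lt_min divr_gt0//= invr_gt0 mulr_gt0.
have ee0 : e < e0 by apply: (@le_lt_trans _ _ (e0 / 2)); [rewrite /e ge_min lexx|lra].
have Ce : C * e <= 2^-1.
  have : e <= (2 * C)^-1 by rewrite /e ge_min lexx orbT.
  by move=> h; apply: le_trans (ler_wpM2l (ltW C0) h) _; rewrite invfM mulrCA mulfV ?mulr1// gt_eqF.
have [A gA KA] : exists2 A, poincare_set A & [set x | rho x <= - e] `<=` A.
  apply: poincare_set_compact; first exact: (compact_level srho OE bO e_gt0).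
  by rewrite OE => x /= h; lra.
have [oA AO [CA CA0 hA]] := gA.
have mA := open_measurable_rV oA.
have mS := measurable_strip drho e.
exists (2 * CA + 1) => [|w g w2 wg]; first by lra.
set G := \sum_i _.
have G0 : 0 <= G by apply: sumr_ge0 => i _; exact: L2sqnorm_ge0.
set m := mean Omega w.
have key K : 0 < K -> G <= K -> L2sqnorm Omega (fun x => w x - m) <= (2 * CA + 1) * K.
  move=> K0 GK; have [c hc] := hA w g K w2 wg K0 GK.
  have v2 : L2 Omega (fun x => w x - c) := L2B mO w2 (L2_cst c mO fO).
  have wv i : is_weak_partial Omega i (fun x => w x - c) (g i) :=
    is_weak_partial_addc srho OE bO (- c) w2 (wg i).
  have h1 := hs e (introT andP (conj e_gt0 ee0)) _ g v2 wv.
  have h2 : L2sqnorm Omega (fun x => w x - c) <= L2sqnorm A (fun x => w x - c) + L2sqnorm (strip rho e) (fun x => w x - c).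
    have OU : Omega = A `|` strip rho e.
      apply/seteqP; split=> x.
        rewrite OE /= => rx; have [h|h] := leP (rho x) (- e); first by left; exact: KA.
        by right; rewrite /strip/= h.
      by move=> [/AO//|]; exact: (strip_Omega drho).
    rewrite {1}OU; apply: L2sqnormU_le => //; first exact: (L2_subset mO mA AO v2).
    exact: (L2_subset mO mS (@strip_Omega _ _ _ _ drho e) v2).
  have h3 : L2sqnorm Omega (fun x => w x - m) <= L2sqnorm Omega (fun x => w x - c).
    exact: L2sqnorm_mean_le.
  apply: le_trans h3 _.
  move: h1 h2; set L := L2sqnorm Omega _; set L1 := L2sqnorm (strip _ _) _ => h1 h2.
  have L0 : 0 <= L := L2sqnorm_ge0 _ _.
  have : L1 <= 2^-1 * (L + K).
    apply: le_trans h1 _; apply: ler_pM => //; rewrite ?mulr_ge0 ?addr_ge0// ?lerD2l// ltW//.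
  move: hc h2; set L2 := L2sqnorm A _ => hc h2 h4; lra.
(* The sets ask for a positive bound [K] on the energy, so the energy, possibly 0, is approached
   from above. *)
apply/ler_addgt0Pr => q q0.
have k0 : 0 < 2 * CA + 1 by lra.
have := key (G + q / (2 * CA + 1)).
rewrite mulrDr mulrCA mulfV ?gt_eqF// mulr1; apply.
  by rewrite ltr_wpDl// divr_gt0.
by rewrite lerDl divr_ge0// ltW.
Qed.

End poincare.

(** * Steady states and eigenfunctions for large diffusion *)

Section nicholson.
Context {R : realType}.
Implicit Types s t : R.

Lemma is_derive_nicholson s : is_derive s (1 : R) (@nicholson R) ((1 - s) * expR (- s)).
Proof.
have [h1 h2] := is_derive1_comp (f := expR) (g := fun t : R => - t) (is_derive_expR _)
  (is_deriveN (is_derive_id s (1 : R))).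
have h3 : is_derive s (1 : R) (fun t : R => expR (- t)) (- expR (- s)).
  by apply: DeriveDef; [exact: h1|apply: (etrans h2); rewrite mulrN1].
have [h4 h5] := is_deriveM (is_derive_id s (1 : R)) h3.
apply: DeriveDef; [exact: h4|apply: (etrans h5)].
rewrite /GRing.scale/=; ring.
Qed.

Lemma derive1_nicholson s : derive1 (@nicholson R) s = (1 - s) * expR (- s).
Proof. by have h := is_derive_nicholson s; rewrite derive1E (@derive_val _ _ _ _ _ _ _ h). Qed.

Lemma expRN_le1 s : 0 <= s -> expR (- s) <= 1.
Proof. by move=> s0; rewrite expR_le1 oppr_le0. Qed.

Lemma mul_expRN_le1 s : 0 <= s -> s * expR (- s) <= 1.
Proof.
move=> s0; rewrite expRN ler_pdivrMr ?expR_gt0// mul1r.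
have := expR_ge1Dx s; lra.
Qed.

(** From e^s = (e^(s/2))^2 >= (s/2)^2. It bounds the source term of the energy identity whatever the
    size of the steady state. *)
Lemma sqr_expRN_le4 s : 0 <= s -> s ^+ 2 * expR (- s) <= 4.
Proof.
move=> s0; rewrite expRN ler_pdivrMr ?expR_gt0//.
have -> : expR s = expR (s / 2) ^+ 2 by rewrite expr2 -expRD; congr expR; field.
have h := expR_ge1Dx (s / 2).
have h1 : s / 2 <= expR (s / 2) by lra.
have h2 : (s / 2) ^+ 2 <= expR (s / 2) ^+ 2 by rewrite ler_sqr ?nnegrE ?expR_ge0// divr_ge0.
have -> : s ^+ 2 = 4 * (s / 2) ^+ 2 by field.
by rewrite ler_pM2l.
Qed.

Let expRN_diff s t : 0 <= s -> s <= t ->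
  0 <= expR (- s) - expR (- t) <= expR (- s) * (t - s).
Proof.
move=> s0 st; have -> : - t = - s + (s - t) by ring.
rewrite expRD; have h := expR_ge1Dx (s - t); have e0 := expR_gt0 (- s).
have h2 : expR (s - t) <= 1 by rewrite expR_le1 subr_le0.
by apply/andP; split; nra.
Qed.

Lemma expRN_lipschitz s t : 0 <= s -> 0 <= t -> `|expR (- s) - expR (- t)| <= `|s - t|.
Proof.
wlog st : s t / s <= t => [wl s0 t0|s0 _].
  by have [st|/ltW ts] := leP s t; [exact: wl|rewrite distrC (distrC s) wl].
have /andP[h1 h2] := expRN_diff s0 st; have h3 := expRN_le1 s0.
rewrite ger0_norm// distrC ger0_norm ?subr_ge0//; apply: le_trans h2 _.
by rewrite -[leRHS]mul1r ler_wpM2r// subr_ge0.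
Qed.

Lemma nicholson'_lipschitz s t : 0 <= s -> 0 <= t ->
  `|(1 - s) * expR (- s) - (1 - t) * expR (- t)| <= 2 * `|s - t|.
Proof.
wlog st : s t / s <= t => [wl s0 t0|s0 t0].
  by have [st|/ltW ts] := leP s t; [exact: wl|rewrite distrC (distrC s) wl].
have /andP[h1 h2] := expRN_diff s0 st; have h3 := expRN_le1 s0; have h4 := mul_expRN_le1 s0.
have h5 := expRN_le1 t0; have e0 := expR_gt0 (- t); have e1 := expR_gt0 (- s).
rewrite (distrC s) (ger0_norm (_ : 0 <= t - s)) ?subr_ge0//.
move: h1 h2 h3 h4 h5 e0 e1; set a := expR (- s); set b := expR (- t) => h1 h2 h3 h4 h5 e0 e1.
have h0 : 0 <= t - s by rewrite subr_ge0.
have k1 : a * (t - s) <= t - s by nra.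
have k2 : s * (a - b) <= t - s by nra.
have k3 : 0 <= s * (a - b) by exact: mulr_ge0.
have k4 : 0 <= (t - s) * b <= t - s by apply/andP; split; nra.
(* Each of the three terms, up to sign, lies in [0, t - s]. *)
have -> : (1 - s) * a - (1 - t) * b = (a - b) - s * (a - b) + (t - s) * b by ring.
by case/andP: k4 => k4 k5; rewrite ler_norml; apply/andP; split; lra.
Qed.

Lemma nicholson'_le1 s : 0 <= s -> `|(1 - s) * expR (- s)| <= 1.
Proof.
move=> s0; have h3 := expRN_le1 s0; have h4 := mul_expRN_le1 s0; have e1 := expR_gt0 (- s).
have := mulr_ge0 s0 (ltW e1).
by rewrite mulrBl mul1r ler_norml => ?; apply/andP; split; lra.
Qed.

End nicholson.

(** * Energy estimates for steady states and eigenfunctions *)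

Section steady_states.
Context {R : realType} {n : nat} (Omega : set 'rV[R]_n) (rho : 'rV[R]_n -> R).
Hypothesis drho : defining_function Omega rho.
Hypothesis bO : bounded_set Omega.
Hypothesis cO : connected Omega.
Hypothesis O0 : Omega !=set0.
Variables (p delta : 'rV[R]_n -> R) (P D : R).
Hypothesis mp : measurable_fun Omega p.
Hypothesis mdelta : measurable_fun Omega delta.
Hypothesis pP : forall x, Omega x -> 0 <= p x <= P.
Hypothesis deltaD : forall x, Omega x -> 0 <= delta x <= D.

Local Notation mu := (@lebesgue_rV R n).
Local Notation V := (volume Omega).

Let srho : smooth rho. Proof. by case: drho. Qed.
Let OE : Omega = [set x | rho x < 0]. Proof. by case: drho. Qed.
Let mO : measurable Omega := measurable_Omega srho OE.
Let fO : (mu Omega < +oo)%E := finite_Omega srho OE bO.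
Let V0 : 0 < V := volume_gt0 drho bO O0.
Let L2c (k : R) : L2 Omega (fun _ => k) := L2_cst k mO fO.

Lemma Rintegral_gt0 (f : 'rV[R]_n -> R) : mu.-integrable Omega (EFin \o f) ->
  (forall x, Omega x -> 0 <= f x) -> {ae mu, forall x, Omega x -> 0 < f x} ->
  0 < \int[mu]_(x in Omega) f x.
Proof.
move=> fi f0 fae.
have ge0 : 0 <= \int[mu]_(x in Omega) f x by apply: Rintegral_ge0.
rewrite lt_neqAle ge0 andbT eq_sym; apply/negP => /eqP E0.
have /integrableP[mf _] := fi.
have fin := integrable_fin_num mO fi.
have E1 : (\int[mu]_(x in Omega) `|(EFin \o f) x| = 0)%E.
  rewrite (eq_integral (EFin \o f)); last by move=> x; rewrite inE => Ox; rewrite gee0_abs//= lee_fin f0.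
  by rewrite -(fineK fin) -/(Rintegral mu Omega f) E0.
have /(ae_eq_integral_abs mu mO mf) h := E1.
have : {ae mu, forall x, ~ Omega x}.
  apply: filterS2 fae h => x h1 h2 Ox.
  by have := h1 Ox; have [->] := h2 Ox; rewrite ltxx.
move=> Oneg; have Oz : mu Omega = 0%E.
  by apply: (measure_negligible mO); move: Oneg; apply: negligibleS => x Ox /=; apply.
by move: V0; rewrite /volume Oz ltxx.
Qed.

Lemma Rintegral_L2D (f g : 'rV[R]_n -> R) : L2 Omega f -> L2 Omega g ->
  \int[mu]_(x in Omega) (f x + g x) = \int[mu]_(x in Omega) f x + \int[mu]_(x in Omega) g x.
Proof. by move=> f2 g2; rewrite RintegralD//; exact: L2_integrable. Qed.

Lemma Rintegral_L2Z (k : R) (f : 'rV[R]_n -> R) : L2 Omega f ->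
  \int[mu]_(x in Omega) (k * f x) = k * \int[mu]_(x in Omega) f x.
Proof. by move=> f2; rewrite RintegralZl//; exact: L2_integrable. Qed.

Lemma Rintegral_Ocst (k : R) : \int[mu]_(x in Omega) k = k * V.
Proof. by rewrite Rintegral_cst. Qed.

Lemma Rintegral_mean (f : 'rV[R]_n -> R) : \int[mu]_(x in Omega) f x = V * mean Omega f.
Proof. by rewrite /mean mulrA mulfV ?mul1r// gt_eqF. Qed.

(** Cauchy-Schwarz against the constant 1. Through this lemma an L^2 deviation of order sqrt r
    becomes an error of order sqrt r in an averaged equation. *)
Lemma sqr_Rintegral_le (f w : 'rV[R]_n -> R) (M : R) : 0 <= M -> L2 Omega w ->
  measurable_fun Omega f -> (forall x, Omega x -> `|f x| <= M * `|w x|) ->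
  L2 Omega f /\ (\int[mu]_(x in Omega) f x) ^+ 2 <= V * (M ^+ 2 * L2sqnorm Omega w).
Proof.
move=> M0 w2 mf fM.
have Mw2 := L2Z M mO w2.
have fMw x : Omega x -> `|f x| <= `|M * w x| by move=> Ox; rewrite normrM (ger0_norm M0) fM.
have f2 : L2 Omega f := L2_le mO mf fMw Mw2.
split=> //; have -> : \int[mu]_(x in Omega) f x = ip Omega f (fun _ => 1).
  by apply: eq_Rintegral => x _; rewrite mulr1.
apply: le_trans (cauchy_schwarz mO f2 (L2c 1)) _.
have -> : L2sqnorm Omega (fun _ => 1) = V by rewrite /L2sqnorm expr1n Rintegral_Ocst mul1r.
rewrite mulrC ler_pM2l// -L2sqnormZ//.
exact: le_L2sqnorm.
Qed.

Lemma is_weak_partial_cst (k : R) i : is_weak_partial Omega i (fun _ => k) (fun _ => 0).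
Proof.
have h : is_weak_partial Omega i (fun _ => 0) (fun _ => 0).
  split; first exact: L2c.
  move=> phi _; rewrite -[LHS]opprK; congr (- _).
  under eq_Rintegral do rewrite mul0r; under [RHS]eq_Rintegral do rewrite mul0r.
  by rewrite Rintegral_Ocst mul0r oppr0.
have := is_weak_partial_addc srho OE bO k (L2c 0) h.
by rewrite (_ : (fun _ => 0 + k) = (fun _ => k))//; apply/funext => x; rewrite add0r.
Qed.

Lemma Rintegral_laplacian y : H2 Omega y -> neumann Omega y ->
  \int[mu]_(x in Omega) laplacian Omega y x = 0.
Proof.
move=> y2 ny.
have := green drho bO (L2c 1) (fun i => is_weak_partial_cst 1 i) y2 ny.
rewrite big1 ?addr0 => [<-|i _].
  by apply: eq_Rintegral => x _; rewrite mul1r.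
by rewrite /ip; under eq_Rintegral do rewrite mul0r; rewrite Rintegral_Ocst mul0r.
Qed.

Lemma ip_laplacian y : H2 Omega y -> neumann Omega y ->
  \sum_i L2sqnorm Omega (weak_partial Omega i y) = - ip Omega y (laplacian Omega y).
Proof.
move=> y2 ny; have [y1 _] := y2.
have := green drho bO y1.1 (fun i => weak_partialP i y1) y2 ny.
under eq_bigr do rewrite -L2sqnormE.
by move/eqP; rewrite addrC addr_eq0 => /eqP.
Qed.

(** The growth rate per head: the steady state equation reads - Laplacian u = r * reaction u * u. It
    is bounded, and its mean is what determines the limit of u. *)
Definition reaction (U : 'rV[R]_n -> R) x : R := p x * expR (- U x) - delta x.

Lemma measurable_expRN (U : 'rV[R]_n -> R) : measurable_fun Omega U -> measurable_fun Omega (fun x => expR (- U x)).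
Proof.
move=> mU; apply: (measurableT_comp (f := fun t : R => expR (- t))) => //.
by apply: continuous_measurable_fun => t; apply: (continuous_comp (opp_continuous _)); exact: continuous_expR.
Qed.

Lemma measurable_reaction (U : 'rV[R]_n -> R) : measurable_fun Omega U -> measurable_fun Omega (reaction U).
Proof.
by move=> mU; apply: measurable_funB => //; apply: measurable_funM => //; exact: measurable_expRN.
Qed.

Lemma reaction_le U x : 0 <= U x -> Omega x -> `|reaction U x| <= P + D.
Proof.
move=> U0 Ox; have /andP[p0 pP'] := pP Ox; have /andP[d0 dD] := deltaD Ox.
have := expRN_le1 U0; have := expR_gt0 (- U x) => h1 h2.
by rewrite /reaction ler_norml; apply/andP; split; nra.
Qed.

Lemma ae_eq_is_weak_partial i (u U g : 'rV[R]_n -> R) : measurable_fun Omega u ->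
  measurable_fun Omega U -> {ae mu, forall x, Omega x -> U x = u x} ->
  is_weak_partial Omega i u g -> is_weak_partial Omega i U g.
Proof.
move=> mu' mU Uu [g2 h]; split=> // phi tphi; rewrite -h//.
have mphi : measurable_fun Omega (partial i phi).
  apply: continuous_measurable_rV; apply: smooth_continuous; apply: smooth_partial.
  by case: tphi.
apply: ae_eq_Rintegral => //; [exact: measurable_funM..|].
by apply: filterS Uu => x hx Ox; rewrite hx.
Qed.

(** The last two identities are the equation tested with 1 and with the solution.
    [steady_state_estimate] draws on them instead of the equation. *)
Lemma positive_steady_state (r : R) u : 0 < r ->
  positive_solution Omega 1 (fun x v => r * p x * nicholson v - r * delta x * v) u ->
  exists (U : 'rV[R]_n -> R) (g : 'I_n -> 'rV[R]_n -> R),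
  [/\ L2 Omega U, forall x, 0 <= U x, {ae mu, forall x, Omega x -> U x = u x},
      forall i, is_weak_partial Omega i U (g i) &
   [/\ 0 < \int[mu]_(x in Omega) U x,
       \int[mu]_(x in Omega) (reaction U x * U x) = 0 &
       \sum_i L2sqnorm Omega (g i) = r * \int[mu]_(x in Omega) (reaction U x * U x ^+ 2)]].
Proof.
move=> r0 [u2 nu upos ueq].
have [[L2u _] _] := u2.
have mu' := L2_measurable L2u.
(* [u] is positive only almost everywhere; [U] is nonnegative everywhere. *)
pose U x := `|u x|.
have mU : measurable_fun Omega U by apply: (measurableT_comp (f := fun t : R => `|t|)).
have U0 x : 0 <= U x by exact: normr_ge0.
have L2U : L2 Omega U by apply: (L2_le mO mU _ L2u) => x _; rewrite normr_id.
have Uu : {ae mu, forall x, Omega x -> U x = u x}.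
  by apply: filterS upos => x h Ox; rewrite /U gtr0_norm// h.
have ml := L2_measurable (L2_laplacian drho u2).
have mk := measurable_reaction mU.
have lapE : {ae mu, forall x, Omega x -> laplacian Omega u x = - r * (reaction U x * U x)}.
  apply: filterS2 Uu ueq => x h1 h2 Ox; have := h2 Ox.
  rewrite /reaction (h1 Ox) /nicholson mul1r => /eqP; rewrite addr_eq0 => /eqP ->; ring.
have kU2 : L2 Omega (fun x => reaction U x * U x).
  by apply: (L2_bounded_mul mO mk (M := P + D)) => // x; exact: reaction_le.
have I0 : \int[mu]_(x in Omega) (reaction U x * U x) = 0.
  have := Rintegral_laplacian u2 nu.
  rewrite (ae_eq_Rintegral mO ml _ lapE); last exact: L2_measurable (L2Z (- r) mO kU2).
  by rewrite Rintegral_L2Z// => /eqP; rewrite mulf_eq0 oppr_eq0 gt_eqF//= => /eqP.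
exists U, (fun i => weak_partial Omega i u); split=> //.
  by move=> i; apply: (ae_eq_is_weak_partial _ _ Uu); rewrite //; apply: weak_partialP; case: u2.
split=> //.
  apply: Rintegral_gt0 => //; first exact: L2_integrable.
  by apply: filterS2 upos Uu => x h1 h2 Ox; rewrite h2// h1.
rewrite ip_laplacian// -[RHS]opprK; congr (- _).
rewrite -mulNr -RintegralZl//; last first.
  have := L2_integrableM mO kU2 L2U.
  by congr (_.-integrable _ (EFin \o _)); apply/funext => x; ring.
apply: ae_eq_Rintegral => //.
- exact: measurable_funM.
- by apply: measurable_funM => //; apply: measurable_funM => //; exact: measurable_funX.
- by apply: filterS2 Uu lapE => x h1 h2 Ox; rewrite h2// -h1//; ring.
Qed.

(* The gradient is also bounded relatively to the mean of U, so that the mean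
   can be divided out of the last estimate: no positive lower bound on the mean,
   uniform in r, is available at this stage. *)
Lemma steady_state_estimate : exists C r0 : R, [/\ 0 <= C, 0 < r0 &
  forall (r : R) (U : 'rV[R]_n -> R) (g : 'I_n -> 'rV[R]_n -> R), 0 < r < r0 ->
    L2 Omega U -> (forall x, 0 <= U x) -> (forall i, is_weak_partial Omega i U (g i)) ->
    0 < \int[mu]_(x in Omega) U x ->
    \int[mu]_(x in Omega) (reaction U x * U x) = 0 ->
    \sum_i L2sqnorm Omega (g i) = r * \int[mu]_(x in Omega) (reaction U x * U x ^+ 2) ->
    [/\ 0 < mean Omega U, L2sqnorm Omega (fun x => U x - mean Omega U) <= C * r &
        (\int[mu]_(x in Omega) reaction U x) ^+ 2 <= C * r]].
Proof.
have [Cp Cp0 poinc] := poincare_inequality drho bO cO O0.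
have [x0 Ox0] := O0.
have P0 : 0 <= P by have /andP[] := pP Ox0; exact: le_trans.
have D0 : 0 <= D by have /andP[] := deltaD Ox0; exact: le_trans.
pose K := P + D.
pose C1 := Cp * (4 * P * V).
pose C2 := V * (K ^+ 2 * (Cp * P * (4 * V))).
have CpP : 0 <= Cp * P by exact: mulr_ge0.
have C10 : 0 <= C1 by rewrite /C1 !mulr_ge0// ltW.
have V0' : 0 <= V := ltW V0.
have C20 : 0 <= C2 by apply: mulr_ge0 => //; apply: mulr_ge0; [exact: sqr_ge0|rewrite !mulr_ge0].
(* The bound on [r] gives Cp P r <= 1/4, which lets the relative energy bound be absorbed in
   [N2]. *)
exists (C1 + C2), (4 * (Cp * P + 1))^-1; split; first exact: addr_ge0.
  by rewrite invr_gt0; lra.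
move=> r U g /andP[r_gt0 rr0] U2 U0 Ug EU kU0 GE.
have mU := L2_measurable U2; have mk := measurable_reaction mU.
set m := mean Omega U; set Q := L2sqnorm Omega _; set N := L2sqnorm Omega U.
have m0 : 0 < m by rewrite /m /mean mulr_gt0// invr_gt0.
have kint : mu.-integrable Omega (EFin \o (fun x => reaction U x * U x ^+ 2)).
  have k2 : L2 Omega (fun x => reaction U x * U x).
    by apply: (L2_bounded_mul mO mk (M := P + D)) => // x; exact: reaction_le.
  have := L2_integrableM mO k2 U2.
  by congr (_.-integrable _ (EFin \o _)); apply/funext => x; ring.
have kP x : Omega x -> reaction U x <= P * expR (- U x).
  move=> Ox; have /andP[p0 pP'] := pP Ox; have /andP[d0 dD] := deltaD Ox.
  have := expR_gt0 (- U x) => h; rewrite /reaction; nra.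
(* The same integral is bounded twice: here by a constant, which gives Q = O(r), and in [I2]
   relatively to the norm of [U], which gives Q = O(r m^2). *)
have I1 : \int[mu]_(x in Omega) (reaction U x * U x ^+ 2) <= 4 * P * V.
  rewrite -Rintegral_Ocst; apply: le_Rintegral => //; first exact: finite_integrable_cst.
  move=> x Ox; have := sqr_expRN_le4 (U0 x); have := kP x Ox; have := sqr_ge0 (U x).
  set a := U x ^+ 2; set b := expR _ => h1 h2 h3; nra.
have I2 : \int[mu]_(x in Omega) (reaction U x * U x ^+ 2) <= P * N.
  rewrite -(RintegralZl P mO (L2_integrable_sqr mO U2)); apply: le_Rintegral => //.
    exact: (integrableZl mO P (L2_integrable_sqr mO U2)).
  move=> x Ox; rewrite ler_wpM2r ?sqr_ge0//; apply: le_trans (kP x Ox) _.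
  by rewrite -[leRHS]mulr1 ler_wpM2l// expRN_le1.
have QG := poinc U g U2 Ug; rewrite -/m -/Q GE in QG.
have Q1 : Q <= C1 * r.
  apply: le_trans QG _; rewrite /C1 -mulrA ler_wpM2l// mulrC ler_wpM2r// ltW//.
have Q2 : Q <= Cp * P * r * N.
  apply: le_trans QG _; rewrite -!mulrA ler_wpM2l// mulrCA ler_pM2l//.
have N0 : 0 <= N := L2sqnorm_ge0 _ _.
have Q0 : 0 <= Q := L2sqnorm_ge0 _ _.
have L2m := L2c m; have L2Um : L2 Omega (fun x => U x - m) := L2B mO U2 L2m.
have N1 : N <= 2 * Q + 2 * (m ^+ 2 * V).
  have := L2sqnormD_le mO L2Um L2m.
  rewrite (_ : (fun x => U x - m + m) = U); last by apply/funext => x; rewrite subrK.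
  by rewrite [X in 2 * _ + 2 * X]/L2sqnorm Rintegral_Ocst.
have rC : Cp * P * r <= 4^-1.
  have : r * (4 * (Cp * P + 1)) <= 1.
    by rewrite -ler_pdivlMr ?mul1r; [exact: ltW|lra].
  nra.
(* From N <= 2 Q + 2 m^2 V and Q <= N / 4. *)
have N2 : N <= 4 * V * m ^+ 2.
  have : Cp * P * r * N <= 4^-1 * N by exact: ler_wpM2r.
  lra.
have Q3 : Q <= Cp * P * (4 * V) * r * m ^+ 2.
  apply: le_trans Q2 _.
  have -> : Cp * P * (4 * V) * r * m ^+ 2 = Cp * P * r * (4 * V * m ^+ 2) by ring.
  by rewrite ler_wpM2l// mulr_ge0// ltW.
split=> //.
  by apply: le_trans Q1 _; rewrite ler_pM2r// lerDl.
have K0 : 0 <= K by rewrite addr_ge0.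
have kb x : Omega x -> `|reaction U x * (U x - m)| <= K * `|U x - m|.
  by move=> Ox; rewrite normrM ler_wpM2r// reaction_le.
have [k2 kQ] := sqr_Rintegral_le K0 L2Um (measurable_funM mk (L2_measurable L2Um)) kb.
have L2k : L2 Omega (reaction U) by apply: (L2_of_bounded mO fO mk (M := K)) => x; exact: reaction_le.
(* As reaction * U has integral 0, m times the integral of the reaction is controlled by U - m; the
   square of the right side carries m^2 by [Q3], and m^2 cancels. *)
have E1 : \int[mu]_(x in Omega) (reaction U x * (U x - m)) = - (m * \int[mu]_(x in Omega) reaction U x).
  apply/eqP; rewrite -addr_eq0 -Rintegral_L2Z// -Rintegral_L2D//; last exact: L2Z.
  by rewrite -[eqbRHS]kU0; apply/eqP; apply: eq_Rintegral => x _; ring.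
rewrite E1 sqrrN exprMn -/Q in kQ.
have m20 : 0 < m ^+ 2 by rewrite exprn_gt0.
rewrite -(ler_pM2l m20); apply: le_trans kQ _.
apply: (@le_trans _ _ (C2 * r * m ^+ 2)).
  have -> : C2 * r * m ^+ 2 = V * (K ^+ 2 * (Cp * P * (4 * V) * r * m ^+ 2)) by rewrite /C2; ring.
  by rewrite ler_pM2l// ler_wpM2l// sqr_ge0.
by rewrite mulrC ler_pM2l// ler_pM2r// lerDr.
Qed.

Lemma hopf_equation_split (th h r c q d l1 l2 a b : R) :
  Complex l1 l2 + (cexp (Complex 0 (- th)) * q%:C%C - d%:C%C - Complex 0 h) *
     (c%:C%C + r%:C%C * Complex a b) = 0 ->
  l1 = - ((cos th * q - d) * (c + r * a) + (sin th * q + h) * (r * b)) /\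
  l2 = - ((cos th * q - d) * (r * b) - (sin th * q + h) * (c + r * a)).
Proof.
rewrite /cexp /= expR0 cosN sinN.
move/eqP; rewrite eq_complex /= => /andP[/eqP e1 /eqP e2]; split; lra.
Qed.

Lemma poincare_mean0 (y : 'rV[R]_n -> R) (g : 'I_n -> 'rV[R]_n -> R) (Cp : R) :
  (forall (w : 'rV[R]_n -> R) (g : 'I_n -> 'rV[R]_n -> R), L2 Omega w ->
    (forall i, is_weak_partial Omega i w (g i)) ->
    L2sqnorm Omega (fun x => w x - mean Omega w) <= Cp * \sum_i L2sqnorm Omega (g i)) ->
  L2 Omega y -> (forall i, is_weak_partial Omega i y (g i)) ->
  \int[mu]_(x in Omega) y x = 0 -> L2sqnorm Omega y <= Cp * \sum_i L2sqnorm Omega (g i).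
Proof.
move=> h y2 yg y0; have := h y g y2 yg; rewrite /mean y0 mulr0.
by rewrite (_ : (fun x => y x - 0) = y)//; apply/funext => x; rewrite subr0.
Qed.

Lemma L2sqnorm_shift (y : 'rV[R]_n -> R) (c r : R) : L2 Omega y ->
  \int[mu]_(x in Omega) y x = 0 ->
  L2sqnorm Omega (fun x => c + r * y x) = c ^+ 2 * V + r ^+ 2 * L2sqnorm Omega y.
Proof.
move=> y2 y0.
have i1 := finite_integrable_cst (c ^+ 2) mO fO.
have i2 := integrableZl mO (2 * c * r) (L2_integrable mO fO y2).
have i3 := integrableZl mO (r ^+ 2) (L2_integrable_sqr mO y2).
rewrite /L2sqnorm (_ : (fun x => (c + r * y x) ^+ 2) =
  (fun x => (c ^+ 2 + 2 * c * r * y x) + r ^+ 2 * y x ^+ 2)); last first.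
  by apply/funext => x; ring.
have i12 : mu.-integrable Omega (EFin \o (fun x => c ^+ 2 + 2 * c * r * y x)).
  exact: (integrable_add mO i1 i2).
rewrite (RintegralD mO i12 i3) (RintegralD mO i1 i2) Rintegral_Ocst Rintegral_L2Z//.
by rewrite y0 mulr0 addr0 RintegralZl//; exact: L2_integrable_sqr.
Qed.

(** The common end of both bounds of [hopf_estimate], where [T] is the defect of the averaged real
    or imaginary part. The lower bound on [b ^+ 2] keeps the constant mode from degenerating, and
    c0^2 cancels between the two sides. *)
Lemma hopf_arithmetic (v b c0 Cp K r Z1 Z2 T T1 T2 Z1' Z2' : R) :
  0 < v -> 0 < c0 ^+ 2 -> 0 <= Cp -> 0 <= K -> 0 < r -> 4^-1 <= b ^+ 2 ->
  r ^+ 2 * (Z1 + Z2) <= Cp * K * (c0 ^+ 2 * v) * r ->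
  b * c0 * (v * T) = - r * (T1 + T2) -> T1 ^+ 2 <= v * (K ^+ 2 * Z1') ->
  T2 ^+ 2 <= v * (K ^+ 2 * Z2') -> Z1' + Z2' = Z1 + Z2 ->
  v * T ^+ 2 <= 16 * K ^+ 2 * (Cp * K) * v * r.
Proof.
move=> v0 c02 Cp0 K0 r0 bb rY t1 t2 t3 t4; have v0' := ltW v0.
have q1 : (b * c0) ^+ 2 * (v ^+ 2 * T ^+ 2) = r ^+ 2 * (T1 + T2) ^+ 2.
  by rewrite -!exprMn t1 !exprMn sqrrN.
have q2 : (T1 + T2) ^+ 2 <= 2 * v * K ^+ 2 * (Z1 + Z2).
  have := sqr_ge0 (T1 - T2); rewrite -t4; nra.
have K2 := sqr_ge0 K.
have q3 : r ^+ 2 * (T1 + T2) ^+ 2 <= 2 * v * K ^+ 2 * (Cp * K * (c0 ^+ 2 * v) * r).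
  apply: (@le_trans _ _ (2 * v * K ^+ 2 * (r ^+ 2 * (Z1 + Z2)))).
    rewrite [leRHS]mulrCA; apply: ler_wpM2l q2; exact: sqr_ge0.
  by apply: ler_wpM2l rY; rewrite mulr_ge0// mulr_ge0.
have q4 : 4^-1 * c0 ^+ 2 * (v ^+ 2 * T ^+ 2) <= (b * c0) ^+ 2 * (v ^+ 2 * T ^+ 2).
  rewrite exprMn; apply: ler_wpM2r; first by rewrite mulr_ge0 ?sqr_ge0.
  by rewrite ler_pM2r.
have k0 : 0 < 4^-1 * c0 ^+ 2 * v by rewrite mulr_gt0// mulr_gt0// invr_gt0.
rewrite -(ler_pM2l k0).
have -> : 4^-1 * c0 ^+ 2 * v * (v * T ^+ 2) = 4^-1 * c0 ^+ 2 * (v ^+ 2 * T ^+ 2) by ring.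
apply: le_trans q4 _; rewrite q1; apply: le_trans q3 _.
pose z := c0 ^+ 2 * v * (K ^+ 2 * (Cp * K) * v * r).
have z0 : 0 <= z.
  apply: mulr_ge0; first by apply: mulr_ge0 => //; exact: ltW.
  apply: mulr_ge0; last exact: ltW.
  by apply: mulr_ge0 => //; apply: mulr_ge0 => //; exact: mulr_ge0.
have -> : 4^-1 * c0 ^+ 2 * v * (16 * K ^+ 2 * (Cp * K) * v * r) = 4 * z by rewrite /z; field.
have -> : 2 * v * K ^+ 2 * (Cp * K * (c0 ^+ 2 * v) * r) = 2 * z by rewrite /z; ring.
lra.
Qed.

Lemma ip_sum2 (w1 f1 w2 f2 : 'rV[R]_n -> R) : L2 Omega w1 -> L2 Omega f1 -> L2 Omega w2 ->
  L2 Omega f2 ->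
  ip Omega w1 f1 + ip Omega w2 f2 = \int[mu]_(x in Omega) (w1 x * f1 x + w2 x * f2 x).
Proof.
move=> h1 h2 h3 h4.
exact: (esym (RintegralD mO (L2_integrableM mO h1 h2) (L2_integrableM mO h3 h4))).
Qed.

Section hopf.
Variables (Cp : R).
Hypothesis Cp0 : 0 <= Cp.
Hypothesis poinc : forall (w : 'rV[R]_n -> R) (g : 'I_n -> 'rV[R]_n -> R), L2 Omega w ->
    (forall i, is_weak_partial Omega i w (g i)) ->
    L2sqnorm Omega (fun x => w x - mean Omega w) <= Cp * \sum_i L2sqnorm Omega (g i).

(* The cross terms of the energy identity cancel, so it does not involve h, for
   which no bound is known beforehand. *)
Lemma hopf_estimate (r c0 beta h th : R) (q y1 y2 : 'rV[R]_n -> R) :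
  0 < r -> r * Cp * (P + D) <= 3 / 4 -> 0 < c0 -> 0 <= beta ->
  measurable_fun Omega q -> (forall x, Omega x -> `|q x| <= P) ->
  X1 Omega y1 -> X1 Omega y2 ->
  {ae mu, forall x, Omega x -> laplacian Omega y1 x =
     - ((cos th * q x - delta x) * (beta * c0 + r * y1 x) + (sin th * q x + h) * (r * y2 x)) /\
     laplacian Omega y2 x =
     - ((cos th * q x - delta x) * (r * y2 x) - (sin th * q x + h) * (beta * c0 + r * y1 x))} ->
  (beta ^+ 2 - 1) * c0 ^+ 2 * V + r ^+ 2 * (L2sqnorm Omega y1 + L2sqnorm Omega y2) = 0 ->
  V * (cos th * mean Omega q - mean Omega delta) ^+ 2 <= 16 * (P + D) ^+ 2 * (Cp * (P + D)) * V * r /\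
  V * (sin th * mean Omega q + h) ^+ 2 <= 16 * (P + D) ^+ 2 * (Cp * (P + D)) * V * r.
Proof.
move=> r0 rsmall c00 b0 mq qP [y1H2 ny1 y10] [y2H2 ny2 y20] aeq nrm.
have [x0 Ox0] := O0.
have P0 : 0 <= P by have /andP[] := pP Ox0; exact: le_trans.
have D0 : 0 <= D by have /andP[] := deltaD Ox0; exact: le_trans.
have V0' : 0 <= V := ltW V0.
set K := P + D; have K0 : 0 <= K by rewrite addr_ge0.
have [[L1 _] _] := y1H2; have [[L2' _] _] := y2H2.
pose A x := cos th * q x - delta x.
pose s x := sin th * q x.
pose c := beta * c0.
pose w1 x := c + r * y1 x.
pose w2 x := r * y2 x.
have c1 : `|cos th| <= 1 by rewrite ler_norml cos_geN1 cos_le1.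
have s1 : `|sin th| <= 1 by rewrite ler_norml sin_geN1 sin_le1.
have mA : measurable_fun Omega A by apply: measurable_funB => //; apply: measurable_funM.
have ms : measurable_fun Omega s by apply: measurable_funM.
have AK x : Omega x -> `|A x| <= K.
  move=> Ox; apply: le_trans (ler_normB _ _) _; rewrite normrM; apply: lerD.
    by rewrite -[leRHS]mul1r; apply: ler_pM => //; exact: qP.
  by have /andP[d0 dD] := deltaD Ox; rewrite ger0_norm.
have sP x : Omega x -> `|s x| <= P.
  by move=> Ox; rewrite normrM -[leRHS]mul1r; apply: ler_pM => //; exact: qP.
have L2A : L2 Omega A := L2_of_bounded mO fO mA AK.
have L2s : L2 Omega s := L2_of_bounded mO fO ms sP.
have L2q : L2 Omega q := L2_of_bounded mO fO mq qP.
have L2d : L2 Omega delta.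
  by apply: (L2_of_bounded mO fO mdelta (M := D)) => x /deltaD /andP[d0 dD]; rewrite ger0_norm.
have bA f : L2 Omega f -> L2 Omega (fun x => A x * f x) := L2_bounded_mul mO mA AK.
have bs f : L2 Omega f -> L2 Omega (fun x => s x * f x) := L2_bounded_mul mO ms sP.
have L2w1 : L2 Omega w1 := L2D mO (L2c c) (L2Z r mO L1).
have L2w2 : L2 Omega w2 := L2Z r mO L2'.
pose B x := s x + h.
have bB f : L2 Omega f -> L2 Omega (fun x => B x * f x).
  move=> f2; have := L2D mO (bs _ f2) (L2Z h mO f2).
  by congr (L2 _ _); apply/funext => x; rewrite /B mulrDl.
pose f1 x := A x * w1 x + B x * w2 x.
pose f2 x := A x * w2 x - B x * w1 x.
have L2f1 : L2 Omega f1 := L2D mO (bA _ L2w1) (bB _ L2w2).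
have L2f2 : L2 Omega f2 := L2B mO (bA _ L2w2) (bB _ L2w1).
have ml1 := L2_measurable (L2_laplacian drho y1H2).
have ml2 := L2_measurable (L2_laplacian drho y2H2).
have e1 : {ae mu, forall x, Omega x -> laplacian Omega y1 x = - f1 x}.
  by apply: filterS aeq => x hx Ox; case: (hx Ox).
have e2 : {ae mu, forall x, Omega x -> laplacian Omega y2 x = - f2 x}.
  by apply: filterS aeq => x hx Ox; case: (hx Ox).
have mN (f : 'rV[R]_n -> R) : L2 Omega f -> measurable_fun Omega (fun x => - f x).
  by move=> f2'; apply: measurable_funN; exact: L2_measurable f2'.
have lapI y f : L2 Omega f -> H2 Omega y -> neumann Omega y ->
   {ae mu, forall x, Omega x -> laplacian Omega y x = - f x} ->
   \int[mu]_(x in Omega) f x = 0 /\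
   \sum_i L2sqnorm Omega (weak_partial Omega i y) = ip Omega y f.
  move=> Lf yH2 ny ae1; have ml := L2_measurable (L2_laplacian drho yH2).
  have := Rintegral_laplacian yH2 ny; rewrite (ae_eq_Rintegral mO ml (mN _ Lf) ae1).
  rewrite (_ : (fun x => - f x) = (fun x => -1 * f x)); last by apply/funext => x; rewrite mulN1r.
  rewrite Rintegral_L2Z// mulN1r => /eqP; rewrite oppr_eq0 => /eqP If; split=> //.
  have [[Ly _] _] := yH2.
  rewrite ip_laplacian// (_ : ip Omega y (laplacian Omega y) = ip Omega y (fun x => -1 * f x)).
    by rewrite (ipZr (-1) mO Lf Ly) mulN1r opprK.
  apply: ae_eq_Rintegral => //.
  - by apply: measurable_funM => //; exact: L2_measurable Ly.
  - apply: measurable_funM; [exact: L2_measurable Ly|exact: L2_measurable (L2Z (-1) mO Lf)].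
  - by apply: filterS ae1 => x hx Ox; rewrite hx// mulN1r.
have [I1 S1] := lapI _ _ L2f1 y1H2 ny1 e1.
have [I2 S2] := lapI _ _ L2f2 y2H2 ny2 e2.
have wp1 i := weak_partialP i y1H2.1; have wp2 i := weak_partialP i y2H2.1.
have Y1 := poincare_mean0 poinc L1 wp1 y10.
have Y2 := poincare_mean0 poinc L2' wp2 y20.
set S1' := \sum_i _ in S1 Y1; set S2' := \sum_i _ in S2 Y2.
have nw1 := L2sqnorm_shift c r L1 y10; have nw2 := L2sqnormZ r mO L2'.
set Z1 := L2sqnorm Omega y1 in nrm Y1 nw1; set Z2 := L2sqnorm Omega y2 in nrm Y2 nw2.
(* Since [f1] has integral 0, the constant [c] may be added to r y1, so the equations are in effect
   tested with [w1] and [w2]. The normalization of the Hopf system evaluates |w1|^2 + |w2|^2 as c0^2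
   V. *)
have rS : r * (S1' + S2') <= K * (c0 ^+ 2 * V).
  have t1 : r * S1' = ip Omega w1 f1.
    rewrite S1 -(ipZl r mO L1 L2f1) /w1 (ipDl mO (L2c c) (L2Z r mO L1) L2f1).
    rewrite {2}/ip (Rintegral_L2Z c L2f1) I1 mulr0 add0r//.
  have t2 : r * S2' = ip Omega w2 f2 by rewrite S2 -(ipZl r mO L2' L2f2).
  have i1 := L2_integrableM mO L2w1 L2f1; have i2 := L2_integrableM mO L2w2 L2f2.
  have -> : r * (S1' + S2') = \int[mu]_(x in Omega) (w1 x * f1 x + w2 x * f2 x).
    by rewrite mulrDr t1 t2; exact: (ip_sum2 L2w1 L2f1 L2w2 L2f2).
  have -> : c0 ^+ 2 * V = L2sqnorm Omega w1 + L2sqnorm Omega w2.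
    by rewrite nw1 nw2 /c; apply/eqP; rewrite -subr_eq0 -oppr_eq0 -[eqbRHS]nrm; apply/eqP; ring.
  have j1 := L2_integrable_sqr mO L2w1; have j2 := L2_integrable_sqr mO L2w2.
  have j12 : mu.-integrable Omega (EFin \o (fun x => w1 x ^+ 2 + w2 x ^+ 2)) := integrable_add mO j1 j2.
  rewrite /L2sqnorm -(RintegralD mO j1 j2) -(RintegralZl K mO j12).
  apply: le_Rintegral => //.
  - exact: (integrable_add mO i1 i2).
  - exact: (integrableZl mO K j12).
  - move=> x Ox; have -> : w1 x * f1 x + w2 x * f2 x = A x * (w1 x ^+ 2 + w2 x ^+ 2).
      by rewrite /f1 /f2; ring.
    rewrite ler_wpM2r ?addr_ge0 ?sqr_ge0//; apply: le_trans (ler_norm _) _; exact: AK.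
have Z10 : 0 <= Z1 := L2sqnorm_ge0 _ _; have Z20 : 0 <= Z2 := L2sqnorm_ge0 _ _.
have rY : r ^+ 2 * (Z1 + Z2) <= Cp * K * (c0 ^+ 2 * V) * r.
  apply: (@le_trans _ _ (r * Cp * (r * (S1' + S2')))).
    have -> : r * Cp * (r * (S1' + S2')) = r ^+ 2 * (Cp * S1' + Cp * S2') by ring.
    exact: (ler_wpM2l (sqr_ge0 r) (lerD Y1 Y2)).
  have -> : Cp * K * (c0 ^+ 2 * V) * r = r * Cp * (K * (c0 ^+ 2 * V)) by ring.
  by rewrite ler_wpM2l// mulr_ge0// ltW.
have c02 : 0 < c0 ^+ 2 by rewrite exprn_gt0.
have cV : 0 < c0 ^+ 2 * V by rewrite mulr_gt0.
(* By the normalization, (1 - beta^2) c0^2 V is the squared norm of r z, at most 3/4 of c0^2 V for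
   small [r]. *)
have bb : 4^-1 <= beta ^+ 2.
  have h1 : (1 - beta ^+ 2) * (c0 ^+ 2 * V) <= (3 / 4) * (c0 ^+ 2 * V).
    have -> : (1 - beta ^+ 2) * (c0 ^+ 2 * V) = r ^+ 2 * (Z1 + Z2) by lra.
    apply: le_trans rY _.
    have -> : Cp * K * (c0 ^+ 2 * V) * r = r * Cp * K * (c0 ^+ 2 * V) by ring.
    by rewrite ler_wpM2r// ltW.
  by move: h1; rewrite ler_pM2r//; lra.
have EA : \int[mu]_(x in Omega) A x = V * (cos th * mean Omega q - mean Omega delta).
  rewrite /A (_ : (fun x => _) = (fun x => cos th * q x + -1 * delta x)); last first.
    by apply/funext => x; rewrite mulN1r.
  rewrite Rintegral_L2D ?Rintegral_L2Z ?Rintegral_mean//; [ring|exact: L2Z..].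
have EB : \int[mu]_(x in Omega) B x = V * (sin th * mean Omega q + h).
  rewrite /B Rintegral_L2D// Rintegral_L2Z// Rintegral_Ocst Rintegral_mean; ring.
have Ky (f b : 'rV[R]_n -> R) (M : R) : 0 <= M -> M <= K -> L2 Omega f -> measurable_fun Omega b ->
    (forall x, Omega x -> `|b x| <= M) ->
    (\int[mu]_(x in Omega) (b x * f x)) ^+ 2 <= V * (K ^+ 2 * L2sqnorm Omega f).
  move=> M0 MK Lf mb bM.
  have bf x : Omega x -> `|b x * f x| <= M * `|f x| by move=> Ox; rewrite normrM ler_wpM2r// bM.
  have [_ hb] := sqr_Rintegral_le M0 Lf (measurable_funM mb (L2_measurable Lf)) bf.
  apply: le_trans hb _; rewrite ler_pM2l// ler_wpM2r ?L2sqnorm_ge0//.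
  by rewrite ler_sqr ?nnegrE// (le_trans M0).
have PK : P <= K by rewrite lerDl.
have k1 := Ky _ _ _ K0 (lexx K) L1 mA AK; have k2 := Ky _ _ _ K0 (lexx K) L2' mA AK.
have k3 := Ky _ _ _ P0 PK L1 ms sP; have k4 := Ky _ _ _ P0 PK L2' ms sP.
rewrite -/Z1 in k1 k3; rewrite -/Z2 in k2 k4.
(* In the averaged equation the unknown [h] multiplies [y2], which has mean 0; so [B] reduces to the
   bounded [s]. *)
have eI1 : c * (\int[mu]_(x in Omega) A x) =
  - r * (\int[mu]_(x in Omega) (A x * y1 x) + \int[mu]_(x in Omega) (s x * y2 x)).
  have : \int[mu]_(x in Omega) ((c * A x + r * (A x * y1 x)) + (r * (s x * y2 x) + r * h * y2 x)) = 0.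
    by rewrite -[RHS]I1; apply: eq_Rintegral => x _; rewrite /f1 /w1 /w2 /B; ring.
  have a1 := L2Z c mO L2A; have a2 := L2Z r mO (bA _ L1); have a3 := L2Z r mO (bs _ L2').
  have a4 := L2Z (r * h) mO L2'.
  rewrite (Rintegral_L2D (L2D mO a1 a2) (L2D mO a3 a4)) (Rintegral_L2D a1 a2) (Rintegral_L2D a3 a4).
  rewrite (Rintegral_L2Z c L2A) (Rintegral_L2Z r (bA _ L1)) (Rintegral_L2Z r (bs _ L2')) (Rintegral_L2Z (r * h) L2').
  rewrite y20 => hh; lra.
have eI2 : c * (\int[mu]_(x in Omega) B x) =
  r * (\int[mu]_(x in Omega) (A x * y2 x) - \int[mu]_(x in Omega) (s x * y1 x)).
  have L2B' : L2 Omega B := L2D mO L2s (L2c h).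
  have : \int[mu]_(x in Omega) ((r * (A x * y2 x) + - c * B x) + (- r * (s x * y1 x) + - (r * h) * y1 x)) = 0.
    by rewrite -[RHS]I2; apply: eq_Rintegral => x _; rewrite /f2 /w1 /w2 /B; ring.
  have a1 := L2Z (- c) mO L2B'; have a2 := L2Z r mO (bA _ L2'); have a3 := L2Z (- r) mO (bs _ L1).
  have a4 := L2Z (- (r * h)) mO L1.
  rewrite (Rintegral_L2D (L2D mO a2 a1) (L2D mO a3 a4)) (Rintegral_L2D a2 a1) (Rintegral_L2D a3 a4).
  rewrite (Rintegral_L2Z (- c) L2B') (Rintegral_L2Z r (bA _ L2')) (Rintegral_L2Z (- r) (bs _ L1)) (Rintegral_L2Z (- (r * h)) L1).
  rewrite y10 => hh; lra.
have fin := hopf_arithmetic V0 c02 Cp0 K0 r0 bb rY.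
rewrite -/c in fin.
split.
  by apply: (fin _ _ _ Z1 Z2 _ k1 k4) => //; rewrite -EA.
(* The imaginary part has the same form with [y1] and [y2] exchanged, hence the swapped norms. *)
apply: (fin _ (- \int[mu]_(x in Omega) (A x * y2 x)) (\int[mu]_(x in Omega) (s x * y1 x)) Z2 Z1).
- by rewrite -EB eI2; ring.
- by rewrite sqrrN.
- exact: k3.
- exact: addrC.
Qed.

End hopf.

End steady_states.

(** * Limits of the angle and of the frequency *)

Section limits.
Context {R : realType}.
Implicit Types f g : R -> R.

Lemma cvg0_of_sqr_le (f : R -> R) (C : R) :
  (\forall d \near +oo, f d ^+ 2 <= C * d^-1) -> f d @[d --> +oo] --> (0 : R).
Proof.
move=> h; apply/cvgr0Pnorm_lt => e e0.
have e2 : 0 < e ^+ 2 by rewrite exprn_gt0.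
near=> d.
have d0 : 0 < d by near: d; exact: nbhs_pinfty_gt.
have dC : `|C| / e ^+ 2 < d by near: d; apply: nbhs_pinfty_gt; exact: num_real.
have fd : f d ^+ 2 <= C * d^-1 by near: d.
rewrite -(ltr_pXn2r (n := 2))// ?nnegrE// ?ltW// -normrX ger0_norm ?sqr_ge0//.
apply: le_lt_trans fd _; rewrite ltr_pdivrMr//.
by apply: le_lt_trans (ler_norm C) _; move: dC; rewrite ltr_pdivrMr// mulrC.
Unshelve. all: by end_near. Qed.

Lemma near_cvg_pinfty (f g : R -> R) (a b : R) : f d @[d --> +oo] --> a -> a = b ->
  (\forall d \near +oo, f d = g d) -> g d @[d --> +oo] --> b.
Proof. by move=> fa <- fg; move: fa; apply: cvg_trans; exact: near_eq_cvg. Qed.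

(** The first bound gives m through a logarithm, the second X -> - b, and the third cos theta, since
    b is not 0. The cosine leaves two candidates for theta in [0, 2 pi); in the fourth bound h > 0
    and X < 0 exclude sin theta <= 0, so theta is the arc cosine, and h = (sin theta X + h) - sin
    theta X converges last. *)
Lemma hopf_angle_cvg (pbar dbar c0 C : R) (m X h th : R -> R) :
  0 < pbar -> 0 < dbar -> c0 = ln (pbar / dbar) -> 2 < c0 ->
  (\forall d \near +oo, [/\ 0 < h d, 0 <= th d < 2 * pi &
   [/\ (pbar * expR (- m d) - dbar) ^+ 2 <= C * d^-1,
    (X d - pbar * expR (- m d) * (1 - m d)) ^+ 2 <= C * d^-1,
    (cos (th d) * X d - dbar) ^+ 2 <= C * d^-1 &
    (sin (th d) * X d + h d) ^+ 2 <= C * d^-1]]) ->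
  th d / h d @[d --> +oo] -->
    acos (1 / (1 - c0)) / (dbar * Num.sqrt (c0 ^+ 2 - 2 * c0)).
Proof.
move=> p0 d0 c0E c02 H.
pose b := dbar * (c0 - 1); have b0 : 0 < b by rewrite mulr_gt0//; lra.
have h1 : pbar * expR (- m d) - dbar @[d --> +oo] --> (0 : R).
  by apply: (@cvg0_of_sqr_le _ C); apply: filterS H => d [_ _ []].
have h2 : X d - pbar * expR (- m d) * (1 - m d) @[d --> +oo] --> (0 : R).
  by apply: (@cvg0_of_sqr_le _ C); apply: filterS H => d [_ _ []].
have h3 : cos (th d) * X d - dbar @[d --> +oo] --> (0 : R).
  by apply: (@cvg0_of_sqr_le _ C); apply: filterS H => d [_ _ []].
have h4 : sin (th d) * X d + h d @[d --> +oo] --> (0 : R).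
  by apply: (@cvg0_of_sqr_le _ C); apply: filterS H => d [_ _ []].
have pE : pbar * expR (- m d) @[d --> +oo] --> dbar.
  apply: (near_cvg_pinfty (cvgD h1 (cvg_cst dbar))); first by rewrite add0r.
  by near=> d; rewrite /= subrK.
have E1 : expR (- m d) @[d --> +oo] --> pbar^-1 * dbar.
  apply: (near_cvg_pinfty (cvgM (cvg_cst pbar^-1) pE) erefl).
  by near=> d; rewrite /= mulrA mulVf ?mul1r// gt_eqF.
have m1 : m d @[d --> +oo] --> c0.
  have l0 : 0 < pbar^-1 * dbar by rewrite mulr_gt0// invr_gt0.
  apply: (near_cvg_pinfty (cvgN (continuous_cvg _ (continuous_ln l0) E1))).
    rewrite c0E (_ : pbar^-1 * dbar = (pbar / dbar)^-1); last by rewrite invfM invrK mulrC.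
    by rewrite lnV ?opprK// posrE divr_gt0.
  by near=> d; rewrite /= expRK opprK.
have X1 : X d @[d --> +oo] --> - b.
  apply: (near_cvg_pinfty (cvgD h2 (cvgM pE (cvgB (cvg_cst (1 : R)) m1)))).
    by rewrite /b; ring.
  by near=> d; rewrite /= subrK.
have Xneg : \forall d \near +oo, X d < - (b / 2).
  by apply: (cvgr_lt _ X1); lra.
have cX : cos (th d) * X d @[d --> +oo] --> dbar.
  apply: (near_cvg_pinfty (cvgD h3 (cvg_cst dbar))); first by rewrite add0r.
  by near=> d; rewrite /= subrK.
have bn0 : - b != 0 by rewrite oppr_eq0 gt_eqF.
have cos1 : cos (th d) @[d --> +oo] --> 1 / (1 - c0).
  apply: (near_cvg_pinfty (cvgM cX (cvgV bn0 X1))); first by rewrite /b; field; lra.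
  near=> d; have Xd : X d < - (b / 2) by near: d.
  by rewrite /= mulfK// lt_eqF//; lra.
set k := 1 / (1 - c0) in cos1 *.
have kE : k * (1 - c0) = 1 by rewrite /k div1r mulVf//; lra.
have k1 : -1 < k < 0 by apply/andP; split; nra.
have k2 : 0 < 1 - k ^+ 2 by case/andP: k1 => ? ?; nra.
set s0 := Num.sqrt (1 - k ^+ 2).
have s00 : 0 < s0 by rewrite sqrtr_gt0.
have s02 : s0 ^+ 2 = 1 - k ^+ 2 by rewrite sqr_sqrtr// ltW.
have sc : Num.sqrt (1 - cos (th d) ^+ 2) @[d --> +oo] --> s0.
  apply: (continuous_cvg _ (@sqrt_continuous R _)).
  apply: cvgB; first exact: cvg_cst.
  by rewrite expr2; under eq_fun do rewrite expr2; exact: cvgM.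
have sgt : \forall d \near +oo, s0 / 2 < Num.sqrt (1 - cos (th d) ^+ 2).
  by apply: (cvgr_gt _ sc); lra.
(* If sin theta <= 0, then - sin theta > s0 / 2 and - X > b / 2, so sin theta X alone exceeds b s0 /
   4 and h > 0 only adds to it. *)
have w1 : \forall d \near +oo, sin (th d) * X d + h d < b * s0 / 4.
  by apply: (cvgr_lt _ h4); rewrite divr_gt0// mulr_gt0.
have sinE : \forall d \near +oo, 0 < sin (th d).
  apply: filterS2 (filterI Xneg w1) (filterI H sgt) => d [Xd wd] [[hd _ _] sd].
  rewrite ltNge; apply/negP => sle.
  have e : Num.sqrt (1 - cos (th d) ^+ 2) = - sin (th d).
    by rewrite -sin2cos2 sqrtr_sqr ler0_norm.
  rewrite e in sd; nra.
(* A positive sine places theta in [0, pi], where [acos] inverts the cosine. *)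
have thE : \forall d \near +oo, acos (cos (th d)) = th d.
  apply: filterS2 H sinE => d [_ /andP[t0 t1] _] sd.
  rewrite cosK// in_itv/= t0/= leNgt; apply/negP => tp.
  have : 0 <= sin (th d - pi) by apply: sin_ge0_pi; apply/andP; split; lra.
  by rewrite sinB sinpi cospi mulr0 subr0 mulrN1; lra.
have th1 : th d @[d --> +oo] --> acos k.
  have k3 : -1 < k < 1 by case/andP: k1 => ? ?; apply/andP; split; lra.
  exact: (near_cvg_pinfty (continuous_cvg _ (continuous_acos k3) cos1) erefl).
have sin1 : sin (th d) @[d --> +oo] --> s0.
  apply: (near_cvg_pinfty sc erefl); apply: filterS sinE => d sd.
  by rewrite -sin2cos2 sqrtr_sqr gtr0_norm.
have hh : h d @[d --> +oo] --> s0 * b.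
  apply: (near_cvg_pinfty (cvgB h4 (cvgM sin1 X1))); first by ring.
  by near=> d; rewrite /= addrC addKr.
have -> : dbar * Num.sqrt (c0 ^+ 2 - 2 * c0) = s0 * b.
  have sb : 0 <= s0 * (c0 - 1) by apply: mulr_ge0; [exact: ltW|lra].
  rewrite /b (_ : Num.sqrt _ = s0 * (c0 - 1)); first by ring.
  rewrite -(ger0_norm sb) -sqrtr_sqr; congr Num.sqrt.
  by rewrite exprMn s02 /k; field; lra.
by apply: cvgM => //; apply: cvgV => //; rewrite gt_eqF// mulr_gt0.
Unshelve. all: by end_near. Qed.

End limits.

(** * The limit of the first Hopf bifurcation value of the diffusive model *)

Section hopf_limit.
Context {R : realType} {n : nat} (Omega : set 'rV[R]_n) (rho : 'rV[R]_n -> R).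
Hypothesis drho : defining_function Omega rho.
Hypothesis bO : bounded_set Omega.
Hypothesis cO : connected Omega.
Hypothesis O0 : Omega !=set0.
Variables (p delta : 'rV[R]_n -> R).
Hypothesis cp : {within closure Omega, continuous p}.
Hypothesis cdelta : {within closure Omega, continuous delta}.
Hypothesis p0 : forall x, closure Omega x -> 0 < p x.
Hypothesis delta0 : forall x, closure Omega x -> 0 < delta x.

Local Notation mu := (@lebesgue_rV R n).
Local Notation V := (volume Omega).

Let srho : smooth rho. Proof. by case: drho. Qed.
Let OE : Omega = [set x | rho x < 0]. Proof. by case: drho. Qed.
Let mO : measurable Omega := measurable_Omega srho OE.
Let fO : (mu Omega < +oo)%E := finite_Omega srho OE bO.
Let V0 : 0 < V := volume_gt0 drho bO O0.
Let oO : open Omega. Proof. by rewrite -(sublevel0 OE); exact: open_sublevel. Qed.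

Lemma within_closure_measurable (f : 'rV[R]_n -> R) :
  {within closure Omega, continuous f} -> measurable_fun Omega f.
Proof.
move=> cf; apply: open_continuous_measurable_rV => // x Ox.
have := continuous_subspaceW (@subset_closure _ Omega) cf.
by rewrite continuous_open_subspace// => /(_ x); apply; rewrite inE.
Qed.

Lemma within_closure_bounds (f : 'rV[R]_n -> R) :
  {within closure Omega, continuous f} -> (forall x, closure Omega x -> 0 < f x) ->
  exists M : R, forall x, Omega x -> 0 <= f x <= M.
Proof.
move=> cf f0.
have cO' : compact (closure Omega).
  apply: bounded_closed_compact; last exact: closed_closure.
  exact: bounded_closure.
have [M Mb] := compact_continuous_bounded cO' cf.
exists M => x Ox; have cx := subset_closure Ox.
by rewrite ltW ?f0//=; apply: le_trans (Mb x cx); exact: ler_norm.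
Qed.

Lemma mean_gt0 (f : 'rV[R]_n -> R) :
  {within closure Omega, continuous f} -> (forall x, closure Omega x -> 0 < f x) ->
  0 < mean Omega f.
Proof.
move=> cf f0; have [M fM] := within_closure_bounds cf f0.
have mf := within_closure_measurable cf.
have f2 : L2 Omega f.
  by apply: (L2_of_bounded mO fO mf (M := M)) => x /fM /andP[h1 h2]; rewrite ger0_norm.
rewrite /mean mulr_gt0// ?invr_gt0//; apply: (Rintegral_gt0 drho bO O0).
- exact: L2_integrable.
- by move=> x /fM /andP[].
- by apply: aeW => x Ox; apply: f0; exact: subset_closure.
Qed.

Let pbar := mean Omega p.
Let dbar := mean Omega delta.
Let c0 := ln (pbar / dbar).
Hypothesis c0_gt2 : 2 < c0.

(** The witnesses are the mean [m] of the steady state and the mean [X] of p f'(u). The first two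
    bounds replace u by m inside e^(-u) and f'(u), by the Lipschitz constants 1 and 2; the last two
    come from [hopf_estimate]. *)
Lemma hopf_system_estimate : exists C r0 : R, [/\ 0 <= C, 0 < r0 &
  forall (r : R) u z beta h th, 0 < r < r0 ->
  positive_solution Omega 1 (fun x v => r * p x * nicholson v - r * delta x * v) u ->
  hopf_system Omega p delta r u z beta h th ->
  exists m X : R, [/\ (pbar * expR (- m) - dbar) ^+ 2 <= C * r,
    (X - pbar * expR (- m) * (1 - m)) ^+ 2 <= C * r,
    (cos th * X - dbar) ^+ 2 <= C * r & (sin th * X + h) ^+ 2 <= C * r]].
Proof.
have [P pP] := within_closure_bounds cp p0.
have [D dD] := within_closure_bounds cdelta delta0.
have mp := within_closure_measurable cp; have md := within_closure_measurable cdelta.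
have [Cp Cp0 poinc] := poincare_inequality drho bO cO O0.
have [C1 [r1 [C10 r10 sse]]] := steady_state_estimate drho bO cO O0 mp md pP dD.
have [x0 Ox0] := O0.
have P0 : 0 <= P by have /andP[] := pP _ Ox0; exact: le_trans.
have D0 : 0 <= D by have /andP[] := dD _ Ox0; exact: le_trans.
pose C2 := 16 * (P + D) ^+ 2 * (Cp * (P + D)).
pose C3 := (2 * C1 + 2 * (V * (P ^+ 2 * C1))) / V ^+ 2.
pose C4 := V * ((2 * P) ^+ 2 * C1) / V ^+ 2.
have V0' : 0 <= V := ltW V0.
have V2 : 0 < V ^+ 2 by rewrite exprn_gt0.
have K0 : 0 <= P + D by exact: addr_ge0.
have C20 : 0 <= C2.
  by apply: mulr_ge0; [apply: mulr_ge0 => //; exact: sqr_ge0|exact: mulr_ge0].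
have C30 : 0 <= C3.
  apply: divr_ge0; last exact: sqr_ge0.
  by rewrite addr_ge0 ?mulr_ge0// mulr_ge0// mulr_ge0 ?sqr_ge0.
have C40 : 0 <= C4.
  by apply: divr_ge0; [apply: mulr_ge0 => //; apply: mulr_ge0 => //; exact: sqr_ge0|exact: sqr_ge0].
(* Half of the minimum ensures both [r < r1] and r Cp (P + D) <= 1/2, within the 3/4 that
   [hopf_estimate] asks for. *)
exists (C2 + C3 + C4), (Num.min r1 (Cp * (P + D) + 1)^-1 / 2).
have q0 : 0 < Cp * (P + D) + 1 by have := mulr_ge0 Cp0 K0; lra.
split; first by rewrite !addr_ge0.
  by rewrite divr_gt0// lt_min r10 invr_gt0.
move=> r u z beta h th /andP[r0 rr] su [z1 b0 h0 thI [aeq nrm]].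
have rr1 : r < r1.
  have : Num.min r1 (Cp * (P + D) + 1)^-1 <= r1 by rewrite ge_min lexx.
  lra.
have rr2 : r * Cp * (P + D) <= 3 / 4.
  have h1 : Num.min r1 (Cp * (P + D) + 1)^-1 <= (Cp * (P + D) + 1)^-1 by rewrite ge_min lexx orbT.
  have h2 : 2 * r <= (Cp * (P + D) + 1)^-1 by lra.
  have h3 : 2 * r * (Cp * (P + D) + 1) <= 1 by rewrite -ler_pdivlMr// mul1r.
  have h4 := mulr_ge0 (ltW r0) (mulr_ge0 Cp0 K0).
  lra.
have [U [g [L2U U0 Uu Ug [UE kU0 GE]]]] := positive_steady_state drho bO O0 mp md pP dD r0 su.
have [m0 Q1 k1] := sse r U g (introT andP (conj r0 rr1)) L2U U0 Ug UE kU0 GE.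
set m := mean Omega U in m0 Q1.
have mU := L2_measurable L2U.
have meU := measurable_expRN mU.
pose q x := p x * ((1 - U x) * expR (- U x)).
have mq : measurable_fun Omega q.
  by apply: measurable_funM => //; apply: measurable_funM => //; exact: measurable_funB.
have qP x : Omega x -> `|q x| <= P.
  move=> Ox; have /andP[h1 h2] := pP x Ox.
  rewrite normrM -[leRHS]mulr1; apply: ler_pM => //; first by rewrite ger0_norm.
  exact: nicholson'_le1.
have c00 : 0 < c0 by move: c0_gt2; lra.
have [X1y1 X1y2] := z1.
pose y1 x := complex.Re (z x); pose y2 x := complex.Im (z x).
have sysE : {ae mu, forall x, Omega x -> laplacian Omega y1 x =
     - ((cos th * q x - delta x) * (beta * c0 + r * y1 x) + (sin th * q x + h) * (r * y2 x)) /\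
     laplacian Omega y2 x =
     - ((cos th * q x - delta x) * (r * y2 x) - (sin th * q x + h) * (beta * c0 + r * y1 x))}.
  apply: filterS2 aeq Uu => x h1 h2 Ox.
  apply: hopf_equation_split; have := h1 Ox.
  rewrite /laplacianC -/y1 -/y2 /q derive1_nicholson (h2 Ox) /y1 /y2.
  by case: (z x).
have [e3 e4] := hopf_estimate drho bO O0 md pP dD Cp0 poinc r0 rr2 c00 b0 mq qP X1y1 X1y2 sysE nrm.
pose X := mean Omega q.
have sc (T C : R) : 0 <= C -> V * T ^+ 2 <= C * V * r -> T ^+ 2 <= C * r.
  by move=> C00; rewrite mulrAC mulrC ler_pM2r.
have sc2 (T C : R) : (V * T) ^+ 2 <= C * r -> T ^+ 2 <= C / V ^+ 2 * r.
  by rewrite exprMn (mulrAC C) ler_pdivlMr// mulrC.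
have bump (T C C' : R) : T ^+ 2 <= C * r -> C <= C' -> T ^+ 2 <= C' * r.
  by move=> h1 h2; apply: le_trans h1 _; rewrite ler_pM2r.
have L2q : L2 Omega q := L2_of_bounded mO fO mq qP.
have pb x : Omega x -> `|p x| <= P by move=> /pP /andP[h1 h2]; rewrite ger0_norm.
have L2p : L2 Omega p := L2_of_bounded mO fO mp pb.
have L2k : L2 Omega (reaction p delta U).
  apply: (L2_of_bounded mO fO (measurable_reaction mp md mU) (M := P + D)) => x Ox.
  exact: (reaction_le pP dD).
have L2d : L2 Omega delta.
  by apply: (L2_of_bounded mO fO md (M := D)) => x /dD /andP[h1 h2]; rewrite ger0_norm.
have L2Um : L2 Omega (fun x => U x - m) := L2B mO L2U (L2_cst m mO fO).
exists m, X; split.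
- apply: (bump _ C3); last by lra.
  apply: sc2.
  have mf : measurable_fun Omega (fun x => p x * (expR (- m) - expR (- U x))).
    by apply: measurable_funM => //; exact: measurable_funB.
  have bf x : Omega x -> `|p x * (expR (- m) - expR (- U x))| <= P * `|U x - m|.
    move=> Ox; rewrite normrM; apply: ler_pM => //; first exact: pb.
    by rewrite (distrC (U x)); apply: expRN_lipschitz => //; exact: ltW.
  have [L2f fQ] := sqr_Rintegral_le drho bO O0 P0 L2Um mf bf.
  (* The defect is the integral of the reaction, already known to be small, plus the cost of
     freezing U at its mean. *)
  have -> : V * (pbar * expR (- m) - dbar) =
    \int[mu]_(x in Omega) reaction p delta U x +
    \int[mu]_(x in Omega) (p x * (expR (- m) - expR (- U x))).
    rewrite -(Rintegral_L2D drho bO L2k L2f).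
    rewrite mulrBr mulrA -!(Rintegral_mean drho bO O0).
    rewrite mulrC -(Rintegral_L2Z drho bO _ L2p) -[X in _ + X]mulN1r.
    rewrite -(Rintegral_L2Z drho bO (-1) L2d).
    rewrite -(Rintegral_L2D drho bO (L2Z _ mO L2p) (L2Z _ mO L2d)).
    by apply: eq_Rintegral => x _; rewrite /reaction; ring.
  move: k1 fQ; set A := Rintegral _ _ _; set B := Rintegral _ _ _ => k1 fQ.
  have fQ2 : B ^+ 2 <= V * (P ^+ 2 * C1) * r.
    apply: le_trans fQ _; rewrite -mulrA ler_pM2l// -mulrA; exact: (ler_wpM2l (sqr_ge0 P) Q1).
  have := sqr_ge0 (A - B); lra.
- apply: (bump _ C4); last by lra.
  apply: sc2.
  have mf : measurable_fun Omega (fun x => p x * ((1 - U x) * expR (- U x) - (1 - m) * expR (- m))).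
    by apply: measurable_funM => //; apply: measurable_funB => //; apply: measurable_funM => //; exact: measurable_funB.
  have bf x : Omega x -> `|p x * ((1 - U x) * expR (- U x) - (1 - m) * expR (- m))| <= (2 * P) * `|U x - m|.
    move=> Ox; rewrite normrM (mulrC 2) -mulrA; apply: ler_pM => //; first exact: pb.
    by apply: nicholson'_lipschitz => //; exact: ltW.
  have P20 : 0 <= 2 * P by exact: mulr_ge0.
  have [L2f fQ] := sqr_Rintegral_le drho bO O0 P20 L2Um mf bf.
  have -> : V * (X - pbar * expR (- m) * (1 - m)) =
    \int[mu]_(x in Omega) (p x * ((1 - U x) * expR (- U x) - (1 - m) * expR (- m))).
    have -> : V * (X - pbar * expR (- m) * (1 - m)) =
        V * mean Omega q + (- ((1 - m) * expR (- m))) * (V * mean Omega p).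
      by rewrite /X /pbar; move: (mean Omega q) (mean Omega p) => Mq Mp; ring.
    rewrite -!(Rintegral_mean drho bO O0) -(Rintegral_L2Z drho bO _ L2p).
    rewrite -(Rintegral_L2D drho bO L2q (L2Z _ mO L2p)).
    by apply: eq_Rintegral => x _; rewrite /q; ring.
  apply: le_trans fQ _; rewrite -mulrA ler_pM2l// -mulrA; exact: (ler_wpM2l (sqr_ge0 (2 * P)) Q1).
- by apply: (bump _ C2); [exact: sc|lra].
- by apply: (bump _ C2); [exact: sc|lra].
Qed.

Lemma diffusive_first_hopf_value_cvg (a : R) (tau0 : R -> R) : 0 < a ->
  (\forall d \near +oo, diffusive_first_hopf_value Omega p delta a d (tau0 d)) ->
  tau0 d @[d --> +oo] -->
    acos (1 / (1 - c0)) / (dbar * Num.sqrt (c0 ^+ 2 - 2 * c0)).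
Proof.
move=> a0 H.
have [C [r0 [C0 r00 est]]] := hopf_system_estimate.
pose good d q := let: (m, X, h, th) := q in [/\ 0 < h, 0 <= th < 2 * pi, tau0 d = th / h &
   [/\ (pbar * expR (- m) - dbar) ^+ 2 <= C * d^-1,
    (X - pbar * expR (- m) * (1 - m)) ^+ 2 <= C * d^-1,
    (cos th * X - dbar) ^+ 2 <= C * d^-1 &
    (sin th * X + h) ^+ 2 <= C * d^-1]].
have ex : \forall d \near +oo, exists q : R * R * R * R, good d q.
  near=> d.
  have dr : r0^-1 < d by near: d; apply: nbhs_pinfty_gt; exact: num_real.
  have d0 : 0 < d by apply: lt_trans dr; rewrite invr_gt0.
  have : diffusive_first_hopf_value Omega p delta a d (tau0 d) by near: d.
  move=> [us [ur [z [beta [h [th [_ su _ hs tE]]]]]]].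
  have rI : 0 < d^-1 < r0.
    by rewrite invr_gt0 d0/= -[r0]invrK ltf_pV2// posrE ?invr_gt0.
  have [m [X [e1 e2 e3 e4]]] := est _ _ _ _ _ _ rI su hs.
  have [_ _ h0 thI _] := hs.
  exists (m, X, h, th); split=> //.
  by rewrite tE; field; rewrite !gt_eqF.
(* For [d] without a Hopf solution the value is an arbitrary default; by [ex] this does not happen
   for large [d]. *)
have /choice[q hq] : forall d, exists q : R * R * R * R, (exists q, good d q) -> good d q.
  by move=> d; have [[q gq]|ng] := pselect (exists q, good d q); [exists q|exists 0].
have pb := mean_gt0 cp p0; have db := mean_gt0 cdelta delta0.
have Hq : \forall d \near +oo, [/\ 0 < (q d).1.2, 0 <= (q d).2 < 2 * pi &
   [/\ (pbar * expR (- (q d).1.1.1) - dbar) ^+ 2 <= C * d^-1,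
    ((q d).1.1.2 - pbar * expR (- (q d).1.1.1) * (1 - (q d).1.1.1)) ^+ 2 <= C * d^-1,
    (cos (q d).2 * (q d).1.1.2 - dbar) ^+ 2 <= C * d^-1 &
    (sin (q d).2 * (q d).1.1.2 + (q d).1.2) ^+ 2 <= C * d^-1]].
  by apply: filterS ex => d /hq; case: (q d) => [[[m X] h] th] [].
apply: (near_cvg_pinfty (hopf_angle_cvg pb db erefl c0_gt2 Hq) erefl).
by apply: filterS ex => d /hq; case: (q d) => [[[m X] h] th] [].
Unshelve. all: by end_near. Qed.

End hopf_limit.

(** * The scalar delay equation *)

Section real_derivatives.
Context {R : realType}.
Implicit Types (f g : R -> R) (x a b : R).

Lemma is_derive_addf f g x a b : is_derive x (1 : R) f a -> is_derive x (1 : R) g b ->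
  is_derive x (1 : R) (fun t => f t + g t) (a + b).
Proof. by move=> hf hg; have [h1 h2] := is_deriveD hf hg; apply: DeriveDef. Qed.

Lemma is_derive_mulf f g x a b : is_derive x (1 : R) f a -> is_derive x (1 : R) g b ->
  is_derive x (1 : R) (fun t => f t * g t) (f x * b + g x * a).
Proof. by move=> hf hg; have [h1 h2] := is_deriveM hf hg; apply: DeriveDef. Qed.

Lemma is_derive_divf f g x a b : g x != 0 -> is_derive x (1 : R) f a -> is_derive x (1 : R) g b ->
  is_derive x (1 : R) (fun t => f t / g t) (a / g x - f x * b / g x ^+ 2).
Proof.
move=> g0 hf hg; have [h1 h2] := is_deriveM hf (is_deriveV g0 hg); apply: DeriveDef; first exact: h1.
apply: (etrans h2); rewrite /GRing.scale/= -exprVn; field; exact: g0.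
Qed.

Lemma is_derive_compf f g x a b : is_derive (g x) (1 : R) f a -> is_derive x (1 : R) g b ->
  is_derive x (1 : R) (fun t => f (g t)) (a * b).
Proof. by move=> hf hg; have [h1 h2] := is_derive1_comp hf hg; apply: DeriveDef. Qed.

Lemma is_derive_oppf f x a : is_derive x (1 : R) f a -> is_derive x (1 : R) (fun t => - f t) (- a).
Proof. by move=> hf; have [h1 h2] := is_deriveN hf; apply: DeriveDef. Qed.

Lemma is_derive_cstf x a : is_derive x (1 : R) (fun _ => a) 0.
Proof. exact: is_derive_cst. Qed.

Lemma is_derive_idf x : is_derive x (1 : R) (fun t : R => t) 1.
Proof. exact: is_derive_id. Qed.

Lemma is_derive_derive1 f x a : is_derive x (1 : R) f a -> derive1 f x = a.
Proof. by move=> h; rewrite derive1E (@derive_val _ _ _ _ _ _ _ h). Qed.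

Lemma is_derive_derivable f x a : is_derive x (1 : R) f a -> derivable f x 1.
Proof. by case. Qed.

Lemma is_derive_continuous f x a : is_derive x (1 : R) f a -> {for x, continuous f}.
Proof. by move=> [h _]; apply: differentiable_continuous; apply/derivable1_diffP. Qed.

(** Intermediate values and strict monotonicity produce the inverse. It stands in for an implicit
    function theorem on the branch of eigenvalues. Outside the range of [N] the inverse takes a
    default value, harmless for claims local at [N x]. *)
Lemma increasing_local_inverse (N N' : R -> R) (c d x : R) : c < x < d ->
  (forall t, c <= t <= d -> is_derive t (1 : R) N (N' t) /\ 0 < N' t) ->
  exists g : R -> R, [/\ g (N x) = x, is_derive (N x) (1 : R) g (N' x)^-1 &
    \forall y \near N x, c < g y < d /\ N (g y) = y].
Proof.
move=> /andP[cx xd] dN.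
have cN t : c <= t <= d -> {for t, continuous N} by move=> /dN[h _]; exact: is_derive_continuous h.
have wN : {within `[c, d], continuous N}.
  by apply: continuous_in_subspaceT => t; rewrite inE/= in_itv/=; exact: cN.
have incr s t : c <= s -> s < t -> t <= d -> N s < N t.
  apply: (gtr0_derive1_incr (f := N)) => // u; rewrite in_itv/= => /andP[u1 u2].
    by have [] := dN u (introT andP (conj (ltW u1) (ltW u2))); case.
  have [h1 h2] := dN u (introT andP (conj (ltW u1) (ltW u2))).
  by rewrite (is_derive_derive1 h1).
have inj s t : c <= s <= d -> c <= t <= d -> N s = N t -> s = t.
  move=> /andP[s1 s2] /andP[t1 t2] st; apply/eqP; rewrite eq_le !leNgt; apply/andP; split.
    by apply/negP => ts; have := incr t s t1 ts s2; rewrite st ltxx.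
  by apply/negP => ts; have := incr s t s1 ts t2; rewrite st ltxx.
have cd := lt_trans cx xd.
have /choice[g hg] : forall y, exists t, N c < y < N d -> c < t < d /\ N t = y.
  move=> y; have [yI|] := pselect (N c < y < N d); last by exists 0.
  have /andP[y1 y2] := yI.
  have [|t tI Nt] := @IVT _ N c d y (ltW cd) wN.
    by rewrite ge_min le_max (ltW y1) (ltW y2)/= orbT.
  exists t => _; split=> //; move: tI; rewrite in_itv/= => /andP[t1 t2].
  rewrite !lt_neqAle t1 t2 !andbT; apply/andP; split; apply/eqP => te.
    by move: y1; rewrite te Nt ltxx.
  by move: y2; rewrite -te Nt ltxx.
have NcI t : c < t < d -> N c < N t < N d.
  by move=> /andP[t1 t2]; rewrite !incr// ltW.
have gN t : c < t < d -> g (N t) = t.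
  move=> tI; have [/andP[g1 g2] Ng] := hg _ (NcI _ tI).
  by case/andP: tI => t1 t2; apply: inj => //; rewrite !ltW.
have xI : c < x < d by rewrite cx xd.
have nearI : \forall t \near x, c < t < d.
  have : x \in `]c, d[ by rewrite in_itv/= xI.
  by move=> /near_in_itvoo; apply: filterS => t; rewrite in_itv.
exists g; split; first exact: gN.
- have xI' : c <= x <= d by rewrite !ltW.
  apply: (@is_derive_inverse _ N).
  + by apply: filterS nearI => t; exact: gN.
  + by apply: filterS nearI => t /andP[t1 t2]; apply: cN; rewrite !ltW.
  + by have [] := dN x xI'.
  + by rewrite gt_eqF//; have [] := dN x xI'.
- have : N x \in `]N c, N d[ by rewrite in_itv/= NcI.
  by move=> /near_in_itvoo; apply: filterS => y; rewrite in_itv/=; exact: hg.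
Qed.

End real_derivatives.

(** * Characteristic roots of v' = - dl v - b v(t - tau) with dl < b *)

Section scalar_delay.
Context {R : realType} (F : R -> R -> R) (us dl b : R).
Hypothesis FA : derive1 (F^~ us) us = - dl.
Hypothesis FB : derive1 (F us) us = - b.
Hypothesis dl0 : 0 < dl.
Hypothesis dlb : dl < b.

Let b0 : 0 < b := lt_trans dl0 dlb.

(** [w0] solves |dl + i w| = b, and [th0] is the phase in (0, pi) with b e^(-i th0) = - (dl + i w0).
    So i w0 is a root exactly when w0 tau agrees with th0 modulo 2 pi, first at tau = th0 / w0. *)
Let w0 := Num.sqrt (b ^+ 2 - dl ^+ 2).
Let k := - (dl / b).
Let th0 := acos k.

Let kI : -1 < k < 0.
Proof. by rewrite /k ltrN2 oppr_lt0 divr_gt0// andbT ltr_pdivrMr// mul1r. Qed.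

Let kI' : -1 <= k <= 1.
Proof. by case/andP: kI => h1 h2; apply/andP; split; lra. Qed.

Let w02 : w0 ^+ 2 = b ^+ 2 - dl ^+ 2.
Proof. by rewrite sqr_sqrtr// subr_ge0; have := dl0; have := dlb; nra. Qed.

Let w00 : 0 < w0.
Proof. by rewrite sqrtr_gt0 subr_gt0; have := dl0; have := dlb; nra. Qed.

Let th0I : 0 < th0 < pi.
Proof.
case/andP: kI => h1 h2; apply/andP; split.
  by apply: acos_gt0; apply/andP; split; lra.
by apply: acos_ltpi; apply/andP; split; lra.
Qed.

Let cos_th0 : b * cos th0 = - dl.
Proof. by rewrite acosK ?in_itv// /k; field; rewrite gt_eqF. Qed.

Let sin_th0 : b * sin th0 = w0.
Proof.
rewrite sin_acos// -[X in X * _](ger0_norm (ltW b0)) -sqrtr_sqr -sqrtrM ?sqr_ge0//.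
by congr Num.sqrt; rewrite /k; field; rewrite gt_eqF.
Qed.

Lemma eigenvalueE (t x y : R) : Defs.eigenvalue F us t (Complex x y) <->
  x + dl + b * expR (- (x * t)) * cos (y * t) = 0 /\
  y - b * expR (- (x * t)) * sin (y * t) = 0.
Proof.
rewrite /Defs.eigenvalue /characteristic FA FB /cexp /=.
rewrite !(mulr0, mul0r, subr0, addr0, add0r) cosN sinN.
split.
  by move=> /eqP; rewrite eq_complex /= => /andP[/eqP e1 /eqP e2]; split; lra.
by move=> [e1 e2]; apply/eqP; rewrite eq_complex /=; apply/andP; split; apply/eqP; lra.
Qed.

(** Conjugation allows y >= 0. If x >= 0, comparing moduli gives y <= w0, so the phase y t stays
    below th0, where b cos > - dl; then the real part of the characteristic equation is positive. *)
Lemma eigenvalue_Re_lt0 (t : R) l : 0 <= t < th0 / w0 -> Defs.eigenvalue F us t l -> complex.Re l < 0.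
Proof.
case: l => x y /andP[t0 tt] /eigenvalueE.
wlog y0 : y / 0 <= y => [wl [e1 e2]|].
  have [y0|y0] := leP 0 y; first exact: (wl y y0).
  apply: (wl (- y)); first by rewrite oppr_ge0 ltW.
  by rewrite mulNr cosN sinN; split=> //; lra.
move=> [e1 e2] /=; rewrite ltNge; apply/negP => x0.
set E := expR _ in e1 e2.
have E0 : 0 < E := expR_gt0 _.
have E1 : E <= 1 by rewrite expR_le1 oppr_le0 mulr_ge0.
have yw : y <= w0.
  have h : (x + dl) ^+ 2 + y ^+ 2 = b ^+ 2 * E ^+ 2.
    have := cos2Dsin2 (y * t) => c.
    have -> : x + dl = - (b * E * cos (y * t)) by lra.
    have {2}-> : y = b * E * sin (y * t) by lra.
    by rewrite -[RHS]mulr1 -c; ring.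
  have E2 : E ^+ 2 <= 1 by nra.
  have b2 : 0 <= b ^+ 2 := sqr_ge0 b.
  have h2 : b ^+ 2 * E ^+ 2 <= b ^+ 2 by nra.
  have h3 : dl ^+ 2 <= (x + dl) ^+ 2 by have := dl0; nra.
  have h4 : y ^+ 2 <= w0 ^+ 2 by rewrite w02; lra.
  by move: h4; rewrite ler_sqr ?nnegrE// ltW.
have tw : t * w0 < th0 by rewrite -ltr_pdivlMr.
have yt : y * t < th0.
  by apply: le_lt_trans tw; rewrite mulrC; apply: ler_wpM2l.
have yt0 : 0 <= y * t by exact: mulr_ge0.
case/andP: th0I => th1 th2.
have cc : cos th0 < cos (y * t).
  by rewrite ltr_cos// in_itv/=; apply/andP; split=> //; lra.
have bc : - dl < b * cos (y * t) by rewrite -cos_th0 ltr_pM2l.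
have := dl0; have := b0.
set C := cos _ in e1 bc *.
(* A nonnegative cosine contradicts [e1] at once; for a negative one, E <= 1 brings b E C back to b
   C > - dl. *)
move=> ? ?; have [C0|C0] := leP 0 C.
  have : 0 <= b * E * C by rewrite !mulr_ge0// ltW.
  lra.
have : - (b * C) * E <= - (b * C) by nra.
lra.
Qed.

Let tau0_gt0 : 0 < th0 / w0.
Proof. by case/andP: th0I => h _; rewrite divr_gt0. Qed.

Let w0tau : w0 * (th0 / w0) = th0.
Proof. by rewrite mulrC divfK// gt_eqF. Qed.

Lemma eigenvalue_crossing : Defs.eigenvalue F us (th0 / w0) (Complex 0 w0).
Proof.
apply/eigenvalueE; rewrite w0tau mul0r oppr0 expR0 !mulr1 cos_th0 sin_th0.
by split; ring.
Qed.

Lemma eigenvalue_imaginary_axis (t s : R) : Defs.eigenvalue F us t (Complex 0 s) -> s = w0 \/ s = - w0.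
Proof.
move=> /eigenvalueE; rewrite mul0r oppr0 expR0 !mulr1 => -[e1 e2].
have s2 : s ^+ 2 = w0 ^+ 2.
  have := cos2Dsin2 (s * t) => c; rewrite w02.
  have {1}-> : s = b * sin (s * t) by lra.
  have -> : dl = - (b * cos (s * t)) by lra.
  by rewrite sqrrN !exprMn -[X in X - _](mulr1 (b ^+ 2)) -c; ring.
by move/eqP: s2; rewrite eqf_sqr => /orP[/eqP->|/eqP->]; [left|right].
Qed.

(** The imaginary part of the derivative of the characteristic function is tau w0 > 0. *)
Lemma simple_eigenvalue_crossing : simple_eigenvalue F us (th0 / w0) (Complex 0 w0).
Proof.
split; first exact: eigenvalue_crossing.
rewrite FB /cexp /= !(mulr0, mul0r, subr0, addr0, add0r, oppr0) expR0 cosN sinN w0tau !mul1r.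
apply/negP => /eqP /(congr1 (@complex.Im R)) /=.
rewrite !(mulr0, mul0r, subr0, addr0, add0r) => e.
have : 0 < th0 / w0 * w0 by rewrite mulr_gt0.
rewrite -{2}sin_th0; lra.
Qed.

(* Writing (l + dl) t = - phi cot phi + i phi turns the characteristic equation
   into phase_of phi = ln (b t) + dl t. *)
Let N (phi : R) := ln phi - ln (sin phi) - phi * (cos phi / sin phi).
Let M (t : R) := ln t + dl * t + ln b.
(** The derivative of [N], 1/phi - 2 cot phi + phi (1 + cot^2 phi), arranged as a sum of squares so
    that it is visibly positive. *)
Let cotN' (phi : R) := ((1 - phi * (cos phi / sin phi)) ^+ 2 + phi ^+ 2) / phi.

Let is_derive_cot (phi : R) : 0 < phi < pi ->
  is_derive phi (1 : R) (fun t => t * (cos t / sin t))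
    (cos phi / sin phi - phi * (1 + (cos phi / sin phi) ^+ 2)).
Proof.
move=> pI; have s0 := sin_gt0_pi pI; have sn : sin phi != 0 by rewrite gt_eqF.
apply: (is_derive_eq (is_derive_mulf (is_derive_idf phi)
  (is_derive_divf sn (is_derive_cos phi) (is_derive_sin phi)))).
by field.
Qed.

Let is_derive_N (phi : R) : 0 < phi < pi ->
  is_derive phi (1 : R) N (cotN' phi) /\ 0 < cotN' phi.
Proof.
move=> pI; have s0 := sin_gt0_pi pI; have sn : sin phi != 0 by rewrite gt_eqF.
have /andP[p0 _] := pI; have pn : phi != 0 by rewrite gt_eqF.
split; last first.
  by rewrite divr_gt0// ltr_wpDl ?sqr_ge0// exprn_gt0.
have h1 := is_derive1_ln p0.
have h2 := is_derive_compf (is_derive1_ln s0) (is_derive_sin phi).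
apply: (is_derive_eq (is_derive_addf (is_derive_addf h1 (is_derive_oppf h2))
  (is_derive_oppf (is_derive_cot pI)))).
rewrite /cotN'; field; rewrite pn/= sn//.
Qed.

Let is_derive_M (t : R) : 0 < t -> is_derive t (1 : R) M (t^-1 + dl).
Proof.
move=> t0.
apply: (is_derive_eq (is_derive_addf (is_derive_addf (is_derive1_ln t0)
  (is_derive_mulf (is_derive_cstf t dl) (is_derive_idf t))) (is_derive_cstf t (ln b)))).
by ring.
Qed.

Let phase_eigenvalue (phi t : R) : 0 < phi < pi -> 0 < t -> N phi = M t ->
  Defs.eigenvalue F us t (Complex (- dl - phi * (cos phi / sin phi) / t) (phi / t)).
Proof.
move=> pI t0 NM; have s0 := sin_gt0_pi pI; have sn : sin phi != 0 by rewrite gt_eqF.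
have /andP[p0 _] := pI; have pn : phi != 0 by rewrite gt_eqF.
have tn : t != 0 by rewrite gt_eqF.
have yt : phi / t * t = phi by rewrite divfK.
apply/eigenvalueE; rewrite yt.
have E : b * expR (- ((- dl - phi * (cos phi / sin phi) / t) * t)) = phi / (sin phi * t).
  have -> : - ((- dl - phi * (cos phi / sin phi) / t) * t) = ln phi - ln (sin phi) - ln t - ln b.
    have : dl * t + phi * (cos phi / sin phi) = ln phi - ln (sin phi) - ln t - ln b.
      by move: NM; rewrite /N /M; lra.
    by move=> <-; field; rewrite tn sn.
  rewrite !expRD !expRN !lnK ?posrE//; field; rewrite tn sn gt_eqF//.
by rewrite E; split; field; rewrite ?tn ?sn.
Qed.

Let N_th0 : N th0 = M (th0 / w0).
Proof.
have s0 := sin_gt0_pi th0I; have /andP[p0 _] := th0I.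
have sE : sin th0 = w0 / b by rewrite -sin_th0 mulrC mulKf// gt_eqF.
have cE : cos th0 = - dl / b by rewrite -cos_th0 mulrC mulKf// gt_eqF.
rewrite /N /M sE cE !lnM ?lnV ?posrE ?invr_gt0//.
by field; rewrite !gt_eqF.
Qed.

Lemma hopf_value_crossing : hopf_value F us (th0 / w0).
Proof.
exists w0; split=> //; [exact: simple_eigenvalue_crossing|exact: eigenvalue_imaginary_axis|].
have /andP[p0 ppi] := th0I.
set tau := th0 / w0.
(* A closed interval around th0 inside (0, pi), where the derivative of [N] is known. *)
have tI : th0 / 2 < th0 < (th0 + pi) / 2 by apply/andP; split; lra.
have dN t : th0 / 2 <= t <= (th0 + pi) / 2 -> is_derive t (1 : R) N (cotN' t) /\ 0 < cotN' t.
  by move=> /andP[t1 t2]; apply: is_derive_N; apply/andP; split; lra.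
have [g [gN dg hg]] := increasing_local_inverse tI dN.
pose phi t := g (M t).
have phi_tau : phi tau = th0 by rewrite /phi -N_th0 gN.
have dM := is_derive_M tau0_gt0.
have cM : {for tau, continuous M} := is_derive_continuous dM.
have dphi : is_derive tau (1 : R) phi ((cotN' th0)^-1 * (tau^-1 + dl)).
  by apply: (is_derive_compf (f := g) (g := M) _ dM); rewrite -N_th0.
pose x t := - dl - phi t * (cos (phi t) / sin (phi t)) / t.
pose y t := phi t / t.
exists (fun t => Complex (x t) (y t)).
have tn : tau != 0 by rewrite gt_eqF.
have sn : sin th0 != 0 by rewrite gt_eqF// sin_gt0_pi.
have dcot : is_derive tau (1 : R) (fun t => phi t * (cos (phi t) / sin (phi t)))
   ((cos th0 / sin th0 - th0 * (1 + (cos th0 / sin th0) ^+ 2)) * ((cotN' th0)^-1 * (tau^-1 + dl))).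
  apply: (is_derive_compf (f := fun s => s * (cos s / sin s)) _ dphi).
  by rewrite phi_tau; exact: is_derive_cot.
have dx := is_derive_addf (is_derive_cstf tau (- dl)) (is_derive_oppf (is_derive_divf (g := fun t => t) tn dcot (is_derive_idf tau))).
have dy := is_derive_divf (g := fun t => t) tn dphi (is_derive_idf tau).
split.
- congr Complex; rewrite /x /y phi_tau /tau.
    have -> : cos th0 / sin th0 = - dl / w0.
      rewrite -cos_th0 -sin_th0; field; rewrite sn/= gt_eqF//.
    by field; rewrite !gt_eqF.
  by field; rewrite !gt_eqF.
- have near1 : \forall t \near tau, th0 / 2 < g (M t) < (th0 + pi) / 2 /\ N (g (M t)) = M t.
    have hg' : \forall s \near M tau, th0 / 2 < g s < (th0 + pi) / 2 /\ N (g s) = s by rewrite -N_th0.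
    exact: (cM _ hg').
  have near2 : \forall t \near tau, 0 < t by exact: lt_nbhsr.
  apply: filterS2 near1 near2 => t [/andP[g1 g2] Ng] t0.
  by apply: phase_eigenvalue => //; apply/andP; split; rewrite /phi; lra.
- exact: is_derive_derivable dy.
- exact: is_derive_derivable dx.
- have -> : (fun t => complex.Re (Complex (x t) (y t))) = x by [].
  rewrite (is_derive_derive1 dx) phi_tau.
  (* Eliminating dl by this relation turns the speed of the real part into th0^2 / (tau^2 ((1 - th0
     cot th0)^2 + th0^2)), which is positive. *)
  have CE : dl * tau = - (th0 * (cos th0 / sin th0)).
    have -> : cos th0 / sin th0 = - dl / w0.
      rewrite -cos_th0 -sin_th0; field; rewrite sn/= gt_eqF//.
    by rewrite /tau; field; rewrite gt_eqF.
  have -> : dl = - (th0 * (cos th0 / sin th0)) / tau by rewrite -CE; field.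
  set C := cos th0 / sin th0.
  set X := (X in X != 0).
  have D0 : 0 < (1 - th0 * C) ^+ 2 + th0 ^+ 2 by rewrite ltr_wpDl ?sqr_ge0// exprn_gt0.
  have -> : X = th0 ^+ 2 / (tau ^+ 2 * ((1 - th0 * C) ^+ 2 + th0 ^+ 2)).
    rewrite /X /cotN' -/C; field.
    by rewrite tn !gt_eqF.
  by rewrite gt_eqF// divr_gt0 ?exprn_gt0// mulr_gt0// exprn_gt0.
Qed.

Lemma first_hopf_value_crossing :
  first_hopf_value F us (acos (- (dl / b)) / Num.sqrt (b ^+ 2 - dl ^+ 2)).
Proof. by split; [exact: hopf_value_crossing|move=> t l; exact: eigenvalue_Re_lt0]. Qed.

End scalar_delay.

(** Dividing by v > 0 leaves pbar e^(-a v) = dbar, so a v = c0; the scale a then cancels from both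
    derivatives. *)
Lemma nicholson_equilibrium (R : realType) (pbar dbar a : R) : 0 < pbar -> 0 < dbar -> 0 < a ->
  1 < ln (pbar / dbar) ->
  let F := fun u v : R => pbar * v * expR (- (a * v)) - dbar * u in
  let us := ln (pbar / dbar) / a in
  [/\ unique (positive_equilibrium F) us, derive1 (F^~ us) us = - dbar &
      derive1 (F us) us = - (dbar * (ln (pbar / dbar) - 1))].
Proof.
move=> p0 d0 a0; set c0 := ln _ => c01 F us.
have an : a != 0 by rewrite gt_eqF.
have aus : a * us = c0 by rewrite /us mulrC divfK.
have us0 : 0 < us by rewrite divr_gt0//; lra.
have pE : pbar * expR (- c0) = dbar.
  by rewrite expRN lnK ?posrE ?divr_gt0//; field; rewrite !gt_eqF.
split.
- split.
    split=> //; rewrite /F aus mulrAC pE; ring.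
  move=> v [v0 Fv].
  have : expR (a * v) = pbar / dbar.
    have h : v * (pbar * expR (- (a * v)) - dbar) = 0 by rewrite -[RHS]Fv /F; ring.
    move/eqP: h; rewrite mulf_eq0 gt_eqF//= subr_eq0 expRN => /eqP <-.
    by field; rewrite !gt_eqF ?expR_gt0.
  by move=> /(congr1 (@ln R)); rewrite expRK -/c0 -aus => /(mulfI an).
- apply: is_derive_derive1.
  apply: (is_derive_eq (is_derive_addf (is_derive_cstf us (pbar * us * expR (- (a * us))))
    (is_derive_oppf (is_derive_mulf (is_derive_cstf us dbar) (is_derive_idf us))))).
  by ring.
- apply: is_derive_derive1.
  have h1 := is_derive_mulf (is_derive_cstf us a) (is_derive_idf us).
  have h2 := is_derive_compf (is_derive_expR _) (is_derive_oppf h1).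
  have h3 := is_derive_mulf (is_derive_mulf (is_derive_cstf us pbar) (is_derive_idf us)) h2.
  apply: (is_derive_eq (is_derive_addf h3 (is_derive_cstf us (- (dbar * us))))).
  by rewrite aus -pE /us; field.
Qed.

Theorem mainTheorem4 (R : realType) (n : nat) (hn : (0 < n)%N)
  (Omega : set 'rV[R]_n) (hOmega : smooth_bounded_domain Omega)
  (p delta : 'rV[R]_n -> R)
  (hp : {within closure Omega, continuous p})
  (hdelta : {within closure Omega, continuous delta})
  (hp_pos : forall x, closure Omega x -> 0 < p x)
  (hdelta_pos : forall x, closure Omega x -> 0 < delta x)
  (a : R) (ha : 0 < a)
  (hc0 : 2 < ln (mean Omega p / mean Omega delta)) :
  let pbar := mean Omega p in
  let dbar := mean Omega delta in
  let c0 := ln (pbar / dbar) in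
  exists theta0 h0 : R,
    [/\ 0 <= theta0 <= 2 * pi,
        cos theta0 = 1 / (1 - c0),
        sin theta0 = - (Num.sqrt (c0 ^+ 2 - 2 * c0) / (1 - c0)) &
        h0 = dbar * Num.sqrt (c0 ^+ 2 - 2 * c0)] /\
    (forall tau0 : R -> R,
       (\forall d \near +oo,
          diffusive_first_hopf_value Omega p delta a d (tau0 d)) ->
       tau0 d @[d --> +oo] --> theta0 / h0) /\
    (let F := fun u v : R => pbar * v * expR (- (a * v)) - dbar * u in
     exists2 us : R, unique (positive_equilibrium F) us &
       first_hopf_value F us (theta0 / h0)).
Proof.
have [nO _ cO bO [rho drho]] := hOmega.
move=> pbar dbar c0.
have p0 : 0 < pbar := mean_gt0 drho bO nO hp hp_pos.
have d0 : 0 < dbar := mean_gt0 drho bO nO hdelta hdelta_pos.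
have c02 : 2 < c0 := hc0.
set k : R := 1 / (1 - c0).
have kE : k * (1 - c0) = 1 by rewrite /k div1r mulVf//; lra.
have kI : -1 <= k <= 1 by apply/andP; split; nra.
have S0 : 0 < c0 ^+ 2 - 2 * c0 by nra.
exists (acos k), (dbar * Num.sqrt (c0 ^+ 2 - 2 * c0)); split; last split.
- split=> //.
  + have h1 := acos_ge0 kI; have h2 := acos_lepi kI; have h3 := pi_gt0 R.
    by apply/andP; split; lra.
  + by rewrite acosK// in_itv.
  + have s0 : 0 <= - (Num.sqrt (c0 ^+ 2 - 2 * c0) / (1 - c0)).
      rewrite -mulrN -invrN; apply: mulr_ge0; first exact: sqrtr_ge0.
      by rewrite invr_ge0; lra.
    rewrite sin_acos// -[RHS](ger0_norm s0) -sqrtr_sqr; congr Num.sqrt.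
    rewrite sqrrN (expr_div_n (Num.sqrt _)) (sqr_sqrtr (ltW S0)) /k; field; lra.
- move=> tau0; exact: (diffusive_first_hopf_value_cvg drho bO cO nO hp hdelta hp_pos hdelta_pos hc0 ha).
- move=> F; have [|u1 u2 u3] := nicholson_equilibrium p0 d0 ha (_ : 1 < c0); first by lra.
  exists (c0 / a) => //.
  have db : dbar < dbar * (c0 - 1) by rewrite ltr_pMr//; lra.
  (* With dl = dbar and b = dbar (c0 - 1) one has - dl / b = 1 / (1 - c0) and b^2 - dl^2 = dbar^2
     (c0^2 - 2 c0). *)
  have := first_hopf_value_crossing (F := F) u2 u3 d0 db.
  congr (first_hopf_value _ _ (_ / _)).
    have n1 : 1 - c0 != 0 by lra.
    have n2 : c0 - 1 != 0 by lra.
    by congr acos; rewrite -/c0 /k; field; rewrite ?n1 ?n2 ?(gt_eqF d0).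
  apply: esym; rewrite -[X in X * _](ger0_norm (ltW d0)) -sqrtr_sqr -sqrtrM ?sqr_ge0//.
  by congr Num.sqrt; rewrite -/c0; ring.
Qed.
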